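(* Let $\lambda,\mu,\nu$ be partitions of the same integer with $\ell(\lambda)\le3$ and $\ell(\mu),\ell(\nu)\le2$ (padded by zeros), and $\chi=(\lambda_1,\lambda_2,\lambda_3;\mu_1,\mu_2;\nu_1,\nu_2)$. Put $$A=\lambda_1+2\lambda_2-\mu_1-\nu_1,\qquad \ell_0=\max\left\{0,\left\lfloor\tfrac{A+1}{2}\right\rfloor\right\},$$ $$\bar\chi=\chi-\ell_0\,(2,2,0;2,2;2,2)=(L_1,L_2,L_3;M_1,M_2;N_1,N_2).$$ Assume that $\bar\chi$ is dominant (otherwise $g_{\lambda,\mu,\nu}=0$) and, interchanging $\mu$ and $\nu$ if necessary, that $M_1-M_2\le N_1-N_2$ (equivalently $M_2\ge N_2$). Put $$a=L_1-L_2,\quad b=L_2-L_3,\quad c=L_3,\quad \rho=M_1-M_2,\quad h=M_2-N_2,\quad d=M_1+N_1-L_1-2L_2,$$ and, for $x\in\mathbb Z$, $m_x=b-h-2x$ and $$\mathsf L(x)=\max\left\{0,\left\lceil\tfrac{a-d-x}{2}\right\rceil,N_2-2c-x\right\},\qquad \mathsf U(x)=\min\{0,m_x\}+\min\left\{a,\left\lfloor\tfrac{a+h+x}{2}\right\rfloor,M_2-L_2+x\right\}.$$ Then $$g_{\lambda,\mu,\nu}=\sum_{x=0}^{\min\{b,\rho\}}[\mathsf U(x)-\mathsf L(x)+1]_+ .$$ Consequently, on the lattice of admissible triple weights, the function $(\lambda;\mu;\nu)\mapsto g_{\lambda,\mu,\nu}$ is piecewise quasi-polynomial with quasiperiod dividing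 two.
   Context: The Kronecker coefficient $g_{\lambda,\mu,\nu}$ is the multiplicity of the Specht module $S^\lambda$ in $S^\mu\otimes S^\nu$ (characteristic zero). $[r]_+=\max\{r,0\}$. A triple $(L;M;N)$ is dominant if $L_1\ge L_2\ge L_3\ge0$, $M_1\ge M_2\ge0$, $N_1\ge N_2\ge0$. A triple $(\lambda;\mu;\nu)$ of partitions is admissible if the three have the same size, $\ell(\lambda)\le3$ and $\ell(\mu),\ell(\nu)\le2$. Piecewise quasi-polynomial with quasiperiod dividing two means: the admissible parameter space has a finite subdivision into polyhedral chambers such that on each chamber the function is given by a quasi-polynomial, i.e. by a polynomial on each coset of $2\Lambda$ in the lattice $\Lambda$ of integer triples with equal sizes. *)

(* Defs.v *)
From HB Require Import structures.
From mathcomp Require Import all_boot all_order all_algebra.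
From mathcomp Require Import all_fingroup all_solvable all_field all_character.
From mathcomp Require Import mpoly.

Set Implicit Arguments.
Unset Strict Implicit.
Unset Printing Implicit Defensive.

Import Order.TTheory GRing.Theory Num.Theory.
Local Open Scope ring_scope.

(* -------------------------------------------------------------------------- *)
(* Specht modules.                                                            *)
(* -------------------------------------------------------------------------- *)

(* Partitions carry no zero parts; lam_i is [nth 0 lam (i-1)], so reading past
   the end of the sequence is the padding by zeros. *)
Definition is_partition (lam : seq nat) : bool :=
  sorted geq lam && (0%N \notin lam).

(* The cells of the diagram of lam, read row by row, are numbered 0 .. n-1,
   where n = |lam|.  A tableau of shape lam is a permutation t : 'S_n, the entry
   in cell x being t x.  'S_n acts on tableaux by t |-> t * g (that is,
   x |-> g (t x)), a right action as everywhere in MathComp, where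
   representations act on row vectors. *)
Section Specht.

Variables (n : nat) (lam : seq nat).

Definition cell_row (x : 'I_n) : nat := reshape_index lam x.
Definition cell_col (x : 'I_n) : nat := reshape_offset lam x.

(* A tabloid is recorded as the family of the sets of entries of its rows. *)
Definition tabloid (t : 'S_n) : {ffun 'I_(size lam) -> {set 'I_n}} :=
  [ffun i : 'I_(size lam) => [set t x | x in [pred x | cell_row x == i]]].

Definition tabloids : {set {ffun 'I_(size lam) -> {set 'I_n}}} :=
  [set tabloid t | t : 'S_n].

Definition tabloid_act (f : {ffun 'I_(size lam) -> {set 'I_n}}) (g : 'S_n) :
    {ffun 'I_(size lam) -> {set 'I_n}} :=
  [ffun i => g @: f i].

Lemma tabloid_actE t g : tabloid_act (tabloid t) g = tabloid (t * g)%g.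
Proof.
apply/ffunP => i; rewrite !ffunE -imset_comp.
by apply: eq_imset => x /=; rewrite permM.
Qed.

Lemma tabloid_act_in f g : f \in tabloids -> tabloid_act f g \in tabloids.
Proof. by case/imsetP=> t _ ->; rewrite tabloid_actE imset_f. Qed.

Lemma tabloid_act1 f : tabloid_act f 1%g = f.
Proof.
apply/ffunP => i; rewrite ffunE -[RHS]imset_id.
by apply: eq_imset => x; rewrite perm1.
Qed.

Lemma tabloid_actM f g h :
  tabloid_act f (g * h)%g = tabloid_act (tabloid_act f g) h.
Proof.
apply/ffunP => i; rewrite !ffunE -imset_comp.
by apply: eq_imset => x /=; rewrite permM.
Qed.

(* The permutation module M^lam, with basis the tabloids. *)
Definition young_mx (g : 'S_n) : 'M[algC]_#|tabloids| :=
  \matrix_(i, j) (enum_val j == tabloid_act (enum_val i) g)%:R.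

Lemma young_mx_repr : mx_repr [set: 'S_n] young_mx.
Proof.
split=> [|g h _ _]; apply/matrixP => i k; rewrite !mxE.
  by rewrite tabloid_act1 (inj_eq enum_val_inj) eq_sym.
have Dg : tabloid_act (enum_val i) g \in tabloids.
  by apply: tabloid_act_in; apply: enum_valP.
rewrite (bigD1 (enum_rank_in Dg (tabloid_act (enum_val i) g))) //= big1.
  by rewrite addr0 !mxE enum_rankK_in // eqxx mul1r tabloid_actM.
move=> j ne_j; rewrite !mxE; case: eqP => [def_j|_]; last by rewrite mul0r.
by case/eqP: ne_j; apply: enum_val_inj; rewrite enum_rankK_in.
Qed.

Definition young_repr := MxRepresentation young_mx_repr.

Definition column_stab (t : 'S_n) : {set 'S_n} :=
  [set s : 'S_n |
    [forall y, cell_col (t^-1%g (s y)) == cell_col (t^-1%g y)]].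

(* e_t = sum of sgn(s) {s.t} over the column stabiliser of t *)
Definition polytabloid (t : 'S_n) : 'rV[algC]_#|tabloids| :=
  \row_j \sum_(s in column_stab t)
            (-1) ^+ s * (enum_val j == tabloid (t * s)%g)%:R.

Lemma polytabloid_act t g : polytabloid t *m young_mx g = polytabloid (t * g)%g.
Proof.
apply/rowP => k; rewrite !mxE.
under eq_bigr do rewrite !mxE mulr_suml.
rewrite exchange_big /= [RHS](reindex_inj (conjg_inj g)) /=.
apply: eq_big => [s|s _].
  rewrite !inE; apply/forallP/forallP => Cs y.
    by rewrite invMg !permM permK.
  by have:= Cs (g y); rewrite invMg !permM !permK.
have Dts : tabloid (t * s)%g \in tabloids by apply: imset_f.
rewrite (bigD1 (enum_rank_in Dts (tabloid (t * s)%g))) //= big1; last first.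
  move=> j ne_j; case: eqP => [def_j|_]; last by rewrite mulr0 mul0r.
  by case/eqP: ne_j; apply: enum_val_inj; rewrite enum_rankK_in.
rewrite addr0 enum_rankK_in // eqxx mulr1 tabloid_actE odd_permJ.
by congr (_ * (_ == tabloid _)%:R); rewrite conjgE !mulgA mulgK.
Qed.

(* The span of all polytabloids of shape lam. *)
Definition specht_space : 'M[algC]_#|tabloids| :=
  (\sum_(t : 'S_n) <<polytabloid t>>)%MS.

Lemma specht_module : mxmodule young_repr specht_space.
Proof.
apply/mxmoduleP => g _; rewrite sumsmxMr; apply/sumsmx_subP => t _.
rewrite (eqmxMr _ (genmxE _)) [X in (X <= _)%MS]polytabloid_act.
by apply: (sumsmx_sup (t * g)%g) => //; rewrite genmxE.
Qed.

Definition specht_repr := submod_repr specht_module.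

End Specht.

(* The multiplicity of the irreducible representation rS in rV: [irr_comp] is
   the type of rS among the irreducible representations of G, and
   [standard_irr_coef] is the rank of the isotypic component of rV of that type
   divided by the degree of rS (see [mx_rsim_standard]). *)
Definition multiplicity (gT : finGroupType) (G : {group gT}) (m k : nat)
    (rS : mx_representation algC G m) (rV : mx_representation algC G k) : nat :=
  standard_irr_coef rV (irr_comp (DecSocleType (regular_repr algC G)) rS).

(* Meaningful when lam, mu and nu are partitions of the same integer. *)
Definition kronecker (lam mu nu : seq nat) : nat :=
  let n := sumn lam in
  multiplicity (specht_repr n lam)
               (prod_repr (specht_repr n mu) (specht_repr n nu)).

Definition admissible (lam mu nu : seq nat) : bool :=
  [&& is_partition lam, is_partition mu & is_partition nu]
  && [&& sumn mu == sumn lam, sumn nu == sumn lam,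
         (size lam <= 3)%N, (size mu <= 2)%N & (size nu <= 2)%N].

(* -------------------------------------------------------------------------- *)
(* Triple weights (L1, L2, L3; M1, M2; N1, N2).                               *)
(* -------------------------------------------------------------------------- *)

Definition weight_row (R : Type) (l1 l2 l3 m1 m2 n1 n2 : R) : 'rV[R]_7 :=
  \row_i tnth [tuple l1; l2; l3; m1; m2; n1; n2] i.

Notation wL1 x := (x ord0 (@Ordinal 7 0 isT)).
Notation wL2 x := (x ord0 (@Ordinal 7 1 isT)).
Notation wL3 x := (x ord0 (@Ordinal 7 2 isT)).
Notation wM1 x := (x ord0 (@Ordinal 7 3 isT)).
Notation wM2 x := (x ord0 (@Ordinal 7 4 isT)).
Notation wN1 x := (x ord0 (@Ordinal 7 5 isT)).
Notation wN2 x := (x ord0 (@Ordinal 7 6 isT)).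

Definition weight (lam mu nu : seq nat) : 'rV[int]_7 :=
  weight_row (nth 0%N lam 0)%:Z (nth 0%N lam 1)%:Z (nth 0%N lam 2)%:Z
             (nth 0%N mu 0)%:Z (nth 0%N mu 1)%:Z
             (nth 0%N nu 0)%:Z (nth 0%N nu 1)%:Z.

Definition equal_sizes (R : nmodType) (x : 'rV[R]_7) : Prop :=
  wL1 x + wL2 x + wL3 x = wM1 x + wM2 x /\
  wL1 x + wL2 x + wL3 x = wN1 x + wN2 x.

Definition dominant (R : numDomainType) (x : 'rV[R]_7) : bool :=
  [&& wL1 x >= wL2 x, wL2 x >= wL3 x, wL3 x >= 0,
      wM1 x >= wM2 x, wM2 x >= 0, wN1 x >= wN2 x & wN2 x >= 0].

(* -------------------------------------------------------------------------- *)
(* The explicit formula.                                                      *)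
(* -------------------------------------------------------------------------- *)

(* [divz] by 2 rounds down. *)
Definition floor_half (z : int) : int := (z %/ 2)%Z.
Definition ceil_half (z : int) : int := - ((- z) %/ 2)%Z.

Definition shift_coef (chi : 'rV[int]_7) : int :=
  let A := wL1 chi + 2 * wL2 chi - wM1 chi - wN1 chi in
  Num.max 0 (floor_half (A + 1)).

Definition reduced_weight (chi : 'rV[int]_7) : 'rV[int]_7 :=
  chi - shift_coef chi *: weight_row 2 2 0 2 2 2 2.

(* The sum over x, as a function of chibar.  It is only used for dominant
   chibar with M1 - M2 <= N1 - N2, when min(b, rho) >= 0. *)
Definition kronecker_sum (chibar : 'rV[int]_7) : int :=
  let L1 := wL1 chibar in let L2 := wL2 chibar in let L3 := wL3 chibar in
  let M1 := wM1 chibar in let M2 := wM2 chibar in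
  let N1 := wN1 chibar in let N2 := wN2 chibar in
  let a := L1 - L2 in let b := L2 - L3 in let c := L3 in
  let rho := M1 - M2 in let h := M2 - N2 in
  let d := M1 + N1 - L1 - 2 * L2 in
  let m (x : int) := b - h - 2 * x in
  let lower (x : int) :=
    Num.max 0 (Num.max (ceil_half (a - d - x)) (N2 - 2 * c - x)) in
  let upper (x : int) :=
    Num.min 0 (m x)
    + Num.min a (Num.min (floor_half (a + h + x)) (M2 - L2 + x)) in
  \sum_(0 <= x < `|Num.min b rho|%N.+1)
     Num.max 0 (upper x%:Z - lower x%:Z + 1).

(* -------------------------------------------------------------------------- *)
(* Piecewise quasi-polynomials.                                               *)
(* -------------------------------------------------------------------------- *)

(* An affine form x |-> phi.1 . x + phi.2 on Q^7. *)
Definition affine_form := ('rV[rat]_7 * rat)%type.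

Definition affine_eval (phi : affine_form) (x : 'rV[rat]_7) : rat :=
  \sum_i phi.1 ord0 i * x ord0 i + phi.2.

(* A polyhedron is given by finitely many weak affine inequalities. *)
Definition polyhedron := seq affine_form.

Definition in_polyhedron (P : polyhedron) (x : 'rV[rat]_7) : bool :=
  all (fun phi => 0 <= affine_eval phi x) P.

(* A face of P is the locus in P where an affine form that is nonnegative on P
   vanishes (the empty face and P itself arise from the forms 1 and 0). *)
Definition is_face (F : 'rV[rat]_7 -> Prop) (P : polyhedron) : Prop :=
  exists phi : affine_form,
    (forall x, in_polyhedron P x -> 0 <= affine_eval phi x) /\
    (forall x, F x <-> in_polyhedron P x /\ affine_eval phi x = 0).

Definition polyhedral_subdivision (X : 'rV[rat]_7 -> Prop)
    (chambers : seq polyhedron) : Prop :=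
  (forall x, X x <-> exists2 C, C \in chambers & in_polyhedron C x) /\
  (forall C D, C \in chambers -> D \in chambers ->
     is_face (fun x => in_polyhedron C x /\ in_polyhedron D x) C /\
     is_face (fun x => in_polyhedron C x /\ in_polyhedron D x) D).

Definition admissible_space (x : 'rV[rat]_7) : Prop :=
  equal_sizes x /\ dominant x.

Definition rat_weight (chi : 'rV[int]_7) : 'rV[rat]_7 :=
  map_mx (fun z : int => z%:~R) chi.

(* chi and kappa lie in the same coset of q Lambda, Lambda being the lattice of
   the integer weights with equal sizes. *)
Definition same_coset (q : nat) (chi kappa : 'rV[int]_7) : Prop :=
  exists2 y : 'rV[int]_7, equal_sizes y & chi = kappa + y *+ q.

(* f is only looked at on admissible triples; "quasiperiod dividing q" is a
   polynomial on each coset of q Lambda, in each chamber. *)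
Definition piecewise_quasipolynomial (q : nat)
    (f : seq nat -> seq nat -> seq nat -> nat) : Prop :=
  exists2 chambers : seq polyhedron,
    polyhedral_subdivision admissible_space chambers &
    forall C, C \in chambers ->
    forall kappa : 'rV[int]_7, equal_sizes kappa ->
    exists p : {mpoly rat[7]},
    forall lam mu nu : seq nat, admissible lam mu nu ->
      in_polyhedron C (rat_weight (weight lam mu nu)) ->
      same_coset q (weight lam mu nu) kappa ->
      (f lam mu nu)%:R = p.@[rat_weight (weight lam mu nu) ord0].

(* Main.v *)
(* Evaluating the Specht module at the permutation characters of colourings
   (James' submodule argument) identifies its character with the Jacobi-Trudi
   determinant of these characters, and Burnside's lemma then turns the
   Kronecker coefficient into a coefficient of
   (1 - 1/u) (1 - 1/v) s_lambda(u v, u, v, 1).  As there are only four weights,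
   the complete symmetric functions satisfy a recurrence of order four, which
   yields Pieri identities for e_1, e_2, e_3; together with the symmetry under
   mu_1 <-> mu_2 they determine all coefficients.

   With a = lambda_1 - lambda_2, b = lambda_2 - lambda_3, c = lambda_3,
   p = mu_1 - (a + b + 2 c) and q = nu_1 - (a + b + 2 c), the solution is the
   sum over i, j >= 0 of corner (a - 2 i, b, c - 2 j, p + i + j, q + i + j) for
   a small combination corner of indicator functions.  Equivalently, corner is
   the second difference of the solution under the steps
   (a, p, q) -> (a - 2, p + 1, q + 1) and (c, p, q) -> (c - 2, p + 1, q + 1).
   On each summand of the formula these steps move the ends of the interval
   [L(x), U(x)], so the second difference only sees intervals with prescribed
   ends and can be summed over x.  Since corner (b) = corner (b - 2) for
   b > a + c + p + q, shifting chi by l_0 (2, 2, 0; 2, 2; 2, 2) changes nothing.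

   For quasi-polynomiality the double sum is evaluated in closed form by counts
   of lattice points in triangles, which depend on the signs of finitely many
   affine forms w and on parities only.  The chambers are cut out by the walls
   2 w + 1 = 0, which avoid the lattice. *)

Require Import Defs.
From HB Require Import structures.
From mathcomp Require Import all_boot all_order all_algebra.
From mathcomp Require Import all_fingroup all_solvable all_field all_character.
From mathcomp Require Import mpoly.
From mathcomp Require Import zify ring lra.

Set Implicit Arguments.
Unset Strict Implicit.
Unset Printing Implicit Defensive.

Import Order.TTheory GRing.Theory Num.Theory.
Local Open Scope ring_scope.

(** * Specht modules and colourings *)

(** Irreducibility of the Specht modules comes from counting. The tabloid module has character
    [chi + phi], with [chi] the Specht character, and the bound ['[chi, chi + phi] <= 1] forces
    ['[chi] = 1]. The Jacobi-Trudi character also has norm 1 and its product with [chi] is 1, so the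
    two coincide. With at most three rows, dominance amounts to an upper bound on the first part and
    a lower bound on the last, which is why only the first and the last colour are ever estimated.

    The obstacle in the recursion is the boundary of the weight range. As functions of all p and q
    the coefficients change sign under the reflections exchanging the parts of mu or of nu, whereas
    indicator functions extend by zero. The two extensions are compared only for a + c + 2 p >= -1
    and a + c + 2 q >= -1, so the Pieri identities for the solution carry range conditions and
    correction terms.

    The closed form evaluates the double sum itself and not the formula with l_0, so neither the
    shift nor the interchange of mu and nu enters the proof of quasi-polynomiality. *)

Lemma multiplicityE (gT : finGroupType) (G : {group gT}) m k
    (rS : mx_representation algC G m) (rV : mx_representation algC G k) :
  '[cfRepr rS] = 1 -> (multiplicity rS rV)%:R = '[cfRepr rV, cfRepr rS].
Proof.
move=> rS1.
have /irrP[i Di] : cfRepr rS \in irr G by rewrite irrEchar cfRepr_char rS1 /=.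
have sim : mx_rsim rS 'Chi_i by apply: cfRepr_inj; rewrite irrRepr.
rewrite /multiplicity (irr_comp_rsim_pchar _ (algC'G_pchar G) sim).
rewrite irr_reprK_pchar ?algC'G_pchar // (cfRepr_sim (mx_rsim_standard rV)).
rewrite cfRepr_standard Di cfdot_suml (bigD1 i) //= big1 => [|j ne_ji].
  by rewrite addr0 cfdotZl cfdot_irr eqxx mulr1.
by rewrite cfdotZl cfdot_irr (negbTE ne_ji) mulr0.
Qed.

Section Colourings.
Local Open Scope nat_scope.
Variables (n : nat) (J : finType).
Implicit Types (c d : {ffun 'I_n -> J}) (g : 'S_n).

Definition content c : {ffun J -> nat} := [ffun j => #|[set y | c y == j]|].

Definition recolour c g : {ffun 'I_n -> J} := [ffun y => c ((g^-1)%g y)].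

Lemma recolour1 : recolour^~ 1%g =1 id.
Proof. by move=> c; apply/ffunP => y; rewrite ffunE invg1 perm1. Qed.

Lemma recolourM c : act_morph recolour c.
Proof. by move=> g h; apply/ffunP => y; rewrite !ffunE invMg permM. Qed.

Canonical recolour_action := TotalAction recolour1 recolourM.

Lemma content_recolour c g : content (recolour c g) = content c.
Proof.
apply/ffunP => j; rewrite !ffunE -(card_imset _ (@perm_inj _ (g^-1)%g)).
apply: eq_card => y; rewrite inE; apply/imsetP/eqP => [[z] | cy].
  by rewrite inE ffunE => /eqP <- ->.
by exists (g y); rewrite ?inE ?ffunE ?permK ?cy.
Qed.

Lemma sum_content c : \sum_j content c j = n.
Proof.
rewrite -[RHS]card_ord -sum1_card (partition_big c xpredT) //=.
by apply: eq_bigr => j _; rewrite ffunE sum1dep_card.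
Qed.

Lemma content_transitive c d : content c = content d -> exists g, d = recolour c g.
Proof.
move=> eq_cd; have : perm_eq [tuple c i | i < n] [tuple d i | i < n].
  apply/allP => j _; apply/eqP.
  have count_content (e : {ffun _ -> _}) : count_mem j [tuple e i | i < n] = content e j.
    rewrite ffunE count_map /= cardE size_filter /= -enumT.
    by apply: eq_count => y; rewrite /= inE.
  by rewrite !count_content eq_cd.
case/tuple_permP => g Dg.
have {}Dg y : c y = d (g y).
  by have := congr1 (fun s => nth (c y) s y) Dg; rewrite -!tnth_nth !tnth_mktuple.
by exists g; apply/ffunP => y; rewrite ffunE Dg permKV.
Qed.

Lemma content_onto (t : {ffun J -> nat}) : \sum_j t j = n ->
  exists c, content c = t.
Proof.
move=> sum_t; pose s := flatten [seq nseq (t j) j | j <- enum J].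
have size_s : size s == n.
  rewrite size_flatten /shape -map_comp sumnE big_map -sum_t big_enum /=.
  by apply/eqP/eq_bigr => j _; rewrite size_nseq.
exists [ffun y => tnth (Tuple size_s) y]; apply/ffunP => j; rewrite ffunE.
have -> : t j = count_mem j s.
  rewrite count_flatten -map_comp sumnE big_map big_enum /= (bigD1 j) //=.
  rewrite count_nseq /= eqxx mul1n big1 ?addn0 // => k /negbTE.
  by rewrite count_nseq /= => ->.
transitivity (count_mem j [seq tnth (Tuple size_s) y | y <- enum 'I_n]); last first.
  by rewrite map_tnth_enum.
rewrite count_map cardE size_filter -enumT; apply: eq_count => y.
by rewrite !inE ffunE.
Qed.

Definition fixes g c := [forall y, c (g y) == c y].

Lemma fixesE g c : fixes g c = (recolour c g == c).
Proof.
apply/forallP/eqP => [fix_c | fix_c y].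
  by apply/ffunP => y; rewrite ffunE -(eqP (fix_c _)) permKV.
by rewrite -{1}fix_c ffunE permK.
Qed.

(** Burnside's lemma: recolouring is transitive on the colourings of a given content, so there is
    one orbit if the prescribed numbers add up to [n], and none otherwise. *)
Lemma sum_fixes (t : {ffun J -> nat}) :
  \sum_(g : 'S_n) #|[set c | content c == t & fixes g c]|
  = (\sum_j t j == n) * n`!.
Proof.
have [sum_t | ne_t] := eqVneq; last first.
  rewrite mul0n big1 // => g _; apply: eq_card0 => c; rewrite !inE.
  by case: eqP => // Dt; rewrite -Dt sum_content eqxx in ne_t.
have [c0 Dc0] := content_onto sum_t.
pose S := [set c | content c == t].
have actS : [acts [set: 'S_n], on S | recolour_action].
  by apply/actsP => g _ c; rewrite !inE /= content_recolour.
have trS : [transitive [set: 'S_n], on S | recolour_action].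
  apply/imsetP; exists c0; first by rewrite inE Dc0.
  apply/setP => c; rewrite inE; apply/eqP/orbitP => [Dc | [g _ <-]] /=.
    have [|g ->] := @content_transitive c0 c; first by rewrite Dc0 Dc.
    by exists g; rewrite ?inE.
  by rewrite content_recolour.
have := Frobenius_Cauchy actS.
have -> : [set orbit recolour_action [set: 'S_n] c | c in S] = [set S].
  apply/setP => A; rewrite inE; apply/imsetP/eqP => [[c Sc ->] | ->].
    exact: (atransP trS).
  by exists c0; rewrite ?inE ?Dc0 //; apply/esym/(atransP trS); rewrite inE Dc0.
rewrite cards1 cardsT card_Sn => <-; apply: eq_big => [g | g _]; first by rewrite inE.
apply: eq_card => c; rewrite !inE fixesE; congr (_ && _).
apply/eqP/subsetP => [fix_c h /set1P-> | /(_ g (set11 g))]; first by rewrite inE;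
  apply/eqP.
by rewrite inE => /eqP.
Qed.

End Colourings.

(** * Colourings of a diagram with at most three rows *)

Section Cells.
Local Open Scope nat_scope.
Variables (n : nat) (lam : seq nat).
Hypotheses (part_lam : is_partition lam) (size_lam : size lam <= 3) (sum_lam : sumn lam
  = n).
Local Notation lam_ i := (nth 0 lam i).
Local Notation row x := (cell_row lam x).
Local Notation col x := (cell_col lam x).

Lemma part_nth i j : i <= j -> lam_ j <= lam_ i.
Proof.
move=> le_ij; have [le_j|lt_j] := leqP (size lam) j; first by rewrite nth_default.
case/andP: part_lam => s_lam _.
have geq_trans : transitive geq by move=> x y z /= xy yz; apply: leq_trans yz xy.
by apply: (sorted_leq_nth geq_trans leqnn 0 s_lam) => //;
  rewrite inE ?(leq_ltn_trans le_ij).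
Qed.

Lemma cell_rowP (x : 'I_n) : row x < size lam.
Proof. by apply: reshape_indexP; rewrite sum_lam. Qed.

Lemma cell_colP (x : 'I_n) : col x < lam_ (row x).
Proof. by apply: reshape_offsetP; rewrite sum_lam. Qed.

Lemma cell_inj (x y : 'I_n) : row x = row y -> col x = col y -> x = y.
Proof.
move=> eq_r eq_c; apply: val_inj;
  rewrite /= -[LHS](reshape_indexK lam) -[RHS](reshape_indexK lam).
by congr flatten_index.
Qed.

Lemma cell_exists i k : k < lam_ i -> exists x : 'I_n, row x = i /\ col x = k.
Proof.
move=> lt_k; have lt_i : i < size lam by rewrite ltnNge; apply: contraL lt_k => ?;
  rewrite nth_default.
have lt_x : flatten_index lam i k < n by rewrite -sum_lam flatten_indexP.
by exists (Ordinal lt_x); rewrite /cell_row /cell_col /= flatten_indexKl ?flatten_indexKr.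
Qed.

Definition row_colouring : {ffun 'I_n -> 'I_3} := [ffun x => inord (row x)].

Lemma row_colouringE x : row_colouring x = row x :> nat.
Proof. by rewrite ffunE inordK // (leq_trans (cell_rowP x)). Qed.

Definition shape_content : {ffun 'I_3 -> nat} := [ffun i : 'I_3 => lam_ i].

Lemma content_row_colouring : content row_colouring = shape_content.
Proof.
apply/ffunP => i; rewrite !ffunE -[RHS]card_ord.
have cellP k : k < lam_ i -> {x : 'I_n | (row x == i) && (col x == k)}.
  move=> lt_k; apply: sigW; have [x [rx cx]] := cell_exists lt_k.
  by exists x; rewrite rx cx !eqxx.
pose f (k : 'I_(lam_ i)) := sval (cellP k (ltn_ord k)).
have fr k : row (f k) = i by have /andP[/eqP] := svalP (cellP k (ltn_ord k)).
have fc k : col (f k) = k by have /andP[_ /eqP] := svalP (cellP k (ltn_ord k)).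
have inj_f : injective f by move=> k l eq_f; apply: val_inj; rewrite /= -!fc eq_f.
rewrite -cardsT -(card_imset _ inj_f); apply: eq_card => x;
  rewrite inE -val_eqE /= row_colouringE.
apply/eqP/imsetP => [rx | [k _ ->]]; last exact: fr.
have lt_k : col x < lam_ i by rewrite -rx cell_colP.
by exists (Ordinal lt_k) => //; apply: cell_inj; rewrite ?fr ?fc.
Qed.

(** Applied to a colouring of the entries pulled back to the cells by a tableau. Without this
    property the symmetrised polytabloid vanishes, by [polytabloid_collide]. *)
Definition column_injective (d : {ffun 'I_n -> 'I_3}) :=
  forall x y, col x = col y -> d x = d y -> x = y.

Section ColumnInjective.
Variable d : {ffun 'I_n -> 'I_3}.
Hypothesis d_inj : column_injective d.

Lemma col_lt0 (x : 'I_n) : col x < lam_ 0.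
Proof. by apply: leq_trans (cell_colP x) _; apply: part_nth. Qed.

Let cc (x : 'I_n) : 'I_(lam_ 0) := Ordinal (col_lt0 x).

Let cc_inj i : {in [set x | d x == i] &, injective cc}.
Proof.
move=> x y; rewrite !inE => /eqP dx /eqP dy [eq_c].
by apply: d_inj; rewrite ?dx ?dy.
Qed.

Lemma content_color0 : content d ord0 <= lam_ 0.
Proof.
rewrite ffunE -(card_in_imset (@cc_inj ord0)) -[X in _ <= X]card_ord; exact: max_card.
Qed.

(** A column of height three has cells of three distinct colours, so the injection [f] from rows to
    colours is onto and the last colour occurs. *)
Let top_columns k : k < lam_ 2 -> exists2 x, d x = ord_max & col x = k.
Proof.
move=> lt_k; have cellP (i : 'I_3) : {x : 'I_n | (row x == i) && (col x == k)}.
  apply: sigW; have [|x [rx cx]] := @cell_exists i k; last by exists x;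
    rewrite rx cx !eqxx.
  by apply: leq_trans lt_k _; apply: part_nth; rewrite -ltnS.
pose f i := d (sval (cellP i)).
have inj_f : injective f.
  move=> i j; have /andP[/eqP ri /eqP ci] := svalP (cellP i).
  have /andP[/eqP rj /eqP cj] := svalP (cellP j); move=> eq_d.
  by apply: val_inj; rewrite /= -ri -rj; congr cell_row; apply: d_inj; rewrite ?ci ?cj.
exists (sval (cellP (invF inj_f ord_max))); first by rewrite -/(f _) f_invF.
by have /andP[_ /eqP] := svalP (cellP (invF inj_f ord_max)).
Qed.

Let tops := [set k : 'I_(lam_ 0) | k < lam_ 2].
Let card_tops : #|tops| = lam_ 2.
Proof.
have le20 : lam_ 2 <= lam_ 0 by apply: part_nth.
have inj_w : injective (widen_ord le20) by move=> j k /(congr1 val)/= ?; apply: val_inj.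
rewrite -[RHS]card_ord -cardsT -(card_imset _ inj_w).
apply: eq_card => k; rewrite inE; apply/idP/imsetP => [lt_k | [j _ ->]];
  last by apply: (ltn_ord j).
by exists (Ordinal lt_k) => //; apply: val_inj.
Qed.

Let tops_sub : tops \subset cc @: [set x | d x == ord_max].
Proof.
apply/subsetP => k; rewrite inE => lt_k; have [x dx cx] := top_columns lt_k.
by apply/imsetP; exists x; rewrite ?inE ?dx //; apply: val_inj.
Qed.

Lemma content_color2 : lam_ 2 <= content d ord_max.
Proof. by rewrite -card_tops ffunE -(card_in_imset (@cc_inj _)) subset_leq_card. Qed.

(** The bounds for the first and the last colour are now attained. Hence every column contains
    colour 0, so that a column of height one contains no other colour, and the last colour occurs
    only in columns of height three. *)
Lemma color_col x : content d = shape_content -> col x < lam_ (d x).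
Proof.
move=> /ffunP content_d.
case dx: (d x) => [[|[|[|//]]] lt_i] /=.
- exact: col_lt0.
- rewrite ltnNge; apply/negP => le1x.
  have full : cc @: [set y | d y == ord0] = setT.
    apply/eqP; rewrite eqEcard subsetT cardsT card_ord card_in_imset; last exact: cc_inj.
    by have := content_d ord0; rewrite !ffunE /= => ->.
  have : cc x \in cc @: [set y | d y == ord0] by rewrite full inE.
  case/imsetP => y; rewrite inE => /eqP dy /(congr1 val)/= eq_c.
  have row0 (z : 'I_n) : col z = col x -> row z = 0.
    move=> cz; apply/eqP; rewrite -leqn0 leqNgt; apply/negP => rz.
    by have := leq_trans (cell_colP z) (part_nth rz); rewrite cz ltnNge le1x.
  have exy : x = y by apply: cell_inj; rewrite ?row0.
  by move: dx; rewrite exy dy.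
- have eq_tops : tops = cc @: [set y | d y == ord_max].
    apply/eqP; rewrite eqEcard tops_sub card_tops card_in_imset; last exact: cc_inj.
    by have := content_d ord_max; rewrite !ffunE /= => ->.
  have : cc x \in tops by rewrite eq_tops imset_f // inE dx; apply/eqP/val_inj.
  by rewrite inE.
Qed.

(** The sorting step of James' argument: inside its column, each cell moves to the row numbered by
    its colour. *)
Lemma column_sort : content d = shape_content ->
  exists2 s : 'S_n, (forall x, col (s x) = col x) & (forall x, row (s x) = d x).
Proof.
move=> content_d.
have cellP x : {y : 'I_n | (row y == d x) && (col y == col x)}.
  apply: sigW; have [y [ry cy]] := cell_exists (color_col x content_d).
  by exists y; rewrite ry cy !eqxx.
pose f x := sval (cellP x).
have fr x : row (f x) = d x by have /andP[/eqP] := svalP (cellP x).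
have fc x : col (f x) = col x by have /andP[_ /eqP] := svalP (cellP x).
have inj_f : injective f.
  move=> x y eq_f; apply: d_inj; first by rewrite -fc eq_f fc.
  by apply: val_inj; rewrite /= -!fr eq_f.
by exists (perm inj_f) => x; rewrite permE.
Qed.

End ColumnInjective.
End Cells.

(** * Polytabloids symmetrised over the stabiliser of a colouring *)

Section Polytabloids.
Variables (n : nat) (lam : seq nat).
Implicit Types (t s g h : 'S_n) (c : {ffun 'I_n -> 'I_3}).

Lemma column_stabM t s : s \in column_stab lam t ->
  column_stab lam (t * s)%g = column_stab lam t.
Proof.
rewrite inE => /forallP s_col.
have inv_col y : cell_col lam (t^-1 (s^-1 y))%g = cell_col lam (t^-1 y)%g.
  by rewrite -(eqP (s_col _)) permKV.
apply/setP => g; rewrite !inE; apply: eq_forallb => y.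
by rewrite !invMg !permM !inv_col.
Qed.

Lemma polytabloid_sign t s : s \in column_stab lam t ->
  polytabloid lam (t * s)%g = (-1) ^+ s *: polytabloid lam t.
Proof.
move=> s_col; apply/rowP => j; rewrite !mxE column_stabM // mulr_sumr.
rewrite [RHS](reindex_inj (mulgI s)) /=.
apply: eq_big => [g | g _].
  rewrite !inE in s_col *; move/forallP: s_col => s_col.
  apply/forallP/forallP => g_col y.
    by rewrite permM (eqP (g_col _)) s_col.
  have := g_col ((s^-1)%g y); rewrite permM permKV => /eqP->.
  by rewrite -(eqP (s_col _)) permKV.
by rewrite mulrA -signr_addb odd_permM addKb mulgA.
Qed.

(* Proportional to the projection onto the invariants of the Young subgroup
   that preserves the colouring [c]. *)
Definition stab_sum c := \sum_(h : 'S_n | fixes h c) young_mx lam h.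

Lemma fixesM g h c : fixes g c -> fixes (g * h)%g c = fixes h c.
Proof.
move=> /forallP fix_g; apply/forallP/forallP => fix_h y.
  have := fix_h ((g^-1)%g y); rewrite permM permKV => /eqP->.
  by rewrite -(eqP (fix_g _)) permKV.
by rewrite permM (eqP (fix_h _)) fix_g.
Qed.

Lemma polytabloid_stab_sum t c :
  polytabloid lam t *m stab_sum c = \sum_(h | fixes h c) polytabloid lam (t * h)%g.
Proof. by rewrite mulmx_sumr; apply: eq_bigr => h _; rewrite polytabloid_act. Qed.

Lemma stab_sumMl t g c : fixes g c ->
  polytabloid lam (t * g)%g *m stab_sum c = polytabloid lam t *m stab_sum c.
Proof.
move=> fix_g; rewrite !polytabloid_stab_sum [RHS](reindex_inj (mulgI g)) /=.
by apply: eq_big => [h | h _]; rewrite ?fixesM // mulgA.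
Qed.

(** The transposition of the two entries fixes the colouring and lies in the column stabiliser, so
    the symmetrised polytabloid equals its own negative. *)
Lemma polytabloid_collide t c x y : x != y -> cell_col lam x = cell_col lam y ->
  c (t x) = c (t y) -> polytabloid lam t *m stab_sum c = 0.
Proof.
move=> ne_xy eq_col eq_c; pose s := tperm (t x) (t y).
have fix_s : fixes s c by apply/forallP => z; rewrite /s; case: tpermP => [->|->|//];
  rewrite eq_c.
have s_col : s \in column_stab lam t.
  by rewrite inE; apply/forallP => z; rewrite /s; case: tpermP => [->|->|//];
    rewrite !permK eq_col.
have := stab_sumMl t fix_s; rewrite polytabloid_sign // odd_tperm (inj_eq perm_inj) ne_xy.
rewrite expr1 scaleN1r mulNmx => /esym/eqP; rewrite -subr_eq0 opprK -mulr2n.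
by rewrite -scaler_nat scaler_eq0 pnatr_eq0 => /eqP.
Qed.

(** The tableaux differ by [t^-1 * t'], which fixes [c] and is therefore absorbed by the
    symmetriser. *)
Lemma stab_sum_same t t' c : (forall x, c (t x) = c (t' x)) ->
  polytabloid lam t *m stab_sum c = polytabloid lam t' *m stab_sum c.
Proof.
pose g := (t^-1 * t')%g => eq_c; have -> : t' = (t * g)%g by rewrite mulKVg.
by rewrite stab_sumMl //; apply/forallP => y; rewrite permM -eq_c permKV.
Qed.

Hypotheses (part_lam : is_partition lam) (size_lam : (size lam <= 3)%N) (sum_lam : sumn
  lam = n).

Lemma content_comp t c : content [ffun x => c (t x)] = content c.
Proof.
rewrite -(content_recolour c t^-1%g); congr content.
by apply/ffunP => x; rewrite !ffunE invgK.
Qed.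

(** A tableau without two equal colours in a column would force the content to respect both bounds;
    so every polytabloid has a collision. *)
Lemma specht_stab_sum0 c :
  (nth 0%N lam 0 < content c ord0)%N || (content c ord_max < nth 0%N lam 2)%N ->
  specht_space n lam *m stab_sum c = 0.
Proof.
move=> bad_c; apply/eqP; rewrite -submx0 sumsmxMr; apply/sumsmx_subP => t _.
rewrite (eqmxMr _ (genmxE _)) submx0.
pose d := [ffun x => c (t x)].
case: (boolP [exists x, exists y, [&& x != y, cell_col lam x == cell_col lam y &
  d x == d y]]).
  case/existsP=> x /existsP[y /and3P[ne_xy /eqP eq_col]].
  by rewrite !ffunE => /eqP eq_c; rewrite (polytabloid_collide ne_xy eq_col eq_c).
move=> no_xy; have d_inj : column_injective lam d.
  move=> x y eq_col eq_d; apply/eqP; apply: contraR no_xy => ne_xy.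
  by apply/existsP; exists x; apply/existsP; exists y; rewrite ne_xy eq_col eq_d !eqxx.
have := content_color0 part_lam sum_lam d_inj.
have := content_color2 part_lam sum_lam d_inj.
rewrite content_comp => le2 le0.
by case/orP: bad_c; rewrite ltnNge ?le0 ?le2.
Qed.

(** A polytabloid either has a collision or is brought, by a column permutation that costs only a
    sign, to a tableau whose entries are coloured by their rows. All such tableaux have the same
    symmetrisation [v]. *)
Lemma specht_stab_sum1 c : content c = shape_content lam ->
  exists v : 'rV_(_), (specht_space n lam *m stab_sum c <= v)%MS.
Proof.
move=> content_c.
have [t0 Dt0] : exists t0 : 'S_n, forall x, c (t0 x) = row_colouring n lam x.
  have [|g Dg] := @content_transitive _ _ c (row_colouring n lam).
    by rewrite content_row_colouring.
  by exists g^-1%g => x; rewrite Dg ffunE.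
exists (polytabloid lam t0 *m stab_sum c).
rewrite sumsmxMr; apply/sumsmx_subP => t _; rewrite (eqmxMr _ (genmxE _)).
pose d := [ffun x => c (t x)].
case: (boolP [exists x, exists y, [&& x != y, cell_col lam x == cell_col lam y &
  d x == d y]]).
  case/existsP=> x /existsP[y /and3P[ne_xy /eqP eq_col]].
  by rewrite !ffunE => /eqP eq_c; rewrite (polytabloid_collide ne_xy eq_col eq_c) sub0mx.
move=> no_xy; have d_inj : column_injective lam d.
  move=> x y eq_col eq_d; apply/eqP; apply: contraR no_xy => ne_xy.
  by apply/existsP; exists x; apply/existsP; exists y; rewrite ne_xy eq_col eq_d !eqxx.
have [|s s_col s_row] := column_sort part_lam sum_lam d_inj.
  by rewrite content_comp.
(* [s] permutes cells; on the entries of [t] it acts through its conjugate by [t]. *)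
have s'_col : (s^-1 ^ t)%g \in column_stab lam t.
  rewrite inE; apply/forallP => y; rewrite conjgE !permM permK -{2}[(t^-1)%g y](permKV s).
  by rewrite s_col.
have -> : polytabloid lam t0 *m stab_sum c
  = polytabloid lam (t * s^-1 ^ t)%g *m stab_sum c.
  apply: stab_sum_same => x; rewrite Dt0 conjgE mulKVg permM.
  apply: val_inj; rewrite /= row_colouringE // -{1}[x](permKV s) s_row.
  by rewrite ffunE.
by rewrite polytabloid_sign // -scalemxAl eqmx_scale // signr_eq0.
Qed.

End Polytabloids.

(** * Permutation characters on colourings *)

Section ColourCharacter.
Variables (n : nat) (t : {ffun 'I_3 -> nat}).

Definition fixed_colourings (g : 'S_n) : {set {ffun 'I_n -> 'I_3}} :=
  [set c | content c == t & fixes g c].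

Fact colour_char_subproof :
  is_class_fun <<[set: 'S_n]>>%g [ffun g => (#|fixed_colourings g|)%:R *+ (g \in [set:
    'S_n])].
Proof.
rewrite genGid; apply: intro_class_fun => [x y _ _ | x]; last by rewrite inE.
rewrite !inE /= !mulr1n; congr _%:R.
rewrite -[RHS](card_imset _ (act_inj (recolour_action n 'I_3) y)).
apply: eq_card => c; rewrite /fixed_colourings inE;
  apply/andP/imsetP => [[/eqP Dc fix_c] | [d]].
  exists (recolour c y^-1%g); last by rewrite /= -recolourM mulVg recolour1.
  rewrite inE content_recolour Dc eqxx /= fixesE -recolourM.
  rewrite (_ : (y^-1 * x = x ^ y * y^-1)%g); last by rewrite conjgE -!mulgA mulgV mulg1.
  by rewrite recolourM; move: fix_c; rewrite fixesE => /eqP->.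
rewrite inE => /andP[/eqP Dd fix_d] -> /=; rewrite content_recolour Dd; split => //.
by move: fix_d; rewrite !fixesE -recolourM -conjgC recolourM => /eqP->.
Qed.
Definition colour_char : 'CF([set: 'S_n]) := Cfun 0 colour_char_subproof.

Lemma colour_charE g : colour_char g = (#|fixed_colourings g|)%:R.
Proof. by rewrite cfunE inE. Qed.

(** Exchanging the sums leaves, for each colouring, a sum of [chi] over its stabiliser; for the
    character of a module this is the trace of a symmetriser. *)
Lemma cfdot_colour (chi : 'CF([set: 'S_n])) :
  '[chi, colour_char] = n`!%:R^-1 *
     \sum_(c : {ffun 'I_n -> 'I_3} | content c == t) \sum_(g : 'S_n | fixes g c) chi g.
Proof.
rewrite cfdotE cardsT card_Sn; congr (_ * _).
rewrite (eq_bigr (fun g => \sum_(c in fixed_colourings g) chi g)); last first.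
  by move=> g _; rewrite colour_charE conjC_nat sumr_const mulr_natr.
rewrite (exchange_big_dep (fun c : {ffun 'I_n -> 'I_3} => content c == t)) /=.
  by apply: eq_bigr => c Dc; apply: eq_bigl => g; rewrite !inE Dc.
by move=> g c _; rewrite inE => /andP[].
Qed.

Lemma sum_colour_stab :
  \sum_(c : {ffun 'I_n -> 'I_3} | content c == t) (\sum_(g : 'S_n | fixes g c) 1)%N
  = ((\sum_j t j == n) * n`!)%N :> nat.
Proof.
rewrite -sum_fixes (exchange_big_dep xpredT) //=.
by apply: eq_bigr => g _; rewrite sum1dep_card; apply: eq_card => c; rewrite !inE.
Qed.

End ColourCharacter.

(** Here [A *m A] is [A] times the scalar [w *m D], and this scalar is the trace of [A]. *)
Lemma trace_rank1 (F : fieldType) m (A : 'M[F]_m) (D : 'cV_m) (w : 'rV_m) k :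
  A = D *m w -> A *m A = k *: A -> \tr A = 0 \/ \tr A = k.
Proof.
move=> DA AA; have [-> | nzA] := eqVneq A 0; first by left; rewrite mxtrace0.
right; rewrite DA mxtrace_mulC [w *m D]mx11_scalar mxtrace_scalar mulr1n.
have : A *m A = (w *m D) 0 0 *: A.
  by rewrite DA mulmxA -[D *m w *m D]mulmxA {1}[w *m D]mx11_scalar mul_mx_scalar
    scalemxAl.
rewrite AA => /eqP; rewrite -subr_eq0 -scalerBl scaler_eq0 (negbTE nzA) orbF subr_eq0.
by move/eqP.
Qed.

Section SpechtCharacter.
Variables (n : nat) (lam : seq nat).
Hypotheses (part_lam : is_partition lam) (size_lam : (size lam <= 3)%N) (sum_lam : sumn
  lam = n).
Local Notation rS := (specht_repr n lam).
Implicit Types c : {ffun 'I_n -> 'I_3}.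

Let specht_stab c := \sum_(g : 'S_n | fixes g c) rS g.

Lemma specht_stabE c : specht_stab c =
  in_submod (specht_space n lam) (val_submod 1%:M *m stab_sum lam c).
Proof. by rewrite /stab_sum mulmx_sumr linear_sum. Qed.

Lemma specht_stab_square c : specht_stab c *m specht_stab c
  = #|[set g : 'S_n | fixes g c]|%:R *: specht_stab c.
Proof.
rewrite {1}/specht_stab mulmx_suml.
rewrite (eq_bigr (fun=> specht_stab c)) => [|g fix_g].
  by rewrite sumr_const scaler_nat; congr (_ *+ _); apply: eq_card => g; rewrite inE.
rewrite mulmx_sumr [RHS](reindex_inj (mulgI g)) /=.
by apply: eq_big => [h | h _]; rewrite ?fixesM // repr_mxM ?inE.
Qed.

(** On the Specht module the symmetriser has rank at most one, and its square is the order of the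
    stabiliser times itself; so its trace is 0 or that order. *)
Lemma specht_stab_trace c : content c = shape_content lam ->
  \sum_(g : 'S_n | fixes g c) cfRepr rS g <= (#|[set g : 'S_n | fixes g c]|)%:R.
Proof.
move=> Dc; have [v Sv] := specht_stab_sum1 part_lam size_lam sum_lam Dc.
have -> : \sum_(g : 'S_n | fixes g c) cfRepr rS g = \tr (specht_stab c).
  by rewrite linear_sum; apply: eq_bigr => g _; rewrite cfunE inE.
have le_v : ((val_submod 1%:M : 'M_(\rank (specht_space n lam),
  _)) *m stab_sum lam c <= v)%MS.
  exact: (submx_trans (submxMr (stab_sum lam c) (val_submodP _)) Sv).
case/submxP: le_v => D DV.
have [||->|->] := @trace_rank1 _ _ (specht_stab c) D (in_submod (specht_space n lam) v)
   #|[set g : 'S_n | fixes g c]|%:R; rewrite ?ler0n //.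
  by rewrite specht_stabE DV /in_submod /= !mulmxA.
exact: specht_stab_square.
Qed.

Lemma cfdot_specht_le1 : '[cfRepr rS, colour_char n (shape_content lam)] <= 1.
Proof.
rewrite cfdot_colour ler_pdivrMl ?ltr0n ?fact_gt0 // mulr1.
apply: (@le_trans _ _ (\sum_(c : {ffun 'I_n -> 'I_3} | content c == shape_content lam)
    (\sum_(g : 'S_n | fixes g c) 1)%N%:R)).
  apply: ler_sum => c /eqP Dc; apply: le_trans (specht_stab_trace Dc) _.
  by rewrite ler_nat sum1dep_card.
rewrite -natr_sum sum_colour_stab ler_nat.
by case: eqP; rewrite ?mul1n ?mul0n.
Qed.

Lemma cfdot_specht0 (t : {ffun 'I_3 -> nat}) :
  (nth 0%N lam 0 < t ord0)%N || (t ord_max < nth 0%N lam 2)%N ->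
  '[cfRepr rS, colour_char n t] = 0.
Proof.
move=> bad_t; rewrite cfdot_colour big1 ?mulr0 // => c /eqP Dc.
have -> : \sum_(g : 'S_n | fixes g c) cfRepr rS g = \tr (specht_stab c).
  by rewrite linear_sum; apply: eq_bigr => g _; rewrite cfunE inE.
rewrite specht_stabE (_ : val_submod _ *m _ = 0) ?linear0 //.
apply/eqP; rewrite -submx0 -(@specht_stab_sum0 n lam part_lam sum_lam c) ?Dc //.
by rewrite submxMr ?val_submodP.
Qed.

Lemma tabloid_colouring (t : 'S_n) : tabloid lam t =
  [ffun i : 'I_(size lam) => [set y | recolour (row_colouring n lam) t y == i :> nat]].
Proof.
apply/ffunP => i; rewrite !ffunE; apply/setP => y; rewrite inE ffunE row_colouringE //.
apply/imsetP/eqP => [[x] | ry].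
  by rewrite inE => /eqP rx ->; rewrite permK.
by exists ((t^-1)%g y); rewrite ?permKV // inE ry.
Qed.

(** A tabloid is a colouring of the entries of content [lam], the colour of an entry being its
    row. *)
Lemma cfRepr_young : cfRepr (young_repr n lam) = colour_char n (shape_content lam).
Proof.
apply/cfun_inP => g _; rewrite cfunE inE mulr1n colour_charE /= /mxtrace.
rewrite (eq_bigr (fun i => (tabloid_act (enum_val i) g == enum_val i)%:R)); last first.
  by move=> i _; rewrite mxE eq_sym.
rewrite -(big_enum_val (fun f : {ffun 'I_(size lam) ->
  {set 'I_n}} => (tabloid_act f g == f)%:R : algC)) /=.
rewrite -natr_sum -big_mkcondr sum1dep_card; congr _%:R.
pose F (c : {ffun 'I_n -> 'I_3}) := [ffun i : 'I_(size lam) => [set y | c y == i :> nat]].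
have inj_F c d : content c = shape_content lam -> F c = F d -> c = d.
  move=> Dc /ffunP eq_F; apply/ffunP => y; apply: val_inj => /=.
  have lt_c : (c y < size lam)%N.
    rewrite ltnNge; apply/negP => le_c; have /ffunP/(_ (c y)) := Dc.
    rewrite !ffunE nth_default // => /eqP; rewrite cards_eq0 => /eqP/setP/(_ y).
    by rewrite !inE eqxx.
  have := eq_F (Ordinal lt_c); rewrite !ffunE => /setP/(_ y).
  by rewrite !inE eqxx => /esym/eqP.
have F_act c : tabloid_act (F c) g = F (recolour c g).
  apply/ffunP => i; rewrite !ffunE; apply/setP => y; rewrite inE ffunE.
  apply/imsetP/eqP => [[z] | cy]; first by rewrite inE => /eqP <- ->; rewrite permK.
  by exists ((g^-1)%g y); rewrite ?permKV // inE cy.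
rewrite -[RHS](@card_in_imset _ _ F); last first.
  by move=> c d; rewrite /fixed_colourings inE => /andP[/eqP Dc _] _; apply: inj_F.
apply: eq_card => f; rewrite inE; apply/andP/imsetP => [[/imsetP[t _ ->]] | [c]].
  rewrite tabloid_colouring -/(F _) F_act => /eqP/inj_F eq_c.
  exists (recolour (row_colouring n lam) t) => //.
  have Dt : content (recolour (row_colouring n lam) t) = shape_content lam.
    by rewrite content_recolour content_row_colouring.
  by rewrite inE fixesE Dt eqxx /= eq_c // 2!content_recolour content_row_colouring.
rewrite inE fixesE => /andP[/eqP Dc /eqP fix_c] ->; rewrite F_act fix_c eqxx; split => //.
have [|t ->] := @content_transitive _ _ (row_colouring n lam) c.
  by rewrite content_row_colouring.
by rewrite /F -tabloid_colouring imset_f.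
Qed.

(** A column permutation that also preserves the rows is trivial, so a polytabloid contains its own
    tabloid with coefficient 1. *)
Lemma specht_space_neq0 : specht_space n lam != 0.
Proof.
have poly1 : polytabloid lam (1%g : 'S_n) != 0.
  have t1 : tabloid lam (1%g : 'S_n) \in tabloids n lam by apply: imset_f.
  apply/eqP => /rowP/(_ (enum_rank_in t1 (tabloid lam (1%g : 'S_n)))).
  rewrite !mxE enum_rankK_in // (bigD1 1%g) /=; last first.
    by rewrite inE; apply/forallP => y; rewrite perm1.
  rewrite mulg1 eqxx odd_perm1 expr0 mulr1 big1 ?addr0; first by move/eqP;
    rewrite oner_eq0.
  move=> s /andP[s_col s1]; case: eqP; rewrite ?mulr0 // mul1g => /ffunP eq_t.
  case/eqP: s1; apply/permP => x; rewrite perm1.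
  apply: (@cell_inj n lam); last first.
    by move: s_col; rewrite inE => /forallP/(_ x); rewrite invg1 !perm1 => /eqP.
  have := eq_t (Ordinal (cell_rowP sum_lam x)); rewrite !ffunE => /setP/(_ (s x)).
  rewrite [RHS]imset_f ?inE ?eqxx // => /imsetP[y]; rewrite inE => /eqP ry ->.
  by rewrite perm1.
apply: contra poly1 => /eqP S0; rewrite -submx0 -S0.
by apply: (sumsmx_sup 1%g) => //; rewrite genmxE.
Qed.

(** The products of [chi] with itself and with the quotient character [phi] are natural numbers with
    sum at most 1, and the first is positive; they must be 1 and 0. *)
Lemma specht_norm : '[cfRepr rS] = 1 /\
  '[cfRepr rS, colour_char n (shape_content lam)] = 1.
Proof.
set chi := cfRepr rS; pose phi := cfRepr (factmod_repr (specht_module n lam)).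
have Dm : colour_char n (shape_content lam) = chi + phi.
  rewrite -cfRepr_young; apply/cfun_inP => g Gg; rewrite !cfunE Gg !mulr1n.
  by rewrite -(mxtrace_sub_fact_mod (specht_module n lam)).
have le1 := cfdot_specht_le1; rewrite -/chi Dm cfdotDr in le1 *.
have Nchi : chi \is a character := cfRepr_char _.
have Nphi : phi \is a character := cfRepr_char _.
have /natrP[k Dk] := Cnat_cfdot_char Nchi Nchi.
have /natrP[l Dl] := Cnat_cfdot_char Nchi Nphi.
have k_gt0 : (0 < k)%N.
  rewrite lt0n -(pnatr_eq0 algC) -Dk cfnorm_eq0;
    apply: contraNneq specht_space_neq0 => chi0.
  by have := cfRepr1 rS; rewrite -/chi chi0 cfunE => /esym/eqP;
    rewrite pnatr_eq0 mxrank_eq0.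
have {}le1 : (k + l <= 1)%N by rewrite -(ler_nat algC) natrD -Dk -Dl.
rewrite Dk Dl -natrD.
by move: k_gt0 le1; case: k {Dk} => [|[|k]]; case: l {Dl}.
Qed.

End SpechtCharacter.

(** * Kronecker coefficients as coefficients of Schur functions *)

Section CompleteHomogeneous.
Variable R : comNzRingType.
Implicit Types (w : R) (ws : seq R).

(** The complete homogeneous symmetric function of degree [k], sorted by the exponent of the first
    variable. *)
Fixpoint hsym ws (k : nat) : R :=
  if ws is w :: ws' then \sum_(i < k.+1) w ^+ i * hsym ws' (k - i)%N else (k == 0%N)%:R.

Lemma hsym0 ws : hsym ws 0 = 1.
Proof. by elim: ws => //= w ws IH; rewrite big_ord1 expr0 mul1r subn0. Qed.

Lemma hsymS w ws k : hsym (w :: ws) k.+1 = hsym ws k.+1 + w * hsym (w :: ws) k.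
Proof.
have hE (m : nat) : hsym (w :: ws) m = \sum_(i < m.+1) w ^+ i * hsym ws (m - i)%N by [].
rewrite [LHS]hE hE big_ord_recl. rewrite expr0 mul1r subn0; congr (_ + _).
by rewrite mulr_sumr; apply: eq_bigr => i _; rewrite mulrA -exprS.
Qed.

(** Cutting the geometric series at exponent [n] leaves the coefficients up to [n] unchanged and
    keeps all exponents in the finite type ['I_n.+1]. *)
Lemma coef_prod_geometric n ws k : (k <= n)%N ->
  (\prod_(w <- ws) \sum_(i < n.+1) (w ^+ i) *: 'X^i)`_k = hsym ws k.
Proof.
elim: ws k => [|w ws IH] k le_kn; first by rewrite big_nil coef1.
rewrite big_cons coefM; apply: eq_bigr => i _.
have lt_in : (i < n.+1)%N by rewrite (leq_trans (ltn_ord i)).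
rewrite IH ?(leq_trans (leq_subr _ _)) // coef_sum (bigD1 (Ordinal lt_in)) //=.
rewrite coefZ coefXn eqxx mulr1 big1 ?addr0 // => j ne_j.
rewrite coefZ coefXn -(inj_eq val_inj) /= eq_sym in ne_j *.
by rewrite (negbTE ne_j) mulr0.
Qed.

Lemma hsym_sum (J : finType) (w : J -> R) n k : (k <= n)%N ->
  \sum_(t : {ffun J -> 'I_n.+1} | (\sum_j t j == k)%N) \prod_j w j ^+ t j
  = hsym [seq w j | j <- enum J] k.
Proof.
move=> le_kn; rewrite -(@coef_prod_geometric n) // big_map big_enum /=.
rewrite bigA_distr_bigA /= coef_sum big_mkcond; apply: eq_bigr => t _.
rewrite scaler_prod -[\prod_i 'X^(t i)](big_morph _ (exprD 'X) (expr0 'X)) coefZ coefXn.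
by rewrite eq_sym; case: eqP; rewrite ?mulr1 ?mulr0.
Qed.

End CompleteHomogeneous.
Lemma hsym_nilS (R : comNzRingType) k : hsym ([::] : seq R) k.+1 = 0.
Proof. by []. Qed.
Arguments hsym : simpl never.

Section TableSum.
Variables (R : comNzRingType) (J : finType) (w : J -> R) (n : nat).

(** Each factor on the right expands over one row of the table; multiplying the rows collects the
    exponents into column sums. *)
Lemma table_sum (al : 'I_3 -> nat) : (forall r, al r <= n)%N ->
  \sum_(t : {ffun 'I_3 * J -> 'I_n.+1} | [forall r, (\sum_j t (r, j) == al r)%N])
     \prod_j w j ^+ (\sum_r t (r, j))%N
  = \prod_r hsym [seq w j | j <- enum J] (al r).
Proof.
move=> le_al; under [RHS]eq_bigr do rewrite -(hsym_sum _ (le_al _)).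
rewrite (bigA_distr_big_dep (fun r (s : {ffun J -> 'I_n.+1}) => \sum_j s j == al r)%N).
pose uncurry (f : {ffun 'I_3 -> {ffun J -> 'I_n.+1}}) : {ffun 'I_3 * J -> 'I_n.+1} :=
  [ffun x => f x.1 x.2].
pose curry (t : {ffun 'I_3 * J -> 'I_n.+1}) := [ffun r => [ffun j => t (r, j)]].
rewrite (reindex uncurry) /=; last first.
  exists curry => [f _ | t _]; last by apply/ffunP => -[r j]; rewrite !ffunE.
  by apply/ffunP => r; apply/ffunP => j; rewrite !ffunE.
apply: eq_big => [f | f _].
  have H r : (\sum_j uncurry f (r, j) = \sum_j f r j)%N by apply: eq_bigr => j _;
    rewrite ffunE.
  by apply/forallP/familyP => Hf r; have := Hf r; rewrite unfold_in /= H.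
rewrite exchange_big /=; apply: eq_bigr => j _.
by rewrite -prodrXr; apply: eq_bigr => r _; rewrite ffunE.
Qed.

End TableSum.

Section PairColourings.
Variables (n : nat) (J : finType).

Lemma sum_fixes_pred (P : pred {ffun J -> nat}) :
  (\sum_(g : 'S_n) #|[set c : {ffun 'I_n -> J} | P (content c) & fixes g c]|
  = #|[set t : {ffun J -> 'I_n.+1} | P [ffun j => t j : nat] & \sum_j t j == n]| * n`!)%N.
Proof.
pose nt (t : {ffun J -> 'I_n.+1}) : {ffun J -> nat} := [ffun j => t j : nat].
pose tbl (c : {ffun 'I_n -> J}) : {ffun J -> 'I_n.+1} := [ffun j => inord (content c j)].
have nt_tbl c : nt (tbl c) = content c.
  apply/ffunP => j; rewrite !ffunE inordK // ltnS -[X in (_ <= X)%N]card_ord.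
  exact: max_card.
have nt_inj : injective nt.
  by move=> s t /ffunP eq_st; apply/ffunP => j; have := eq_st j;
    rewrite !ffunE => /val_inj.
have sum_nt t : (\sum_j nt t j = \sum_j t j)%N by apply: eq_bigr => j _; rewrite ffunE.
transitivity (\sum_(g : 'S_n) \sum_(t : {ffun J -> 'I_n.+1} | P (nt t))
    #|[set c : {ffun 'I_n -> J} | content c == nt t & fixes g c]|)%N.
  apply: eq_bigr => g _; rewrite -sum1dep_card (partition_big tbl (fun t => P (nt t)))
    /=; last first.
    by move=> c /andP[]; rewrite nt_tbl.
  apply: eq_bigr => t Pt; rewrite sum1dep_card; apply: eq_card => c; rewrite !inE.
  rewrite -(inj_eq nt_inj) nt_tbl; case: eqP => [->|]; rewrite ?andbF ?andbT //.
  by rewrite Pt.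
rewrite exchange_big /= (eq_bigr (fun t : {ffun J ->
  'I_n.+1} => (\sum_j t j == n) * n`!)%N); last first.
  by move=> t _; rewrite sum_fixes sum_nt.
rewrite -big_distrl /= -sum1dep_card; congr (_ * _)%N.
by rewrite [RHS]big_mkcondr; apply: eq_bigr => t _; case: eqP.
Qed.

Lemma content_fst (I : finType) (e : {ffun 'I_n -> I * J}) i :
  content [ffun y => (e y).1] i = (\sum_j content e (i, j))%N.
Proof.
rewrite ffunE -sum1dep_card (partition_big (fun y => (e y).2) xpredT) //=.
apply: eq_bigr => j _; rewrite sum1dep_card !ffunE; apply: eq_card => y.
by rewrite !inE ffunE; case: (e y) => i' j' /=; rewrite xpair_eqE.
Qed.

Lemma content_snd (I : finType) (e : {ffun 'I_n -> I * J}) j :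
  content [ffun y => (e y).2] j = (\sum_i content e (i, j))%N.
Proof.
rewrite ffunE -sum1dep_card (partition_big (fun y => (e y).1) xpredT) //=.
apply: eq_bigr => i _; rewrite sum1dep_card !ffunE; apply: eq_card => y.
by rewrite !inE ffunE; case: (e y) => i' j' /=; rewrite xpair_eqE andbC.
Qed.

(** Two colourings form one colouring by pairs, and their contents are the marginals of its
    content. *)
Lemma card_pair_fixes (I : finType) (P : pred {ffun I -> nat}) (Q : pred {ffun J ->
  nat}) (g : 'S_n) :
  (#|[set c : {ffun 'I_n -> I} | P (content c) & fixes g c]|
   * #|[set d : {ffun 'I_n -> J} | Q (content d) & fixes g d]|
  = #|[set e : {ffun 'I_n -> I * J} |
       P [ffun i => \sum_j content e (i, j)] && Q [ffun j => \sum_i content e (i, j)]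
       & fixes g e]|)%N.
Proof.
rewrite -cardsX.
pose F (cd : {ffun 'I_n -> I} * {ffun 'I_n -> J}) : {ffun 'I_n ->
  I * J} := [ffun y => (cd.1 y, cd.2 y)].
have inj_F : injective F.
  move=> [c d] [c' d'] /ffunP eq_F; congr (_, _); apply/ffunP => y;
  by have := eq_F y; rewrite !ffunE /= => -[].
rewrite -(card_imset _ inj_F); apply: eq_card => e; rewrite inE.
have -> : [ffun i => \sum_j content e (i, j)]%N = content [ffun y => (e y).1].
  by apply/ffunP => i; rewrite content_fst ffunE.
have -> : [ffun j => \sum_i content e (i, j)]%N = content [ffun y => (e y).2].
  by apply/ffunP => i; rewrite content_snd ffunE.
have FK c d : [ffun y => (F (c, d) y).1] = c /\ [ffun y => (F (c, d) y).2] = d.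
  by split; apply/ffunP => y; rewrite !ffunE.
have fixesF c d : fixes g (F (c, d)) = fixes g c && fixes g d.
  apply/forallP/andP => [fix_e | [/forallP fix_c /forallP fix_d] y].
    by split; apply/forallP => y; have := fix_e y; rewrite !ffunE xpair_eqE => /andP[].
  by rewrite !ffunE xpair_eqE fix_c fix_d.
apply/imsetP/idP => [[[c d] cd ->] | He].
  have [-> ->] := FK c d; move: cd.
  by rewrite inE /= !inE fixesF => /andP[/andP[-> ->] /andP[-> ->]].
exists ([ffun y => (e y).1], [ffun y => (e y).2]); last first.
  by apply/ffunP => y; rewrite !ffunE -surjective_pairing.
have De : e = F ([ffun y => (e y).1], [ffun y => (e y).2]).
  by apply/ffunP => y; rewrite !ffunE -surjective_pairing.
by move: He; rewrite {3}De fixesF inE /= !inE => /andP[/andP[-> ->] /andP[-> ->]].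
Qed.

End PairColourings.

(** A forbidden letter gets weight 0, so only tables in which its multiplicity is 0 contribute. *)
Definition monomial_weight (ok : bool) (a b : nat) : {poly {poly int}} :=
  if ok then 'X^a * ('X^b)%:P else 0.

Lemma coef_monomial a b x y :
  ('X^a * ('X^b)%:P : {poly {poly int}})`_x`_y = ((a == x) && (b == y))%:R.
Proof.
rewrite coefMC coefXn [x == a]eq_sym; case: eqP => _; last by rewrite mul0r coef0.
by rewrite mul1r coefXn [y == b]eq_sym.
Qed.

Section TableCoefficient.
Variables (J : finType) (ok : pred J) (a b : J -> nat).
Local Notation w j := (monomial_weight (ok j) (a j) (b j)).

Lemma prod_weight (k : J -> nat) : \prod_j w j ^+ k j =
  if [forall j, ok j || (k j == 0%N)]
  then 'X^(\sum_j a j * k j) * ('X^(\sum_j b j * k j))%:P else 0.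
Proof.
case: ifP => [/forallP ok_k | /forallPn[j]]; last first.
  rewrite negb_or => /andP[/negbTE ok_j k_j].
  by rewrite (bigD1 j) //= /monomial_weight ok_j expr0n (negbTE k_j) mul0r.
rewrite -!prodrXr rmorph_prod -big_split /=; apply: eq_bigr => j _.
rewrite /monomial_weight; have := ok_k j; case: (ok j) => /= [_ | /eqP->].
  by rewrite exprMn -exprM -polyC_exp -exprM.
by rewrite !muln0 !expr0 mulr1.
Qed.

Variable n : nat.

Definition matches (x y : nat) (k : {ffun J -> nat}) : bool :=
  [&& [forall j, ok j || (k j == 0%N)], (\sum_j a j * k j == x)%N
    & (\sum_j b j * k j == y)%N].

(** By Burnside, both sides are n! times the number of tables with row sums [al] whose column sums
    satisfy [matches]. *)
Lemma colour_table (al : {ffun 'I_3 -> nat}) x y : (\sum_r al r = n)%N ->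
  ((\sum_(g : 'S_n) #|fixed_colourings al g|
     * #|[set d : {ffun 'I_n -> J} | matches x y (content d) & fixes g d]|)%N%:R : int)
  = (\prod_r hsym [seq w j | j <- enum J] (al r))`_x`_y * n`!%:R.
Proof.
move=> sum_al.
have le_al r : (al r <= n)%N by rewrite -sum_al (bigD1 r) //= leq_addr.
rewrite (eq_bigr _ (fun g _ => card_pair_fixes (pred1 al) (matches x y) g)).
rewrite (@sum_fixes_pred n _ (fun k : {ffun 'I_3 * J -> nat} =>
  ([ffun r => \sum_j k (r, j)] == al)%N && matches x y [ffun j => \sum_r k (r, j)]%N)).
rewrite natrM; congr (_ * _); rewrite -(table_sum _ le_al) !coef_sum.
rewrite -sum1dep_card natr_sum big_mkcond [RHS]big_mkcond /=; apply: eq_bigr => t _.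
rewrite prod_weight.
have rows r : (\sum_j [ffun i => t i : nat] (r, j) = \sum_j t (r, j))%N.
  by apply: eq_bigr => j _; rewrite ffunE.
have cols j : (\sum_r [ffun i => t i : nat] (r, j) = \sum_r t (r, j))%N.
  by apply: eq_bigr => r _; rewrite ffunE.
have -> : ([ffun r => \sum_j [ffun i => t i : nat] (r, j)] == al)%N
    = [forall r, (\sum_j t (r, j) == al r)%N].
  apply/eqP/forallP => [<- r | Ht]; first by rewrite ffunE rows.
  by apply/ffunP => r; rewrite ffunE rows (eqP (Ht r)).
have -> : (\sum_j t j == n)%N = (\sum_r \sum_j t (r, j) == n)%N.
  by rewrite pair_bigA; congr (_ == n); apply: eq_bigr => -[].
case: (boolP [forall r, _]) => [/forallP Ht | _] /=; last by [].
rewrite (eq_bigr al) => [|r _]; last exact/eqP.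
rewrite sum_al eqxx andbT /matches.
have -> : [forall j, ok j || ([ffun j => \sum_r [ffun i => t i : nat] (r, j)]%N j == 0%N)]
   = [forall j, ok j || ((\sum_r t (r, j))%N == 0%N)].
  by apply: eq_forallb => j; rewrite ffunE cols.
case: [forall j, ok j || _] => /=; last by rewrite !coef0.
rewrite coef_monomial; under eq_bigr do rewrite ffunE cols.
by under [in X in _ && X]eq_bigr do rewrite ffunE cols; case: (_ && _).
Qed.

End TableCoefficient.

Lemma enum_I3 : enum 'I_3 = [:: @Ordinal 3 0 isT; @Ordinal 3 1 isT; @Ordinal 3 2 isT].
Proof. by apply: (inj_map val_inj); rewrite val_enum_ord. Qed.

Lemma sum_I3 (F : 'I_3 -> nat) : (\sum_i F i = F (@Ordinal 3 0 isT)
  + F (@Ordinal 3 1 isT) + F (@Ordinal 3 2 isT))%N.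
Proof. by rewrite -big_enum enum_I3 !big_cons big_nil /= addn0 addnA. Qed.

Lemma prod_I3 (R : comNzRingType) (F : 'I_3 ->
  R) : \prod_i F i = F (@Ordinal 3 0 isT) * F (@Ordinal 3 1 isT) * F (@Ordinal 3 2 isT).
Proof. by rewrite -big_enum enum_I3 !big_cons big_nil /= mulr1 mulrA. Qed.

Section ThreeColours.
Local Notation i0 := (@Ordinal 3 0 isT).
Local Notation i1 := (@Ordinal 3 1 isT).
Local Notation i2 := (@Ordinal 3 2 isT).

Lemma ffun_I3_eq (k be : {ffun 'I_3 -> nat}) : (\sum_i k i = \sum_i be i)%N ->
  k i0 = be i0 -> k i2 = be i2 -> k = be.
Proof.
rewrite !sum_I3 => sum_k k0 k2.
have k1 : k i1 = be i1 by move: sum_k; rewrite k0 k2 => /addIn/addnI.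
by apply/ffunP => -[[|[|[|//]]] lt_i]; rewrite (bool_irrelevance lt_i isT).
Qed.

Section Two.
Variable n : nat.
Local Notation u := ('X : {poly {poly int}}).
Local Notation v := ('X%:P : {poly {poly int}}).
Implicit Types al be ga : {ffun 'I_3 -> nat}.

Lemma cfdot_colour2 al be : (\sum_r al r = n)%N -> (\sum_r be r = n)%N ->
  '[colour_char n be, colour_char n al]
  = ((\prod_r hsym [:: u; v; 1] (al r))`_(be i0)`_(be i1))%:~R.
Proof.
move=> sum_al sum_be.
pose a (j : 'I_3) := nat_of_bool (j == i0).
pose b (j : 'I_3) := nat_of_bool (j == i1).
have := colour_table xpredT a b (be i0) (be i1) sum_al.
rewrite enum_I3 /= /monomial_weight /a /b /= expr1 !expr0 expr1 mulr1 mul1r mulr1.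
move=> /(congr1 (fun z : int => z%:~R : algC)); rewrite intrM !natz -!pmulrn => E.
rewrite cfdotE cardsT card_Sn -[RHS](mulfK (_ : n`!%:R != 0)); last first.
  by rewrite pnatr_eq0 -lt0n fact_gt0.
rewrite -[X in X / _]E mulrC; congr (_ / _); rewrite natr_sum;
  apply: eq_big => [g | g _]; first by rewrite inE.
rewrite !colour_charE conjC_nat natrM mulrC; congr (_ * _%:R).
apply: eq_card => c; rewrite !inE; congr (_ && _).
rewrite /matches; apply/eqP/and3P => [-> | [_ /eqP E0 /eqP E1]].
  by split; first exact/forallP; rewrite sum_I3 /a /b /= ?mul0n ?mul1n ?addn0.
rewrite !sum_I3 /a /b /= !mul0n !mul1n ?addn0 ?add0n in E0 E1.
have E2 : content c i2 = be i2.
  apply/eqP; rewrite -(eqn_add2l (be i0 + be i1)); apply/eqP.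
  by rewrite -[RHS]sum_I3 sum_be -[RHS](sum_content c) sum_I3 E0 E1.
by apply/ffunP => -[[|[|[|//]]] lt_i]; rewrite (bool_irrelevance lt_i isT).
Qed.

(** As mu and nu have at most two parts, pairs involving the third colour are excluded; the other
    four have weights u v, u, v and 1. *)
Definition kron_ok (j : 'I_3 * 'I_3) := (j.1 != i2) && (j.2 != i2).
Definition kron_fst (j : 'I_3 * 'I_3) := nat_of_bool (j.1 == i0).
Definition kron_snd (j : 'I_3 * 'I_3) := nat_of_bool (j.2 == i0).

Lemma kron_table al x y : (\sum_r al r = n)%N ->
  ((\sum_(g : 'S_n) #|fixed_colourings al g| * #|[set d : {ffun 'I_n -> 'I_3 * 'I_3} |
      matches kron_ok kron_fst kron_snd x y (content d) & fixes g d]|)%N%:R : int)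
  = (\prod_r hsym [:: u * v; u; v; 1] (al r))`_x`_y * n`!%:R.
Proof.
move=> sum_al; rewrite (colour_table _ _ _ _ _ sum_al); set ws := [seq _ | _ <- _].
suff -> : \prod_r hsym ws (al r) = \prod_r hsym [:: u * v; u; v; 1] (al r) by [].
apply: eq_bigr => r _; rewrite -!(@coef_prod_geometric _ (al r)) //; congr (_`__).
pose geo w := \sum_(i < (al r).+1) (w ^+ i) *: 'X^i : {poly {poly {poly int}}}.
(* Since 0 ^ 0 = 1, an excluded pair contributes the factor 1 to the generating function. *)
have geo0 : geo 0 = 1.
  rewrite /geo big_ord_recl expr0 scale1r big1 ?addr0 // => i _.
  by rewrite expr0n scale0r.
rewrite big_map big_enum -(pair_bigA _ (fun j k =>
  geo (monomial_weight (kron_ok (j, k)) (kron_fst (j, k)) (kron_snd (j, k))))).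
rewrite !big_cons big_nil !prod_I3 /monomial_weight /kron_ok /kron_fst /kron_snd /=
  -!/(geo _).
by rewrite !geo0 !expr0 !expr1 !mulr1 !mul1r !mulrA.
Qed.

Lemma cfdot_colour3 al be ga : (\sum_r al r = n)%N -> (\sum_r be r = n)%N ->
  (\sum_r ga r = n)%N ->
  be i2 = 0%N -> ga i2 = 0%N ->
  '[colour_char n be * colour_char n ga, colour_char n al]
  = ((\prod_r hsym [:: u * v; u; v; 1] (al r))`_(be i0)`_(ga i0))%:~R.
Proof.
move=> sum_al sum_be sum_ga be2 ga2.
have := kron_table (be i0) (ga i0) sum_al.
move=> /(congr1 (fun z : int => z%:~R : algC)); rewrite intrM !natz -!pmulrn => E.
rewrite cfdotE cardsT card_Sn -[RHS](mulfK (_ : n`!%:R != 0)); last first.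
  by rewrite pnatr_eq0 -lt0n fact_gt0.
rewrite -[X in X / _]E mulrC; congr (_ / _); rewrite natr_sum;
  apply: eq_big => [g | g _]; first by rewrite inE.
rewrite cfunE !colour_charE conjC_nat -!natrM mulnC; congr (_ * _)%:R.
rewrite (card_pair_fixes (pred1 be) (pred1 ga)); apply: eq_card => c; rewrite !inE;
  congr (_ && _).
rewrite /matches.
set k := content c; have sum_k : (\sum_i \sum_j k (i, j) = n)%N.
  by rewrite pair_bigA -[RHS](sum_content c); apply: eq_bigr => -[].
have Da : (\sum_j kron_fst j * k j = \sum_j k (i0, j))%N.
  rewrite (eq_bigr (fun p => (fun i j => kron_fst (i, j) * k (i,
    j)) p.1 p.2)%N) => [|[]//].
  rewrite -(pair_bigA _ (fun i j => kron_fst (i, j) * k (i, j))%N) !sum_I3.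
  by rewrite !mul0n !mul1n !addn0.
have Db : (\sum_j kron_snd j * k j = \sum_i k (i, i0))%N.
  rewrite (eq_bigr (fun p => (fun i j => kron_snd (i, j) * k (i,
    j)) p.1 p.2)%N) => [|[]//].
  rewrite -(pair_bigA _ (fun i j => kron_snd (i, j) * k (i, j))%N); apply: eq_bigr => i _.
  by rewrite sum_I3 !mul0n mul1n !addn0.
rewrite Da Db.
apply/andP/and3P => [[/eqP/ffunP k_be /eqP/ffunP k_ga] | [/forallP ok_k /eqP ka /eqP kb]].
  split; last 2 first.
  - by rewrite -k_be ffunE.
  - by rewrite -k_ga ffunE.
  apply/forallP => -[i j]; rewrite /kron_ok /=.
  have [-> | _] /= := eqVneq i i2.
    by have /eqP := k_be i2; rewrite ffunE be2 sum_nat_eq0 => /forallP/(_ j).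
  have [-> | _] //= := eqVneq j i2.
  by have /eqP := k_ga i2; rewrite ffunE ga2 sum_nat_eq0 => /forallP/(_ i).
split; apply/eqP/ffun_I3_eq; rewrite ?ffunE //.
- by rewrite sum_be -sum_k; apply: eq_bigr => i _; rewrite ffunE.
- rewrite be2 big1 // => j _.
  by have := ok_k (i2, j) => /eqP.
- by rewrite sum_ga -sum_k exchange_big; apply: eq_bigr => i _; rewrite ffunE.
- rewrite ga2 big1 // => j _.
  by have := ok_k (j, i2); rewrite /kron_ok /= andbF => /eqP.
Qed.

End Two.

End ThreeColours.

(** * Jacobi-Trudi determinants and alternants *)

Definition hsymz (R : comNzRingType) (ws : seq R) (k : int) : R :=
  if 0 <= k then hsym ws `|k|%N else 0.

Definition coefz (P : {poly {poly int}}) (i j : int) : int :=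
  if (0 <= i) && (0 <= j) then P`_`|i|%N`_`|j|%N else 0.

(** The Leibniz expansion of a 3 by 3 Jacobi-Trudi determinant, with the product of entries replaced
    by any function of the three indices; it serves for polynomials, class functions and
    coefficients alike. *)
Definition alt3 (V : zmodType) (F : int -> int -> int -> V) (x y z : int) : V :=
  F x y z - F x (y + 1) (z - 1) - F (x + 1) (y - 1) z + F (x + 1) (y + 1) (z - 2)
  + F (x + 2) (y - 1) (z - 1) - F (x + 2) y (z - 2).

Definition hsym3 (R : comNzRingType) (ws : seq R) (x y z : int) : R :=
  hsymz ws x * hsymz ws y * hsymz ws z.

Definition jacobi_trudi (R : comNzRingType) (ws : seq R) := alt3 (hsym3 ws).

Section Alternant.
Variables (R : idomainType) (u v : R).
Hypotheses (u1 : u != 1) (v1 : v != 1) (uv : u != v).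

Definition vdm : R := (u - v) * (u - 1) * (v - 1).

Lemma vdm_neq0 : vdm != 0.
Proof. by rewrite /vdm !mulf_neq0 // subr_eq0. Qed.

(** The right side is the alternant with exponents k + 2, 1, 0 in the variables u, v, 1. *)
Lemma vdm_hsym (k : nat) :
  vdm * hsym [:: u; v; 1] k = (v - 1) * u ^+ k.+2 - (u - 1) * v ^+ k.+2 + (u - v).
Proof.
have h1 m : hsym [:: 1 : R] m = 1.
  by elim: m => [|m IH]; rewrite ?hsym0 // hsymS IH hsym_nilS mul1r add0r.
have h2 m : (v - 1) * hsym [:: v; 1] m = v ^+ m.+1 - 1.
  elim: m => [|m IH]; first by rewrite hsym0 mulr1 expr1.
  by rewrite hsymS h1 mulrDr mulrCA IH [v ^+ m.+2]exprS; ring.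
elim: k => [|k IH]; first by rewrite hsym0 /vdm !exprS expr0; ring.
rewrite hsymS mulrDr mulrCA IH [u ^+ _.+3]exprS [v ^+ _.+3]exprS.
have -> : vdm * hsym [:: v; 1] k.+1 = (u - v) * (u - 1) * (v ^+ k.+2 - 1).
  by rewrite -h2 /vdm; ring.
by ring.
Qed.

(** For k = -1 and k = -2 the alternant has a repeated exponent and vanishes. No smaller index
    occurs in the determinant of a partition. *)
Lemma vdm_hsymz (k : int) : - 2 <= k ->
  vdm * hsymz [:: u; v; 1] k
  = (v - 1) * u ^+ `|(k + 2)%R|%N - (u - 1) * v ^+ `|(k + 2)%R|%N + (u - v).
Proof.
rewrite /hsymz => k_ge; case: ifP => k0.
  by rewrite vdm_hsym (_ : `|(k + 2)%R|%N = `|k|.+2); last lia.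
rewrite mulr0; have [->|->] : k = - 1 \/ k = - 2 by lia.
  by rewrite !expr1; ring.
by rewrite !expr0; ring.
Qed.

Lemma alternant_jacobi_trudi (l0 l1 l2 : nat) : let L0 := l0.+2 in let L1 := l1.+1 in
  vdm * jacobi_trudi [:: u; v; 1] l0 l1 l2 =
  u ^+ L0 * v ^+ L1 - u ^+ L0 * v ^+ l2 - u ^+ L1 * v ^+ L0 + u ^+ L1 * v ^+ l2
  + u ^+ l2 * v ^+ L0 - u ^+ l2 * v ^+ L1.
Proof.
(* Each of the three entries in a product has to absorb one Vandermonde factor, so two more are
   supplied. *)
move=> L0 L1; apply: (mulfI (mulf_neq0 vdm_neq0 vdm_neq0)).
rewrite /jacobi_trudi /alt3 /hsym3; set h := hsymz _.
have Dh (k : int) (l i : nat) : - 2 <= k -> k + 2 = l%:Z + i%:Z ->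
    vdm * h k = (v - 1) * u ^+ l * u ^+ i - (u - 1) * v ^+ l * v ^+ i + (u - v).
  move=> k_ge Dk; rewrite vdm_hsymz // -!mulrA -!exprD.
  by rewrite (_ : `|(k + 2)%R|%N = (l + i)%N); last lia.
have E00 := @Dh l0 L0 0 ltac:(lia) ltac:(lia).
have E01 := @Dh (l0%:Z + 1) L0 1 ltac:(lia) ltac:(lia).
have E02 := @Dh (l0%:Z + 2) L0 2 ltac:(lia) ltac:(lia).
have E10 := @Dh (l1%:Z - 1) L1 0 ltac:(lia) ltac:(lia).
have E11 := @Dh l1 L1 1 ltac:(lia) ltac:(lia).
have E12 := @Dh (l1%:Z + 1) L1 2 ltac:(lia) ltac:(lia).
have E20 := @Dh (l2%:Z - 2) l2 0 ltac:(lia) ltac:(lia).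
have E21 := @Dh (l2%:Z - 1) l2 1 ltac:(lia) ltac:(lia).
have E22 := @Dh l2 l2 2 ltac:(lia) ltac:(lia).
have -> (a00 a01 a02 a10 a11 a12 a20 a21 a22 : R) :
  vdm * vdm * (vdm * (a00 * a11 * a22 - a00 * a12 * a21 - a01 * a10 * a22
     + a01 * a12 * a20 + a02 * a10 * a21 - a02 * a11 * a20)) =
  (vdm * a00) * (vdm * a11) * (vdm * a22) - (vdm * a00) * (vdm * a12) * (vdm * a21)
  - (vdm * a01) * (vdm * a10) * (vdm * a22)
     + (vdm * a01) * (vdm * a12) * (vdm * a20) + (vdm * a02) * (vdm * a10) * (vdm * a21)
     - (vdm * a02) * (vdm * a11) * (vdm * a20) by ring.
rewrite E00 E01 E02 E10 E11 E12 E20 E21 E22 /vdm !expr0 !expr1.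
move: (u ^+ L0) (u ^+ L1) (u ^+ l2) (v ^+ L0) (v ^+ L1) (v ^+ l2) => *.
ring.
Qed.

End Alternant.

Section WeightCoefficients.
Local Notation u := ('X : {poly {poly int}}).
Local Notation v := ('X%:P : {poly {poly int}}).
Local Notation i0 := (@Ordinal 3 0 isT).
Local Notation i1 := (@Ordinal 3 1 isT).
Local Notation i2 := (@Ordinal 3 2 isT).

Definition triple (x y z : int) : {ffun 'I_3 -> nat} :=
  [ffun i : 'I_3 => nth 0%N [:: `|x|; `|y|; `|z|]%N i].

Definition colour_charz n (x y z : int) : 'CF([set: 'S_n]) :=
  if [&& 0 <= x, 0 <= y & 0 <= z] then colour_char n (triple x y z) else 0.

Lemma sum_triple (n : nat) x y z : 0 <= x -> 0 <= y -> 0 <= z -> x + y + z = n%:Z ->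
  (\sum_r triple x y z r = n)%N.
Proof. by rewrite sum_I3 !ffunE /=; lia. Qed.

Lemma prod_triple (R : comNzRingType) (ws : seq R) x y z : 0 <= x -> 0 <= y -> 0 <= z ->
  \prod_r hsym ws (triple x y z r) = hsym3 ws x y z.
Proof. by move=> x0 y0 z0; rewrite prod_I3 !ffunE /= /hsym3 /hsymz x0 y0 z0. Qed.

Lemma hsym3_out (R : comNzRingType) (ws : seq R) x y z :
  ~~ [&& 0 <= x, 0 <= y & 0 <= z] -> hsym3 ws x y z = 0.
Proof.
rewrite /hsym3 /hsymz; case: (0 <= x); rewrite ?mul0r //=.
by case: (0 <= y); rewrite ?mulr0 ?mul0r //= => /negbTE->; rewrite mulr0.
Qed.

Lemma coefzB P Q i j : coefz (P - Q) i j = coefz P i j - coefz Q i j.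
Proof. by rewrite /coefz; case: ifP; rewrite ?subr0 // !coefB. Qed.

Lemma coefzD P Q i j : coefz (P + Q) i j = coefz P i j + coefz Q i j.
Proof. by rewrite /coefz; case: ifP; rewrite ?addr0 // !coefD. Qed.

Lemma coefz0 i j : coefz 0 i j = 0.
Proof. by rewrite /coefz !coef0 if_same. Qed.

Lemma coefz_alt3 F x y z i j :
  coefz (alt3 F x y z) i j = alt3 (fun x y z => coefz (F x y z) i j) x y z.
Proof. by rewrite /alt3 !(coefzB, coefzD). Qed.

Lemma coef_hsym3_uv n x y z (i j : int) : x + y + z = n%:Z -> n%:Z < i + j ->
  coefz (hsym3 [:: u; v; 1] x y z) i j = 0.
Proof.
have [/and3P[x0 y0 z0] sum_n|/hsym3_out-> _ _] := boolP [&& 0 <= x, 0 <= y & 0 <= z];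
  last first.
  exact: coefz0.
rewrite /coefz; case: ifP => // /andP[i_ge0 j_ge0] lt_n.
have sum_al := sum_triple x0 y0 z0 sum_n.
pose a (j : 'I_3) := nat_of_bool (j == i0).
pose b (j : 'I_3) := nat_of_bool (j == i1).
have := colour_table xpredT a b `|i| `|j| sum_al.
rewrite enum_I3 /= /monomial_weight /a /b /= expr1 !expr0 expr1 mulr1 mul1r mulr1
  prod_triple //.
rewrite big1 => [/esym/eqP|g _]; last first.
  rewrite [X in (_ * X)%N]eq_card0 ?muln0 // => c; rewrite inE; apply/andP => -[].
  rewrite /matches !sum_I3 /a /b /= => /and3P[_ /eqP ci /eqP cj] _.
  rewrite !mul0n !mul1n ?addn0 ?add0n in ci cj.
  have := sum_content c; rewrite sum_I3 ci cj; lia.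
by rewrite mulf_eq0 pnatr_eq0 (gtn_eqF (fact_gt0 n)) orbF => /eqP.
Qed.

(* The weights of the tensor product of two planes with weights [u, 1] and
   [v, 1]; [u] is the outer variable. *)
Definition kron_weights : seq {poly {poly int}} := [:: u * v; u; v; 1].

Lemma cfdot_colourz2 n (x y z x' y' z' : int) : x + y + z = n%:Z -> x' + y' + z' = n%:Z ->
  '[colour_charz n x' y' z', colour_charz n x y z] = (coefz (hsym3 [:: u; v;
    1] x y z) x' y')%:~R.
Proof.
move=> sum_n sum_n'; rewrite /colour_charz.
have [/and3P[x0 y0 z0]|out] := boolP [&& 0 <= x, 0 <= y & 0 <= z]; last first.
  by rewrite cfdot0r hsym3_out // coefz0.
case: ifP => [/and3P[x0' y0' z0']|out].
  rewrite (cfdot_colour2 (sum_triple x0 y0 z0 sum_n) (sum_triple x0' y0' z0' sum_n')).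
  by rewrite prod_triple // !ffunE /coefz x0' y0'.
rewrite cfdot0l; have [z0'|z0'] := ltrP z' 0; first by rewrite (coef_hsym3_uv sum_n) //;
  lia.
by rewrite /coefz; case: ifP => // /andP[x0' y0']; rewrite x0' y0' z0' in out.
Qed.

Lemma coef_hsym3_kron n x y z (i j : int) : x + y + z = n%:Z -> n%:Z < i \/ n%:Z < j ->
  coefz (hsym3 kron_weights x y z) i j = 0.
Proof.
have [/and3P[x0 y0 z0] sum_n|/hsym3_out-> _ _] := boolP [&& 0 <= x, 0 <= y & 0 <= z];
  last first.
  exact: coefz0.
rewrite /coefz; case: ifP => // /andP[i_ge0 j_ge0] lt_n.
have sum_al := sum_triple x0 y0 z0 sum_n.
have := kron_table `|i| `|j| sum_al; rewrite prod_triple //.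
rewrite big1 => [/esym/eqP|g _]; last first.
  rewrite [X in (_ * X)%N]eq_card0 ?muln0 // => c; rewrite inE; apply/andP => -[].
  rewrite /matches => /and3P[_ /eqP ci /eqP cj] _.
  have le_n (w : 'I_3 * 'I_3 -> bool) : (\sum_k w k * content c k <= n)%N.
    rewrite -[X in (_ <= X)%N](sum_content c); apply: leq_sum => k _.
    by case: (w k); rewrite ?mul1n ?mul0n.
  have := le_n (fun k => k.1 == i0); have := le_n (fun k => k.2 == i0).
  by rewrite [X in (X <= n)%N -> _]cj [X in _ -> (X <= n)%N -> _]ci; lia.
by rewrite mulf_eq0 pnatr_eq0 (gtn_eqF (fact_gt0 n)) orbF => /eqP.
Qed.

Lemma cfdot_colourz3 n (x y z p q : int) : x + y + z = n%:Z ->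
  '[colour_charz n p (n%:Z - p) 0 * colour_charz n q (n%:Z - q) 0, colour_charz n x y z]
  = (coefz (hsym3 kron_weights x y z) p q)%:~R.
Proof.
move=> sum_n; rewrite /colour_charz.
have [/and3P[x0 y0 z0]|out] := boolP [&& 0 <= x, 0 <= y & 0 <= z]; last first.
  by rewrite cfdot0r hsym3_out // coefz0.
have [lt_p|le_p] := ltrP n%:Z p.
  by rewrite (_ : 0 <= n%:Z - p = false) ?andbF ?mul0r ?cfdot0l ?(coef_hsym3_kron sum_n)
    //; lia.
have [lt_q|le_q] := ltrP n%:Z q.
  by rewrite (_ : 0 <= n%:Z - q = false) ?andbF ?mulr0 ?cfdot0l ?(coef_hsym3_kron sum_n)
    //; lia.
rewrite !subr_ge0 le_p le_q !andbT /coefz.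
have [p0|p0] := lerP 0 p; last by rewrite mul0r cfdot0l.
have [q0|q0] := lerP 0 q; last by rewrite mulr0 cfdot0l.
rewrite (cfdot_colour3 (sum_triple x0 y0 z0 sum_n)) ?prod_triple ?ffunE //.
  by apply: sum_triple; lia.
by apply: sum_triple; lia.
Qed.

End WeightCoefficients.

Section SpechtCharacters.
Local Notation u := ('X : {poly {poly int}}).
Local Notation v := ('X%:P : {poly {poly int}}).

Lemma coefz_mulXn (a b : nat) P (i j : int) :
  coefz (u ^+ a * v ^+ b * P) i j = coefz P (i - a%:Z) (j - b%:Z).
Proof.
rewrite /coefz -mulrA; case: ifP => [/andP[i0 j0]|out]; last by rewrite ifF //; lia.
rewrite coefXnM; have [lt_i|le_i] := ltnP `|i| a; first by rewrite coef0 ifF //; lia.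
rewrite -polyC_exp coefCM coefXnM; have [lt_j|le_j] := ltnP `|j| b;
  first by rewrite ifF //; lia.
rewrite ifT; last by lia.
have Ei : `|(i - a%:Z)%R|%N = (`|i| - a)%N by lia.
have Ej : `|(j - b%:Z)%R|%N = (`|j| - b)%N by lia.
by rewrite Ei Ej.
Qed.

Lemma coefz_Xn (a b : nat) (i j : int) :
  coefz (u ^+ a * v ^+ b) i j = ((i == a%:Z) && (j == b%:Z))%:R.
Proof.
rewrite -[_ * _]mulr1 coefz_mulXn /coefz; case: ifP => [/andP[i0 j0]|out].
  rewrite coef1; have [e|ne] := eqVneq `|(i - a%:Z)%R|%N 0%N; rewrite ?coef1 ?coef0.
    have -> : i == a%:Z by lia.
    by have -> : (`|(j - b%:Z)%R|%N == 0%N) = (j == b%:Z) by lia.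
  by have -> : (i == a%:Z) = false by lia.
by have -> : (i == a%:Z) && (j == b%:Z) = false by lia.
Qed.

Section Psi.
Variables (n l0 l1 l2 : nat).
Hypotheses (le01 : (l1 <= l0)%N) (le12 : (l2 <= l1)%N) (sum_l : (l0 + l1 + l2 = n)%N).

(* The Jacobi-Trudi determinant, with products of complete symmetric functions
   replaced by characters of colourings. *)
Definition psi : 'CF([set: 'S_n]) := alt3 (colour_charz n) l0 l1 l2.

Local Notation JT := (jacobi_trudi [:: u; v; 1] l0 l1 l2).

Lemma cfdot_colour_psi x y z : x + y + z = n%:Z ->
  '[colour_charz n x y z, psi] = (coefz JT x y)%:~R.
Proof.
move=> sum_n; rewrite /psi /jacobi_trudi coefz_alt3 /alt3 !(cfdotBr, cfdotDr).
by do 6 (rewrite cfdot_colourz2; [|lia..]); rewrite !(rmorphB, rmorphD).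
Qed.

(** Pairing the six terms of one determinant with the other amounts to multiplying its polynomial by
    the Vandermonde. The norm is thus the coefficient of u^(l0 + 2) v^(l1 + 1) in an alternant with
    exponents l0 + 2 > l1 + 1 > l2, where only the first term counts. *)
Lemma psi_norm : '[psi] = 1.
Proof.
have -> : '[psi] = (alt3 (fun x y _ => coefz JT x y) l0 l1 l2)%:~R.
  rewrite {1}/psi /alt3 !(cfdotBl, cfdotDl).
  by do 6 (rewrite cfdot_colour_psi; [|lia..]); rewrite !(rmorphB, rmorphD).
have -> : alt3 (fun x y _ => coefz JT x y) l0 l1 l2
    = coefz (vdm u v * JT) (l0%:Z + 2) (l1%:Z + 1).
  move: (jacobi_trudi _ _ _ _) => J.
  have -> : vdm u v * J = u ^+ 2 * v ^+ 1 * J - u ^+ 2 * v ^+ 0 * J - u ^+ 1 * v ^+ 2 * J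
      + u ^+ 1 * v ^+ 0 * J + u ^+ 0 * v ^+ 2 * J - u ^+ 0 * v ^+ 1 * J.
    by rewrite /vdm !expr0 !expr1; move: u v J => a b c; ring.
  rewrite !(coefzB, coefzD, coefz_mulXn) /alt3.
  have e1 (x : int) : x + 2 - 1%:Z = x + 1 by lia.
  have e2 (x : int) : x + 1 - 2%:Z = x - 1 by lia.
  have e3 (x : int) : x + 2 - 2%:Z = x by lia.
  have e4 (x : int) : x + 1 - 1%:Z = x by lia.
  have e5 (x : int) : x - 0%:Z = x by lia.
  by rewrite !e1 !e2 !e3 !e4 !e5; lra.
rewrite alternant_jacobi_trudi; last 3 first.
- by rewrite -subr_eq0 polyXsubC_eq0.
- by rewrite -subr_eq0 -polyCB polyC_eq0 polyXsubC_eq0.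
- by rewrite -subr_eq0 polyXsubC_eq0.
rewrite !(coefzB, coefzD, coefz_Xn).
have -> : l0%:Z + 2 == l0.+2%:Z by lia.
have -> : l1%:Z + 1 == l1.+1%:Z by lia.
have -> : (l1%:Z + 1 == l2%:Z) = false by lia.
have -> : (l0%:Z + 2 == l1.+1%:Z) = false by lia.
by have -> : (l0%:Z + 2 == l2%:Z) = false by lia.
Qed.

End Psi.

(** Five of the six terms have a larger first part or a smaller last part than [lam] and are
    orthogonal to [chi]. So ['[chi, psi] = 1], and as both norms are 1 the difference has norm 0. *)
Lemma specht_psi (lam : seq nat) : is_partition lam -> (size lam <= 3)%N ->
  cfRepr (specht_repr (sumn lam) lam)
    = psi (sumn lam) (nth 0%N lam 0) (nth 0%N lam 1) (nth 0%N lam 2).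
Proof.
move=> part_lam size_lam; set n := sumn lam; set chi := cfRepr _.
have sum_l : (nth 0 lam 0 + nth 0 lam 1 + nth 0 lam 2 = n)%N.
  by rewrite /n; case: lam size_lam {part_lam n chi} => [|? [|? [|? []]]] //= _; lia.
have le01 : (nth 0 lam 1 <= nth 0 lam 0)%N by apply: part_nth.
have le12 : (nth 0 lam 2 <= nth 0 lam 1)%N by apply: part_nth.
have [chi1 chi_lam] := specht_norm part_lam size_lam (erefl n).
have out x y z : (nth 0%N lam 0)%:Z < x \/ z < (nth 0%N lam 2)%:Z ->
  '[chi, colour_charz n x y z] = 0.
  move=> bad; rewrite /colour_charz; case: ifP => [/and3P[x0 y0 z0]|_];
    last by rewrite cfdot0r.
  by rewrite cfdot_specht0 // !ffunE /=; lia.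
have chi_psi : '[chi, psi n (nth 0%N lam 0) (nth 0%N lam 1) (nth 0%N lam 2)] = 1.
  have main : '[chi, colour_charz n (nth 0%N lam 0) (nth 0%N lam 1) (nth 0%N lam 2)] = 1.
    rewrite -chi_lam /colour_charz /=; congr '[_, colour_char _ _].
    by apply/ffunP => -[[|[|[|//]]] lt_i]; rewrite !ffunE.
  rewrite /psi /alt3 !(cfdotBr, cfdotDr) main.
  do 5 (rewrite out; [|lia]).
  by rewrite !(subr0, addr0).
have psi1 := psi_norm le01 le12 sum_l.
move: psi1 chi_psi; move: (psi _ _ _ _) => p p1 chi_p.
have p_chi : '[p, chi] = 1 by rewrite cfdotC chi_p conjC1.
by apply/eqP; rewrite -subr_eq0 -cfnorm_eq0 cfdotBl !cfdotBr chi1 chi_p p_chi p1 !subrr.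
Qed.

(** For two rows only two of the six terms of the determinant have no negative third part, so each
    of the characters of mu and nu is a difference of two colouring characters; their product gives
    four coefficients. *)
Lemma kronecker_coef lam mu nu : admissible lam mu nu ->
  let s := jacobi_trudi kron_weights (nth 0%N lam 0) (nth 0%N lam 1) (nth 0%N lam 2) in
  let i := (nth 0%N mu 0)%:Z in let j := (nth 0%N nu 0)%:Z in
  (kronecker lam mu nu)%:Z
  = coefz s i j - coefz s (i + 1) j - coefz s i (j + 1) + coefz s (i + 1) (j + 1).
Proof.
move=> adm s i j; move: adm; rewrite /admissible.
case/andP=> /and3P[part_lam part_mu part_nu] /and5P[sum_mu sum_nu size_lam size_mu
  size_nu].
pose n := sumn lam.
have psi2 ka : is_partition ka -> (size ka <= 2)%N -> sumn ka = n ->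
  cfRepr (specht_repr n ka) = colour_charz n (nth 0%N ka 0)%:Z (n%:Z - (nth 0%N ka 0)%:Z)
    0
    - colour_charz n ((nth 0%N ka 0)%:Z + 1) (n%:Z - ((nth 0%N ka 0)%:Z + 1)) 0.
  move=> part_ka size_ka <-; rewrite specht_psi //; last by apply: leq_trans size_ka _.
  have k2 : nth 0%N ka 2 = 0%N by rewrite nth_default.
  have k1 : (nth 0%N ka 1)%:Z = (sumn ka)%:Z - (nth 0%N ka 0)%:Z.
    by case: ka {part_ka k2} size_ka => [|? [|? []]] //= _; lia.
  have out x y z : z < 0 -> colour_charz (sumn ka) x y z = 0.
    by move=> z0; rewrite /colour_charz [0 <= z]leNgt z0 !andbF.
  rewrite /psi /alt3 k2 ![colour_charz _ _ _ (0%:Z - _)]out // !(subr0, addr0) -k1.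
  by congr (_ - colour_charz _ _ _ _); lia.
have chi_lam := (specht_norm part_lam size_lam (erefl n)).1.
apply: (intr_inj (R := algC)); rewrite -pmulrn /kronecker multiplicityE //.
rewrite -cfRepr_prod.
rewrite (psi2 mu) ?(eqP sum_mu) // (psi2 nu) ?(eqP sum_nu) // specht_psi //.
set a := nth 0%N lam 0; set b := nth 0%N lam 1; set c := nth 0%N lam 2.
have sum_abc : a%:Z + b%:Z + c%:Z = n%:Z.
  by rewrite /n /a /b /c; case: lam size_lam {part_lam s n chi_lam sum_mu sum_nu psi2 a b
    c} => [|? [|? [|? []]]] //= _; lia.
have coef p q : '[colour_charz n p (n%:Z - p) 0 * colour_charz n q (n%:Z - q) 0,
  psi n a b c] = (coefz s p q)%:~R.
  rewrite /psi /s /jacobi_trudi coefz_alt3 /alt3 !(cfdotBr, cfdotDr).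
  by do 6 (rewrite cfdot_colourz3; [|lia]); rewrite !(rmorphB, rmorphD).
rewrite mulrBl !mulrBr !cfdotBl !coef !(rmorphB, rmorphD) /=.
by ring.
Qed.

End SpechtCharacters.

(** * The recurrence of order four and the Pieri identities *)

Section HsymRecurrence.
Variable R : comNzRingType.

Lemma hsymz_cons (w : R) ws k : hsymz (w :: ws) k = hsymz ws k
  + w * hsymz (w :: ws) (k - 1).
Proof.
rewrite /hsymz; case: ifP => k0; last by rewrite ifF ?mulr0 ?addr0 //; lia.
have [-> | nz_k] := eqVneq k 0; first by rewrite /= !hsym0 mulr0 addr0.
rewrite ifT; last by lia.
have -> : `|k|%N = `|(k - 1)%R|%N.+1 by lia.
by rewrite hsymS.
Qed.

(** Peeling off the variables multiplies the generating function by the four factors 1 - w_i t and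
    leaves 1, hence the condition [0 < k]. *)
Lemma hsymz_rec4 (w1 w2 w3 w4 : R) k : 0 < k -> let h := hsymz [:: w1; w2; w3; w4] in
  h k = (w1 + w2 + w3 + w4) * h (k - 1)
   - (w1 * w2 + w1 * w3 + w1 * w4 + w2 * w3 + w2 * w4 + w3 * w4) * h (k - 2)
   + (w1 * w2 * w3 + w1 * w2 * w4 + w1 * w3 * w4 + w2 * w3 * w4) * h (k - 3)
   - w1 * w2 * w3 * w4 * h (k - 4).
Proof.
move=> k0 h.
have h1 (m : int) : hsymz [:: w4] m = hsymz [::] m
  + w4 * hsymz [:: w4] (m - 1) := hsymz_cons _ _ _.
have h2 (m : int) : hsymz [:: w4] m = hsymz [:: w3; w4] m - w3 * hsymz [:: w3;
  w4] (m - 1).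
  by rewrite (hsymz_cons w3 _ m) addrK.
have h3 (m : int) : hsymz [:: w3; w4] m = hsymz [:: w2; w3; w4] m - w2 * hsymz [:: w2;
  w3; w4] (m - 1).
  by rewrite (hsymz_cons w2 _ m) addrK.
have h4 (m : int) : hsymz [:: w2; w3; w4] m = h m - w1 * h (m - 1).
  by rewrite /h (hsymz_cons w1 _ m) addrK.
have h0 : hsymz ([::] : seq R) k = 0.
  by rewrite /hsymz ltW //; case: k k0 => [[|m]|].
have := h1 k; rewrite h0 add0r !h2 !h3 !h4.
have -> : k - 1 - 1 = k - 2 by lia. have -> : k - 2 - 1 = k - 3 by lia.
have -> : k - 3 - 1 = k - 4 by lia.
move/eqP; rewrite -subr_eq0 => /eqP E; apply/eqP; rewrite -subr_eq0 -E; apply/eqP.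
ring.
Qed.

End HsymRecurrence.

Lemma int_shifts (x : int) :
  ((x + 1 + 1 = x + 2)%R
  * (x + 1 + 2 = x + 3)%R
  * (x + 1 - 2 = x - 1)%R
  * (x - 1 + 2 = x + 1)%R
  * (x - 1 - 1 = x - 2)%R
  * (x - 1 - 2 = x - 3)%R
  * (x + 1 - 1 = x)%R
  * (x - 1 + 1 = x)%R
  * (x + 2 - 1 = x + 1)%R
  * (x + 2 - 2 = x)%R)%type.
Proof. by do !split; lia. Qed.

Section EqualRows.
Variables (R : comNzRingType) (h : int -> R).
Let jt := alt3 (fun x y z => h x * h y * h z).
Lemma jt_eq_rows01 (l0 l2 : int) : jt l0 (l0 + 1) l2 = 0.
Proof. by rewrite /jt /alt3 !int_shifts; ring. Qed.
Lemma jt_eq_rows12 (l0 l1 : int) : jt l0 l1 (l1 + 1) = 0.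
Proof. by rewrite /jt /alt3 !int_shifts; ring. Qed.
End EqualRows.

Section PieriIdentities.
Variables (R : comNzRingType) (e1 e2 e3 e4 : R) (h : int -> R).
Hypothesis h_rec : forall k : int, 0 < k ->
  h k = e1 * h (k - 1) - e2 * h (k - 2) + e3 * h (k - 3) - e4 * h (k - 4).
Let jt := alt3 (fun x y z => h x * h y * h z).
Variables (l0 l1 l2 : int).
Hypotheses (l01 : l1 <= l0) (l12 : l2 <= l1) (l2_ge0 : 0 <= l2).

Let E0 : h (l0 + 3) = e1 * h (l0 + 2) - e2 * h (l0 + 1) + e3 * h l0 - e4 * h (l0 - 1).
Proof.
rewrite h_rec; last by lia.
by rewrite (_ : l0 + 3 - 1 = l0 + 2) 1?(_ : l0 + 3 - 2 = l0 + 1) 1?(_ : l0 + 3 - 3 = l0)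
   1?(_ : l0 + 3 - 4 = l0 - 1) //; lia.
Qed.
Let E1 : h (l1 + 2) = e1 * h (l1 + 1) - e2 * h l1 + e3 * h (l1 - 1) - e4 * h (l1 - 2).
Proof.
rewrite h_rec; last by lia.
by rewrite (_ : l1 + 2 - 1 = l1 + 1) 1?(_ : l1 + 2 - 2 = l1) 1?(_ : l1 + 2 - 3 = l1 - 1)
   1?(_ : l1 + 2 - 4 = l1 - 2) //; lia.
Qed.
Let E2 : h (l2 + 1) = e1 * h l2 - e2 * h (l2 - 1) + e3 * h (l2 - 2) - e4 * h (l2 - 3).
Proof.
rewrite h_rec; last by lia.
by rewrite (_ : l2 + 1 - 1 = l2) 1?(_ : l2 + 1 - 2 = l2 - 1) 1?(_ : l2 + 1 - 3 = l2 - 2)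
   1?(_ : l2 + 1 - 4 = l2 - 3) //; lia.
Qed.

(** In four variables a box in the fourth row completes a column of height four, which is the factor
    [e4]. Only the largest index of each determinant row is rewritten; l0 + 3, l1 + 2 and l2 + 1 are
    positive, as [h_rec] requires. *)
Lemma jt_pieri1 : jt (l0 + 1) l1 l2 + jt l0 (l1 + 1) l2 + jt l0 l1 (l2 + 1)
   + e4 * jt (l0 - 1) (l1 - 1) (l2 - 1) = e1 * jt l0 l1 l2.
Proof. rewrite /jt /alt3 !int_shifts E0 E1 E2; ring. Qed.

(** A vertical strip of three boxes that meets the fourth row misses one of the first three; taking
    out the full column leaves one box removed from that row. *)
Lemma jt_pieri3 : jt (l0 + 1) (l1 + 1) (l2 + 1)
   + e4 * (jt (l0 - 1) l1 l2 + jt l0 (l1 - 1) l2 + jt l0 l1 (l2 - 1)) = e3 * jt l0 l1 l2.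
Proof. rewrite /jt /alt3 !int_shifts E0 E1 E2; ring. Qed.

Lemma jt_pieri2 : jt (l0 + 1) (l1 + 1) l2 + jt (l0 + 1) l1 (l2 + 1) + jt l0 (l1
  + 1) (l2 + 1)
   + e4 * (jt (l0 - 1) (l1 - 1) l2 + jt (l0 - 1) l1 (l2 - 1)
     + jt l0 (l1 - 1) (l2 - 1)) = e2 * jt l0 l1 l2.
Proof. rewrite /jt /alt3 !int_shifts E0 E1 E2; ring. Qed.

End PieriIdentities.

(** * The recursion and its solution *)

(** Comparisons settled by the context are replaced by their values before any case split, which
    keeps the number of cases small. *)
Ltac decide_le := repeat match goal with
 | |- context [@Order.le ?d ?T ?x ?y] =>
    first [ rewrite (_ : @Order.le d T x y = true); [|by lia]
          | rewrite (_ : @Order.le d T x y = false); [|by lia]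
          | case: (@Order.TotalTheory.leP _ _ x y) => ? ];
    rewrite /= ?andbF ?orbT ?orbF ?andbT
 end.

(** For a, c >= 0 the two wings, exchanged by p and q, overlap in [tri]. There [shared] lowers the
    value from 2 to 1 on the edge p + q = b and whenever a or c vanishes; if both vanish, [oddtri]
    leaves only the points with b - p - q even. *)
Definition wing (a b c p q : int) : bool :=
  [&& 0 <= a, 0 <= c, 0 <= p, p <= b, - a <= q, - c <= q & p + q <= b].
Definition tri (b p q : int) : bool := [&& 0 <= p, 0 <= q & p + q <= b].
Definition shared (a b c p q : int) : bool :=
  [&& 0 <= a, 0 <= c, tri b p q & [|| b <= p + q, a <= 0 | c <= 0]].
Definition oddtri (a b c p q : int) : bool :=
  [&& 0 <= a, 0 <= c, a <= 0, c <= 0, tri b p q & odd `|(b - p - q)%R|%N].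

(* The differences of the parts of lambda are [a, b, c], and [a + c + 2 p],
   [a + c + 2 q] are those of mu and nu. *)
Definition corner (a b c p q : int) : int :=
  Posz (wing a b c p q) + Posz (wing a b c q p) - Posz (shared a b c p q)
  - Posz (oddtri a b c p q).

(* [e_1 s_la = sum s_(la + eps_i) + e_4 s_(la - (1,1,1))] in the coordinates of
   [corner]; passing to duals turns it into [pieri_dual], which comes from [e_3]. *)
Definition pieri (F : int -> int -> int -> int -> int -> int) a b c p q : int :=
  F (a + 1) b c (p - 1) (q - 1) + F (a - 1) (b + 1) c p q
  + F a (b - 1) (c + 1) (p - 1) (q - 1) + F a b (c - 1) p q
  - (F a b c p q + F a b c (p - 1) q + F a b c p (q - 1)
     + F a b c (p - 1) (q - 1)).

Lemma pieri_wing (a b c p q : int) : 0 <= b -> 1 <= a + c + 2 * q ->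
  1 <= a -> 1 <= c ->
  pieri (fun a b c p q => Posz (wing a b c p q)) a b c p q = 0.
Proof. by move=> *; rewrite /pieri /wing; decide_le; lia. Qed.

Lemma pieri_shared (a b c p q : int) : 0 <= b -> 1 <= a -> 1 <= c ->
  pieri (fun a b c p q => Posz (shared a b c p q)) a b c p q
  = Posz ((a <= 1) && tri b p q) + Posz ((c <= 1) && tri (b - 1) p q).
Proof. by move=> *; rewrite /pieri /shared /tri; decide_le; lia. Qed.

Lemma oddtri0 (a' b' c' p' q' : int) : (a' != 0) || (c' != 0) ->
  oddtri a' b' c' p' q' = false.
Proof. rewrite /oddtri; lia. Qed.

Lemma corner_tri (a' b' c' p' q' : int) : 0 <= a' -> 0 <= c' -> 0 < a' + c' ->
  (a' == 0) || (c' == 0) -> corner a' b' c' p' q' = Posz (tri b' p' q').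
Proof.
move=> ? ? ? ?; rewrite /corner oddtri0; last by lia.
have E : a' = 0 \/ c' = 0 by lia.
rewrite /wing /shared /tri; case: E => ->; decide_le; lia.
Qed.

Lemma corner_even (b' p' q' : int) :
  corner 0 b' 0 p' q' = Posz (tri b' p' q' && ~~ odd `|(b' - p' - q')%R|%N).
Proof.
rewrite /corner /wing /shared /oddtri /tri.
case: odd; decide_le; lia.
Qed.

Lemma corner_out (a' b' c' p' q' : int) : (a' < 0) || (c' < 0) || (b' < 0) ->
  corner a' b' c' p' q' = 0.
Proof. rewrite /corner /wing /shared /oddtri /tri => ?; lia. Qed.

(** The defects at a = 1 and c = 1 are what the boundary terms at a - 2 = -1 and c - 2 = -1
    compensate in [pieri_kron]. *)
Lemma pieri_corner (a b c p q : int) : 0 <= b -> 1 <= a + c + 2 * p ->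
  1 <= a + c + 2 * q ->
  0 <= a -> 0 <= c ->
  pieri corner a b c p q = - (if a == 1 then corner 0 b c p q else 0)
    - (if c == 1 then corner a (b - 1) 0 p q else 0).
Proof.
move=> b0 m0 n0 a0 c0.
have [a1|a1] := leP 1 a; have [c1|c1] := leP 1 c.
- have E1 := pieri_wing p b0 n0 a1 c1.
  have E2 := pieri_wing q b0 m0 a1 c1.
  have E3 := pieri_shared p q b0 a1 c1.
  have -> : (if a == 1 then corner 0 b c p q else 0) = Posz ((a <= 1) && tri b p q).
    have [->|?] := eqVneq a 1; first by rewrite corner_tri //; lia.
    by have -> : (a <= 1) = false by lia.
  have -> : (if c == 1 then corner a (b - 1) 0 p q else 0)
    = Posz ((c <= 1) && tri (b - 1) p q).
    have [->|?] := eqVneq c 1; first by rewrite corner_tri //; lia.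
    by have -> : (c <= 1) = false by lia.
  move: E1 E2 E3; rewrite /pieri /corner !oddtri0; [|by lia ..].
  rewrite /= !subr0. lra.
- have -> : c = 0 by lia.
  rewrite /pieri [corner _ _ (0-1) _ _]corner_out; last by lia.
  have [->|?] := eqVneq a 1.
    rewrite (_ : 1 - 1 = 0 :> int) // !corner_even ![corner _ _ 0 _ _]corner_tri //.
    rewrite /corner oddtri0 /wing /shared /tri //.
    have -> : odd `|(b + 1 - p - q)%R| = ~~ odd `|(b - p - q)%R| by lia.
    case: (boolP (odd _)) => ?; decide_le; lia.
  rewrite ![corner _ _ 0 _ _]corner_tri; [|by lia ..].
  rewrite /corner !oddtri0 /wing /shared /tri; [|by lia ..].
  decide_le; lia.
- have -> : a = 0 by lia.
  rewrite /pieri [corner (0-1) _ _ _ _]corner_out; last by lia.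
  have [->|?] := eqVneq c 1.
    rewrite (_ : 1 - 1 = 0 :> int) // !corner_even ![corner 0 _ _ _ _]corner_tri //.
    rewrite /corner oddtri0 /wing /shared /tri //.
    have -> : odd `|(b - 1 - p - q)%R| = ~~ odd `|(b - p - q)%R| by lia.
    case: (boolP (odd _)) => ?; decide_le; lia.
  rewrite ![corner 0 _ _ _ _]corner_tri; [|by lia ..].
  rewrite /corner !oddtri0 /wing /shared /tri; [|by lia ..].
  decide_le; lia.
- have -> : a = 0 by lia. have -> : c = 0 by lia.
  rewrite /pieri [corner (0-1) _ _ _ _]corner_out; last by lia.
  rewrite [corner _ _ (0-1) _ _]corner_out; last by lia.
  rewrite !corner_even !corner_tri //.
  have -> : odd `|(b - (p - 1) - q)%R| = ~~ odd `|(b - p - q)%R| by lia.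
  have -> : odd `|(b - p - (q - 1))%R| = ~~ odd `|(b - p - q)%R| by lia.
  have -> : odd `|(b - (p - 1) - (q - 1))%R| = odd `|(b - p - q)%R| by lia.
  rewrite /tri; case: (boolP (odd _)) => ?; decide_le; lia.
Qed.

(** The range runs beyond a / 2; the additional terms have a negative first argument, where the
    functions in use vanish. *)
Definition tower (F : int -> int -> int -> int) (a p q : int) : int :=
  \sum_(i < `|a|%N.+1) F (a - 2 * i%:Z) (p + i%:Z) (q + i%:Z).

Lemma tower_out F (a p q : int) : (forall a' p' q' : int, a' < 0 -> F a' p' q' = 0) ->
  a < 0 -> tower F a p q = 0.
Proof. by move=> F0 a0; apply: big1 => i _; apply: F0; lia. Qed.

Lemma tower_rec F (a p q : int) : (forall a' p' q' : int, a' < 0 -> F a' p' q' = 0) ->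
  tower F a p q = F a p q + tower F (a - 2) (p + 1) (q + 1).
Proof.
move=> F0; have [a0|a0] := ltrP a 0.
  by rewrite !tower_out ?F0 //; lia.
rewrite /tower big_ord_recl /= mulr0 subr0 !addr0; congr (_ + _).
have step (k : nat) : F (a - 2 * (bump 0 k)%:Z) (p + (bump 0 k)%:Z) (q + (bump 0 k)%:Z)
     = F (a - 2 - 2 * k%:Z) (p + 1 + k%:Z) (q + 1 + k%:Z).
  by congr F; rewrite /bump; lia.
under eq_bigr do rewrite step.
set G := fun k : nat => F (a - 2 - 2 * k%:Z) (p + 1 + k%:Z) (q + 1 + k%:Z).
rewrite -(big_mkord xpredT G) -(big_mkord xpredT G).
have [a1|a1] := ltrP a 2.
  by rewrite !big_nat big1 ?big1 // => i _; apply: F0; lia.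
rewrite [LHS](@big_cat_nat _ _ _ `|(a - 2)%R|%N.+1) //=; last by lia.
by rewrite [X in _ + X]big_nat [X in _ + X]big1 ?addr0 // => i ?; apply: F0; lia.
Qed.

Definition kron (a b c p q : int) : int :=
  tower (fun a p q => tower (fun c p q => corner a b c p q) c p q) a p q.

Lemma kron_out (a b c p q : int) : [|| a < 0, b < 0 | c < 0] -> kron a b c p q = 0.
Proof.
move=> out; apply: big1 => i _; apply: big1 => j _.
by apply: corner_out; lia.
Qed.

Lemma kron_rec (a b c p q : int) :
  kron a b c p q = kron (a - 2) b c (p + 1) (q + 1) + kron a b (c - 2) (p + 1) (q + 1)
    - kron (a - 2) b (c - 2) (p + 2) (q + 2) + corner a b c p q.
Proof.
have out1 (c' a' p' q' : int) : a' < 0 ->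
  tower (fun c p q => corner a' b c p q) c' p' q' = 0.
  by move=> a0; apply: big1 => j _; apply: corner_out; rewrite a0.
have out2 (a' c' p' q' : int) : c' < 0 -> corner a' b c' p' q' = 0.
  by move=> c0; apply: corner_out; rewrite c0 orbT.
have split_kron (c' p' q' : int) : kron a b c' p' q' =
    tower (fun c p q => corner a b c p q) c' p' q' + kron (a - 2) b c' (p' + 1) (q' + 1).
  by rewrite {1}/kron tower_rec // => a' p1 q1; apply: out1.
rewrite (split_kron c) (split_kron (c - 2)) tower_rec; last exact: out2.
rewrite (_ : p + 1 + 1 = p + 2) 1?(_ : q + 1 + 1 = q + 2); [lra | lia ..].
Qed.

Lemma pieri_rec (a b c p q : int) :
  pieri kron a b c p q = pieri kron (a - 2) b c (p + 1) (q + 1)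
    + pieri kron a b (c - 2) (p + 1) (q + 1)
    - pieri kron (a - 2) b (c - 2) (p + 2) (q + 2) + pieri corner a b c p q.
Proof.
rewrite /pieri.
rewrite [kron (a + 1) b c _ _]kron_rec [kron (a - 1) _ _ _ _]kron_rec
  [kron a _ (c + 1) _ _]kron_rec [kron a b (c - 1) _ _]kron_rec
  [kron a b c p q]kron_rec [kron a b c (p - 1) q]kron_rec
  [kron a b c p (q - 1)]kron_rec [kron a b c (p - 1) (q - 1)]kron_rec.
have e1 (x : int) : x + 1 - 2 = x - 2 + 1 by lia.
have e2 (x : int) : x - 1 - 2 = x - 2 - 1 by lia.
have e3 (x : int) : x - 1 + 1 = x + 1 - 1 by lia.
have e4 (x : int) : x - 1 + 2 = x + 2 - 1 by lia.
rewrite !e1 !e2 !e3 !e4; lra.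
Qed.

Lemma pieri_kron (a b c p q : int) : 0 <= a -> 0 <= b -> 0 <= c ->
  1 <= a + c + 2 * p -> 1 <= a + c + 2 * q -> pieri kron a b c p q = 0.
Proof.
have Pa (c' p' q' : int) : pieri kron (- 1) b c' p' q' = kron 0 b c' (p' - 1) (q' - 1).
  rewrite /pieri (_ : - 1 + 1 = 0 :> int) // [kron (-1 - 1) _ _ _ _]kron_out //.
  by rewrite ![kron (- 1) _ _ _ _]kron_out // !(addr0, subr0).
have Pc (a' p' q' : int) : pieri kron a' b (- 1) p' q'
  = kron a' (b - 1) 0 (p' - 1) (q' - 1).
  rewrite /pieri (_ : - 1 + 1 = 0 :> int) // [kron _ _ (-1 - 1) _ _]kron_out ?orbT //.
  by rewrite ![kron _ _ (- 1) _ _]kron_out ?orbT // !add0r !(addr0, subr0).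
have Pa2 (c' p' q' : int) : pieri kron (- 2) b c' p' q' = 0.
  by rewrite /pieri !kron_out; lia.
have Pc2 (a' p' q' : int) : pieri kron a' b (- 2) p' q' = 0.
  by rewrite /pieri !kron_out; lia.
have [n] := ubnP (`|a| + `|c|)%N; elim: n a c p q => // n IH a c p q an a0 b0 c0 m0 n0.
rewrite pieri_rec pieri_corner //.
have XA (c' p' q' : int) : kron 0 b c' p' q' = kron 0 b (c' - 2) (p' + 1) (q' + 1)
  + corner 0 b c' p' q'.
  by rewrite {1}kron_rec ![kron (0 - 2) _ _ _ _]kron_out //; lia.
have XC (a' p' q' : int) : kron a' (b - 1) 0 p' q' = kron (a' - 2) (b - 1) 0 (p'
  + 1) (q' + 1) + corner a' (b - 1) 0 p' q'.
  by rewrite {1}kron_rec ![kron _ _ (0 - 2) _ _]kron_out //; lia.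
have -> : pieri kron (a - 2) b c (p + 1) (q + 1) = if a == 1 then kron 0 b c p q else 0.
  have [->|?] := eqVneq a 1; first by rewrite Pa !addrK.
  have [->|?] := eqVneq a 0; first by rewrite Pa2.
  by apply: IH; lia.
have -> : pieri kron a b (c - 2) (p + 1) (q
  + 1) = if c == 1 then kron a (b - 1) 0 p q else 0.
  have [->|?] := eqVneq c 1; first by rewrite Pc !addrK.
  have [->|?] := eqVneq c 0; first by rewrite Pc2.
  by apply: IH; lia.
have -> : pieri kron (a - 2) b (c - 2) (p + 2) (q + 2) =
    (if a == 1 then kron 0 b (c - 2) (p + 1) (q + 1) else 0)
  + (if c == 1 then kron (a - 2) (b - 1) 0 (p + 1) (q + 1) else 0).
  have e (x : int) : x + 2 - 1 = x + 1 by lia.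
  have [->|?] := eqVneq a 1.
    rewrite Pa !e; case: eqVneq => [->|_]; last by rewrite addr0.
    by rewrite !kron_out; lia.
  have [->|?] := eqVneq a 0.
    by rewrite Pa2 add0r; case: ifP => // _; rewrite kron_out; lia.
  have [->|?] := eqVneq c 1; first by rewrite Pc !e add0r.
  have [->|?] := eqVneq c 0; first by rewrite Pc2.
  by rewrite addr0; apply: IH; lia.
move: (XA c p q) (XC a p q).
by have [ea|?] := eqVneq a 1; have [ec|?] := eqVneq c 1; rewrite ?ea ?ec; lra.
Qed.

(** Passage to the dual representation exchanges a and c, so the identity for e_3 follows from the
    one for e_1. *)
Lemma kron_symAC (a b c p q : int) : kron a b c p q = kron c b a p q.
Proof.
have [n] := ubnP (`|a| + `|c|)%N; elim: n a c p q => // n IH a c p q lt_n.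
have [|a0] := ltrP a 0; first by move=> ?; rewrite !kron_out; lia.
have [|c0] := ltrP c 0; first by move=> ?; rewrite !kron_out; lia.
have symc (b' p' q' : int) : corner a b' c p' q' = corner c b' a p' q'.
  by rewrite /corner /wing /shared /oddtri; congr (_ + _ - _ - _); lia.
have sub1 : kron (a - 2) b c (p + 1) (q + 1) = kron c b (a - 2) (p + 1) (q + 1).
  by have [?|?] := ltrP a 2; [rewrite !kron_out | rewrite IH]; lia.
have sub2 : kron a b (c - 2) (p + 1) (q + 1) = kron (c - 2) b a (p + 1) (q + 1).
  by have [?|?] := ltrP c 2; [rewrite !kron_out | rewrite IH]; lia.
have sub3 : kron (a - 2) b (c - 2) (p + 2) (q + 2) = kron (c - 2) b (a - 2) (p + 2) (q
  + 2).
  have [?|?] := ltrP c 2; first by rewrite !kron_out; lia.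
  by have [?|?] := ltrP a 2; [rewrite !kron_out | rewrite IH]; lia.
by rewrite kron_rec symc sub1 sub2 sub3 [RHS]kron_rec; lra.
Qed.

Lemma kron_swap (a b c p q : int) : kron a b c p q = kron a b c q p.
Proof.
apply: eq_bigr => i _; apply: eq_bigr => j _.
by rewrite /corner /shared /oddtri /tri; congr (_ - Posz _ - Posz _); lia.
Qed.

(** Beyond a + c + 2 p = -1 the solution is extended by zero, in contrast to the antisymmetric
    coefficients. *)
Lemma kron_outp (a b c p q : int) : 0 <= a -> 0 <= c -> a + c + 2 * p < 0 ->
  kron a b c p q = 0.
Proof.
move=> a0 c0 pneg; apply: big1 => i _; apply: big1 => j _.
rewrite /corner /wing /shared /oddtri /tri; lia.
Qed.

Lemma kron_small (a b c p q : int) : a < 2 -> c < 2 -> kron a b c p q = corner a b c p q.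
Proof. by move=> ? ?; rewrite kron_rec !kron_out; lia. Qed.

(* The last term makes up for the boundary of the weight range: on the
   antisymmetric extension the value at [m = -2] is minus that at [m = 0]. *)
Lemma pieri2_kron (b p q : int) : 0 <= b -> 0 <= p -> 0 <= q ->
  kron 0 (b + 1) 0 p q + kron 1 (b - 1) 1 (p - 1) (q - 1) + kron 0 (b - 1) 0 p q
  = kron 0 b 0 (p + 1) q + kron 0 b 0 p (q + 1) + 2 * kron 0 b 0 p q
    + (if p == 0 then - kron 0 b 0 p q else kron 0 b 0 (p - 1) q)
    + (if q == 0 then - kron 0 b 0 p q else kron 0 b 0 p (q - 1)).
Proof.
move=> b0 p0 q0; rewrite !kron_small // !corner_even.
rewrite (_ : odd `|(b + 1 - p - q)%R| = ~~ odd `|(b - p - q)%R|); last by lia.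
rewrite (_ : odd `|(b - 1 - p - q)%R| = ~~ odd `|(b - p - q)%R|); last by lia.
rewrite (_ : odd `|(b - (p + 1) - q)%R| = ~~ odd `|(b - p - q)%R|); last by lia.
rewrite (_ : odd `|(b - p - (q + 1))%R| = ~~ odd `|(b - p - q)%R|); last by lia.
rewrite (_ : odd `|(b - (p - 1) - q)%R| = ~~ odd `|(b - p - q)%R|); last by lia.
rewrite (_ : odd `|(b - p - (q - 1))%R| = ~~ odd `|(b - p - q)%R|); last by lia.
rewrite /corner oddtri0 // /wing /shared /tri.
case: (boolP (odd _)) => ?; case: (eqVneq p 0) => ?; case: (eqVneq q 0) => ?;
 decide_le; lia.
Qed.

Definition pieri_dual (F : int -> int -> int -> int -> int -> int) a b c p q : int :=
  pieri (fun a b c p q => F c b a p q) c b a p q.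

(* [pieri] lowers [a], [pieri_dual] lowers [c], and the identity for [e_2] is
   only needed to lower [b] when [a = c = 0]. *)
Lemma kron_unique (g : int -> int -> int -> int -> int -> int) :
  (forall a b c p q : int, [|| a < 0, b < 0 | c < 0] -> g a b c p q = 0) ->
  (forall p q : int, 0 <= p -> 0 <= q -> g 0 0 0 p q = Posz ((p == 0) && (q == 0))) ->
  (forall a b c p q : int, g a b c (- a - c - 1 - p) q = - g a b c p q) ->
  (forall a b c p q : int, g a b c p (- a - c - 1 - q) = - g a b c p q) ->
  (forall a b c p q : int, 0 <= a -> 0 <= b -> 0 <= c -> pieri g a b c p q = 0) ->
  (forall a b c p q : int, 0 <= a -> 0 <= b -> 0 <= c -> pieri_dual g a b c p q = 0) ->
  (forall b p q : int, 0 <= b ->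
     g 0 (b + 1) 0 p q + g 1 (b - 1) 1 (p - 1) (q - 1) + g 0 (b - 1) 0 p q
     = g 0 b 0 (p + 1) q + g 0 b 0 p (q + 1) + 2 * g 0 b 0 p q
       + g 0 b 0 (p - 1) q + g 0 b 0 p (q - 1)) ->
  forall a b c p q : int, - 1 <= a + c + 2 * p -> - 1 <= a + c + 2 * q ->
    g a b c p q = kron a b c p q.
Proof.
move=> g_out g_one anti_p anti_q g_pieri g_dual g_pieri2 a b c p q.
have [a0|a0] := ltrP a 0; first by rewrite g_out ?kron_out ?a0.
have [b0|b0] := ltrP b 0; first by rewrite g_out ?kron_out ?b0 ?orbT.
have [c0|c0] := ltrP c 0; first by rewrite g_out ?kron_out ?c0 ?orbT.
(* The weights 3, 4, 3 are those of the sum of the positive coroots of type A3 on the fundamental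
   weights; under them every other term of the three identities is smaller than the one being
   computed. *)
have [n] := ubnP (3 * `|a| + 4 * `|b| + 3 * `|c|)%N.
elim: n a b c p q a0 b0 c0 => // n IH a b c p q a0 b0 c0 lt_n m0 n0.
have IHg (a' b' c' p' q' : int) :
    (3 * a' + 4 * b' + 3 * c' < 3 * a + 4 * b + 3 * c) ->
    - 1 <= a' + c' + 2 * p' -> - 1 <= a' + c' + 2 * q' ->
      g a' b' c' p' q' = kron a' b' c' p' q'.
  move=> lt' m' n'.
  have [a0'|a0'] := ltrP a' 0; first by rewrite g_out ?kron_out ?a0'.
  have [b0'|b0'] := ltrP b' 0; first by rewrite g_out ?kron_out ?b0' ?orbT.
  have [c0'|c0'] := ltrP c' 0; first by rewrite g_out ?kron_out ?c0' ?orbT.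
  by apply: IH => //; lia.
(* This value is fixed by the reflection, so antisymmetry forces [g] to be 0. *)
have [m1|m1] := eqVneq (a + c + 2 * p) (- 1).
  have := anti_p a b c p q; rewrite (_ : - a - c - 1 - p = p); last by lia.
  by rewrite kron_outp //; lia.
have [n1|n1] := eqVneq (a + c + 2 * q) (- 1).
  have := anti_q a b c p q; rewrite (_ : - a - c - 1 - q = q); last by lia.
  by rewrite kron_swap kron_outp //; lia.
have [a1|a1] := ltrP 0 a.
  have m2 : 1 <= a - 1 + c + 2 * (p + 1) by lia.
  have n2 : 1 <= a - 1 + c + 2 * (q + 1) by lia.
  have a2 : 0 <= a - 1 by lia.
  have := g_pieri (a - 1) b c (p + 1) (q + 1) a2 b0 c0.
  have := pieri_kron a2 b0 c0 m2 n2.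
  rewrite /pieri !addrK.
  rewrite ![g (a - 1) _ _ _ _]IHg ?[g (a - 1 - 1) _ _ _ _]IHg; [|lia ..].
  lra.
have [c1|c1] := ltrP 0 c.
  have m2 : 1 <= c - 1 + a + 2 * (p + 1) by lia.
  have n2 : 1 <= c - 1 + a + 2 * (q + 1) by lia.
  have c2 : 0 <= c - 1 by lia.
  have := g_dual a b (c - 1) (p + 1) (q + 1) a0 b0 c2.
  have := pieri_kron c2 b0 a0 m2 n2.
  rewrite /pieri_dual /pieri !addrK ![kron _ _ a _ _]kron_symAC ![kron _ _ (a
    + 1) _ _]kron_symAC ![kron _ _ (a - 1) _ _]kron_symAC.
  rewrite ![g _ _ (c - 1) _ _]IHg ?[g _ _ (c - 1 - 1) _ _]IHg; [|lia ..].
  lra.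
have {a1} ea : a = 0 by lia.
have {c1} ec : c = 0 by lia.
have [b1|b1] := ltrP 0 b; last first.
  have -> : b = 0 by lia.
  rewrite ea ec g_one ?kron_small ?corner_even; [|lia ..].
  by rewrite /tri; lia.
subst a c.
have b2 : 0 <= b - 1 by lia.
have p0 : 0 <= p by lia.
have q0 : 0 <= q by lia.
have := g_pieri2 (b - 1) p q b2.
have := pieri2_kron b2 p0 q0.
rewrite !addrNK.
(* At p = 0 the argument p - 1 = -1 lies across the wall, and the reflection takes it back to 0 with
   a sign. *)
have -> : g 0 (b - 1) 0 (p - 1) q
  = if p == 0 then - kron 0 (b - 1) 0 p q else kron 0 (b - 1) 0 (p - 1) q.
  case: eqVneq => [->|?]; last by rewrite IHg; lia.
  have := anti_p 0 (b - 1) 0 0 q; rewrite (_ : - 0 - 0 - 1 - 0 = 0 - 1 :> int) // => ->.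
  by rewrite IHg //; lia.
have -> : g 0 (b - 1) 0 p (q - 1)
  = if q == 0 then - kron 0 (b - 1) 0 p q else kron 0 (b - 1) 0 p (q - 1).
  case: eqVneq => [->|?]; last by rewrite IHg; lia.
  have := anti_q 0 (b - 1) 0 p 0; rewrite (_ : - 0 - 0 - 1 - 0 = 0 - 1 :> int) // => ->.
  by rewrite IHg //; lia.
rewrite ![g _ (b - 1) _ _ _]IHg ?[g _ (b - 1 - 1) _ _ _]IHg; [|lia ..].
lra.
Qed.

(** * The recursion for the coefficients of the Schur functions *)

Section CoefficientRecursion.
Local Notation u := ('X : {poly {poly int}}).
Local Notation v := ('X%:P : {poly {poly int}}).
Local Notation i0 := (@Ordinal 3 0 isT).
Local Notation i1 := (@Ordinal 3 1 isT).
Local Notation i2 := (@Ordinal 3 2 isT).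

(** Renaming the colours preserves fixed colourings; this is the source of the symmetry between the
    two parts of mu, and of nu. *)
Lemma colour_charz_swap n (x y z : int) : colour_charz n x y z = colour_charz n y x z.
Proof.
rewrite /colour_charz andbCA; case: ifP => // _.
apply/cfun_inP => g _; rewrite !colour_charE; congr _%:R.
pose s (c : {ffun 'I_n -> 'I_3}) : {ffun 'I_n -> 'I_3} := [ffun k => tperm i0 i1 (c k)].
have sK : involutive s by move=> c; apply/ffunP => k; rewrite !ffunE tpermK.
rewrite -(card_imset _ (inv_inj sK)); apply: eq_card => c.
rewrite -[c in LHS]sK (mem_imset _ _ (inv_inj sK)) !inE.
have -> : fixes g (s c) = fixes g c.
  by apply: eq_forallb => k; rewrite !ffunE (inj_eq perm_inj).
congr (_ && _); apply/eqP/eqP => /ffunP Dc; apply/ffunP => j.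
  have -> : content c j = content (s c) (tperm i0 i1 j).
    by rewrite !ffunE; apply: eq_card => k; rewrite !inE ffunE (inj_eq perm_inj).
  by rewrite Dc !ffunE; case: tpermP => [->|->|/eqP + /eqP] //=; case: j => [[|[|[|]]]].
have -> : content (s c) j = content c (tperm i0 i1 j).
  rewrite !ffunE; apply: eq_card => k; rewrite !inE ffunE.
  by rewrite -(inj_eq (@perm_inj _ (tperm i0 i1))) tpermK.
by rewrite Dc !ffunE; case: tpermP => [->|->|/eqP + /eqP] //=; case: j => [[|[|[|]]]].
Qed.

Lemma coefz_hsym3_sym n (x y z i j : int) : x + y + z = n%:Z ->
  coefz (hsym3 kron_weights x y z) (n%:Z - i) j = coefz (hsym3 kron_weights x y z) i j
  /\ coefz (hsym3 kron_weights x y z) i (n%:Z - j) = coefz (hsym3 kron_weights x y z) i j.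
Proof.
move=> sum_n; have subK (k : int) : n%:Z - (n%:Z - k) = k by lia.
split; apply: (intr_inj (R := algC)); rewrite -!(@cfdot_colourz3 n) // subK.
  by rewrite [colour_charz n (n%:Z - i) _ _]colour_charz_swap.
by rewrite [colour_charz n (n%:Z - j) _ _]colour_charz_swap.
Qed.

Definition jtz := jacobi_trudi kron_weights.

Lemma coefz_jtz_sym (l0 l1 l2 i j N : int) : 0 <= l0 + l1 + l2 -> N = l0 + l1 + l2 ->
  coefz (jtz l0 l1 l2) (N - i) j = coefz (jtz l0 l1 l2) i j
  /\ coefz (jtz l0 l1 l2) i (N - j) = coefz (jtz l0 l1 l2) i j.
Proof.
case: N => [n|n] N0 DN; last by lia.
have sym x y z : x + y + z = n%:Z -> _ := @coefz_hsym3_sym n x y z i j.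
split; rewrite /jtz /jacobi_trudi !coefz_alt3 /alt3.
  by do 6 (rewrite [in LHS](proj1 (sym _ _ _ _)); [|lia]).
by do 6 (rewrite [in LHS](proj2 (sym _ _ _ _)); [|lia]).
Qed.

(** The coefficient of u^i v^j in (1 - 1/u) (1 - 1/v) P, which extracts highest-weight
    multiplicities for the two planes. *)
Definition dcoef P (i j : int) : int :=
  coefz P i j - coefz P (i + 1) j - coefz P i (j + 1) + coefz P (i + 1) (j + 1).

Lemma dcoefD P Q i j : dcoef (P + Q) i j = dcoef P i j + dcoef Q i j.
Proof. by rewrite /dcoef !coefzD; lra. Qed.

Lemma dcoef_mul (a b : nat) P (i j : int) :
  dcoef (u ^+ a * v ^+ b * P) i j = dcoef P (i - a%:Z) (j - b%:Z).
Proof.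
rewrite /dcoef !coefz_mulXn.
have sh (x y : int) : x + 1 - y = x - y + 1 by lia.
by rewrite !sh.
Qed.

Definition gcoef (a b c p q : int) : int :=
  if [&& 0 <= a, 0 <= b & 0 <= c] then
    dcoef (jtz (a + b + c) (b + c) c) (a + b + 2 * c + p) (a + b + 2 * c + q)
  else 0.

Lemma kron_weights_rec (k : int) : 0 < k ->
  let h := hsymz kron_weights in
  h k = ((1 + u) * (1 + v)) * h (k - 1)
   - (u ^+ 2 * v + u * v ^+ 2 + 2 * (u * v) + u + v) * h (k - 2)
   + (u * v * ((1 + u) * (1 + v))) * h (k - 3) - (u ^+ 2 * v ^+ 2) * h (k - 4).
Proof.
move=> k0 h; rewrite {1}/h /kron_weights hsymz_rec4 // -/h.
by move: u v (h _) (h _) (h _) (h _) => *; ring.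
Qed.

Lemma jtz_neg (l0 l1 l2 : int) : l2 < 0 -> jtz l0 l1 l2 = 0.
Proof.
move=> l2_lt0; rewrite /jtz /jacobi_trudi /alt3.
by do 6 (rewrite hsym3_out; [|lia]); rewrite !(subr0, addr0).
Qed.

Lemma jtzE (l0 l1 l2 : int) :
  jtz l0 l1 l2 = alt3 (fun x y z => hsymz kron_weights x * hsymz kron_weights y * hsymz
    kron_weights z) l0 l1 l2.
Proof. by []. Qed.

Lemma dcoef0 i j : dcoef 0 i j = 0.
Proof. by rewrite /dcoef !coefz0. Qed.

(** The value 0 outside the dominant range is the true one for the neighbours in the Pieri
    identities: at a = -1 or b = -1 two rows of the determinant coincide, and at c = -1 its last row
    is zero. *)
Lemma gcoefE (a b c p q : int) : - 1 <= a -> - 1 <= b -> - 1 <= c ->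
  gcoef a b c p q = dcoef (jtz (a + b + c) (b + c) c) (a + b + 2 * c + p) (a + b
    + 2 * c + q).
Proof.
move=> a1 b1 c1; rewrite /gcoef; case: ifP => // out.
have [c0|c0] := ltrP c 0; first by rewrite jtz_neg ?dcoef0.
have [b0|b0] := ltrP b 0; first by rewrite jtzE [X in alt3 _ _ _ X](_ : c = b + c
  + 1) ?jt_eq_rows12 ?dcoef0 //; lia.
by rewrite jtzE [X in alt3 _ _ X _](_ : b + c = a + b + c + 1) ?jt_eq_rows01 ?dcoef0 //;
  lia.
Qed.

Section CoefficientExtraction.
Variables (P P1 P2 P3 P4 P5 P6 : {poly {poly int}}) (i j : int).

Lemma dcoef_pieri1 : P1 + P2 + P3 + u ^+ 2 * v ^+ 2 * P4 = (1 + u) * (1 + v) * P ->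
  dcoef P1 i j + dcoef P2 i j + dcoef P3 i j + dcoef P4 (i - 2) (j - 2)
  = dcoef P i j + dcoef P (i - 1) j + dcoef P i (j - 1) + dcoef P (i - 1) (j - 1).
Proof.
move=> /(congr1 (fun Q => dcoef Q i j)).
have -> : (1 + u) * (1 + v) * P = u ^+ 0 * v ^+ 0 * P + u ^+ 1 * v ^+ 0 * P
    + u ^+ 0 * v ^+ 1 * P + u ^+ 1 * v ^+ 1 * P by move: u v P => *; ring.
by rewrite !dcoefD !dcoef_mul !subr0.
Qed.

Lemma dcoef_pieri3 : P1 + u ^+ 2 * v ^+ 2 * (P2 + P3 + P4) = u * v * ((1 + u) * (1
  + v)) * P ->
  dcoef P1 (i + 1) (j + 1)
    + (dcoef P2 (i - 1) (j - 1) + dcoef P3 (i - 1) (j - 1) + dcoef P4 (i - 1) (j - 1))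
  = dcoef P i j + dcoef P (i - 1) j + dcoef P i (j - 1) + dcoef P (i - 1) (j - 1).
Proof.
move=> /(congr1 (fun Q => dcoef Q (i + 1) (j + 1))).
have -> : u * v * ((1 + u) * (1 + v)) * P = u ^+ 1 * v ^+ 1 * P + u ^+ 2 * v ^+ 1 * P
    + u ^+ 1 * v ^+ 2 * P + u ^+ 2 * v ^+ 2 * P by move: u v P => *; ring.
by rewrite !dcoefD !dcoef_mul !dcoefD !int_shifts.
Qed.

Lemma dcoef_pieri2 :
  P1 + P2 + P3 + u ^+ 2 * v ^+ 2 * (P4 + P5 + P6)
  = (u ^+ 2 * v + u * v ^+ 2 + 2 * (u * v) + u + v) * P ->
  dcoef P1 (i + 1) (j + 1) + dcoef P2 (i + 1) (j + 1) + dcoef P3 (i + 1) (j + 1)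
    + (dcoef P4 (i - 1) (j - 1) + dcoef P5 (i - 1) (j - 1) + dcoef P6 (i - 1) (j - 1))
  = dcoef P (i - 1) j + dcoef P i (j - 1) + 2 * dcoef P i j + dcoef P i (j + 1)
    + dcoef P (i + 1) j.
Proof.
move=> /(congr1 (fun Q => dcoef Q (i + 1) (j + 1))).
have -> : (u ^+ 2 * v + u * v ^+ 2 + 2 * (u * v) + u + v) * P = u ^+ 2 * v ^+ 1 * P
  + u ^+ 1 * v ^+ 2 * P
    + u ^+ 1 * v ^+ 1 * P + u ^+ 1 * v ^+ 1 * P + u ^+ 1 * v ^+ 0 * P
      + u ^+ 0 * v ^+ 1 * P
  by move: u v P => *; ring.
rewrite !dcoefD !dcoef_mul !dcoefD !int_shifts !subr0 => ->; lra.
Qed.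

End CoefficientExtraction.

Ltac int_eq x y := rewrite (_ : x = y); [|lia].

Lemma gcoef_pieri (a b c p q : int) : 0 <= a -> 0 <= b -> 0 <= c ->
  pieri gcoef a b c p q = 0.
Proof.
move=> a0 b0 c0; rewrite /pieri !gcoefE; [|lia ..].
have := dcoef_pieri1 (a + b + 2 * c + p) (a + b + 2 * c + q)
  (@jt_pieri1 _ _ _ _ _ _ kron_weights_rec (a + b + c) (b
    + c) c ltac:(lia) ltac:(lia) c0).
rewrite -!jtzE => E.
int_eq (a + 1 + b + c) (a + b + c + 1).
int_eq (a - 1 + (b + 1) + c) (a + b + c).
int_eq (b + 1 + c) (b + c + 1).
int_eq (a + (b - 1) + (c + 1)) (a + b + c).
int_eq (b - 1 + (c + 1)) (b + c).
int_eq (a + b + (c - 1)) (a + b + c - 1).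
int_eq (b + (c - 1)) (b + c - 1).
int_eq (a + 1 + b + 2 * c + (p - 1)) (a + b + 2 * c + p).
int_eq (a + 1 + b + 2 * c + (q - 1)) (a + b + 2 * c + q).
int_eq (a - 1 + (b + 1) + 2 * c + p) (a + b + 2 * c + p).
int_eq (a - 1 + (b + 1) + 2 * c + q) (a + b + 2 * c + q).
int_eq (a + (b - 1) + 2 * (c + 1) + (p - 1)) (a + b + 2 * c + p).
int_eq (a + (b - 1) + 2 * (c + 1) + (q - 1)) (a + b + 2 * c + q).
int_eq (a + b + 2 * (c - 1) + p) (a + b + 2 * c + p - 2).
int_eq (a + b + 2 * (c - 1) + q) (a + b + 2 * c + q - 2).
int_eq (a + b + 2 * c + (p - 1)) (a + b + 2 * c + p - 1).
int_eq (a + b + 2 * c + (q - 1)) (a + b + 2 * c + q - 1).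
by rewrite E; apply/eqP; rewrite subr_eq0.
Qed.

Lemma gcoef_dual (a b c p q : int) : 0 <= a -> 0 <= b -> 0 <= c ->
  pieri_dual gcoef a b c p q = 0.
Proof.
move=> a0 b0 c0; rewrite /pieri_dual /pieri !gcoefE; [|lia ..].
have := dcoef_pieri3 (a + b + 2 * c + p) (a + b + 2 * c + q)
  (@jt_pieri3 _ _ _ _ _ _ kron_weights_rec (a + b + c) (b
    + c) c ltac:(lia) ltac:(lia) c0).
rewrite -!jtzE => E.
int_eq (a + b + (c + 1)) (a + b + c + 1).
int_eq (a + (b + 1) + (c - 1)) (a + b + c).
int_eq (b + (c + 1)) (b + c + 1).
int_eq (a + 1 + (b - 1) + c) (a + b + c).
int_eq (b + 1 + (c - 1)) (b + c).
int_eq (b - 1 + c) (b + c - 1).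
int_eq (a - 1 + b + c) (a + b + c - 1).
int_eq (a + b + 2 * (c + 1) + (p - 1)) (a + b + 2 * c + p + 1).
int_eq (a + b + 2 * (c + 1) + (q - 1)) (a + b + 2 * c + q + 1).
int_eq (a + (b + 1) + 2 * (c - 1) + p) (a + b + 2 * c + p - 1).
int_eq (a + (b + 1) + 2 * (c - 1) + q) (a + b + 2 * c + q - 1).
int_eq (a + 1 + (b - 1) + 2 * c + (p - 1)) (a + b + 2 * c + p - 1).
int_eq (a + 1 + (b - 1) + 2 * c + (q - 1)) (a + b + 2 * c + q - 1).
int_eq (a - 1 + b + 2 * c + p) (a + b + 2 * c + p - 1).
int_eq (a - 1 + b + 2 * c + q) (a + b + 2 * c + q - 1).
int_eq (a + b + 2 * c + (p - 1)) (a + b + 2 * c + p - 1).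
int_eq (a + b + 2 * c + (q - 1)) (a + b + 2 * c + q - 1).
by rewrite -E; lra.
Qed.

Lemma gcoef_pieri2 (b p q : int) : 0 <= b ->
  gcoef 0 (b + 1) 0 p q + gcoef 1 (b - 1) 1 (p - 1) (q - 1) + gcoef 0 (b - 1) 0 p q
  = gcoef 0 b 0 (p + 1) q + gcoef 0 b 0 p (q + 1) + 2 * gcoef 0 b 0 p q
    + gcoef 0 b 0 (p - 1) q + gcoef 0 b 0 p (q - 1).
Proof.
move=> b0; rewrite !gcoefE; [|lia ..].
have := dcoef_pieri2 (b + p) (b + q)
  (@jt_pieri2 _ _ _ _ _ _ kron_weights_rec b b 0 ltac:(lia) ltac:(lia) isT).
rewrite -!jtzE [jtz b (b + 1) _]jt_eq_rows01 ![jtz _ _ (0 - 1)]jtz_neg //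
  !dcoef0 !(addr0, add0r, mulr0).
int_eq (1 + (b - 1) + 1) (b + 1).
int_eq (b - 1 + 1) b.
int_eq (b + 1 + p) (b + p + 1).
int_eq (b + 1 + q) (b + q + 1).
int_eq (1 + (b - 1) + 2 * 1 + (p - 1)) (b + p + 1).
int_eq (1 + (b - 1) + 2 * 1 + (q - 1)) (b + q + 1).
int_eq (b - 1 + p) (b + p - 1).
int_eq (b - 1 + q) (b + q - 1).
int_eq (b + (p + 1)) (b + p + 1).
int_eq (b + (q + 1)) (b + q + 1).
int_eq (b + (p - 1)) (b + p - 1).
int_eq (b + (q - 1)) (b + q - 1).
by move=> ->; lra.
Qed.

End CoefficientRecursion.

(** The coefficients are symmetric under i -> N - i with N = a + 2 b + 3 c; the factor 1 - 1/u turns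
    this into antisymmetry about a point moved by one half, and likewise for v. *)
Lemma gcoef_anti (a b c p q : int) :
  gcoef a b c (- a - c - 1 - p) q = - gcoef a b c p q
  /\ gcoef a b c p (- a - c - 1 - q) = - gcoef a b c p q.
Proof.
rewrite /gcoef; case: ifP => [/and3P[a0 b0 c0]|_]; last by rewrite oppr0.
have sum0 : 0 <= a + b + c + (b + c) + c by lia.
have DN : a + 2 * b + 3 * c = a + b + c + (b + c) + c by lia.
have : forall i j : int, coefz (jtz (a + b + c) (b + c) c) (a + 2 * b
  + 3 * c - i) j = coefz (jtz (a + b + c) (b + c) c) i j
  /\ coefz (jtz (a + b + c) (b + c) c) i (a + 2 * b + 3 * c - j) = coefz (jtz (a + b
    + c) (b + c) c) i j.
  by move=> i j; apply: coefz_jtz_sym.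
rewrite /dcoef; move: (jtz _ _ _) => P; move: (coefz P) => f {P} sym.
have Dp (x : int) : a + b + 2 * c + (- a - c - 1 - x) = a + 2 * b + 3 * c - (a + b
  + 2 * c + x + 1) by clear; lia.
have Dp1 (x : int) : a + 2 * b + 3 * c - (a + b + 2 * c + x + 1) + 1 = a + 2 * b
  + 3 * c - (a + b + 2 * c + x) by clear; lia.
split.
  rewrite !Dp !Dp1 !(proj1 (sym _ _)).
  by move: (f _ _) (f _ _) (f _ _) (f _ _); clear; lia.
rewrite !Dp !Dp1 !(proj2 (sym _ _)).
by move: (f _ _) (f _ _) (f _ _) (f _ _); clear; lia.
Qed.

Lemma jacobi_trudi0 (R : comNzRingType) (ws : seq R) : jacobi_trudi ws 0 0 0 = 1.
Proof.
have hN (k : int) : k < 0 -> hsymz ws k = 0 by case: k.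
have h0 : hsymz ws 0 = 1 by rewrite /hsymz hsym0.
rewrite /jacobi_trudi /alt3 /hsym3 !add0r h0 (hN (- 1)) // (hN (- 2)) //.
by rewrite !(mul0r, mulr0) !subr0 !addr0 !mulr1.
Qed.

Lemma jtz0 : jtz 0 0 0 = 1.
Proof. exact: jacobi_trudi0. Qed.

Lemma gcoef_one (p q : int) : 0 <= p -> 0 <= q ->
  gcoef 0 0 0 p q = Posz ((p == 0) && (q == 0)).
Proof.
move=> p0 q0; rewrite /gcoef /= /dcoef !addr0 !add0r jtz0.
case: p p0 => [p|] // _; case: q q0 => [q|] // _.
have co (i j : nat) : (1 : {poly {poly int}})`_i`_j = ((i == 0%N) && (j == 0%N))%:R.
  by rewrite coef1; case: eqP => _; rewrite ?coef1 ?coef0.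
have cz (k l : nat) : coefz 1 k l = (1 : {poly {poly int}})`_k`_l by [].
have s1 (k : nat) : Posz k + 1 = k.+1 by lia.
by rewrite !s1 !cz !co; case: p => [|p]; case: q => [|q].
Qed.

Section WeightsOfAdmissibleTriples.
Local Notation part k s := (Posz (nth 0%N s k)).

Lemma admissible_weight lam mu nu : admissible lam mu nu ->
  [/\ part 1%N lam <= part 0%N lam, part 2%N lam <= part 1%N lam,
      part 1%N mu <= part 0%N mu, part 1%N nu <= part 0%N nu &
      part 0%N lam + part 1%N lam + part 2%N lam = part 0%N mu + part 1%N mu
      /\ part 0%N lam + part 1%N lam + part 2%N lam = part 0%N nu + part 1%N nu].
Proof.
case/andP=> /and3P[p_lam p_mu p_nu] /and5P[/eqP Dmu /eqP Dnu s_lam s_mu s_nu].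
split; rewrite ?lez_nat ?part_nth //.
have sum3 (s : seq nat) : (size s <= 3)%N ->
    part 0%N s + part 1%N s + part 2%N s = sumn s.
  by case: s => [|? [|? [|? []]]] //= _; lia.
have sum2 (s : seq nat) : (size s <= 2)%N -> part 0%N s + part 1%N s = sumn s.
  by case: s => [|? [|? []]] //= _; lia.
by rewrite sum3 // !sum2 // Dmu Dnu.
Qed.

Lemma kroneckerE lam mu nu : admissible lam mu nu ->
  let a := part 0%N lam - part 1%N lam in
  let b := part 1%N lam - part 2%N lam in
  let c := part 2%N lam in
  (kronecker lam mu nu)%:Z
  = kron a b c (part 0%N mu - (a + b + 2 * c)) (part 0%N nu - (a + b + 2 * c)).
Proof.
move=> adm a b c; rewrite kronecker_coef //.
have [a0 b0 m0 n0 [Dmu Dnu]] := admissible_weight adm.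
move: (a0) (b0); rewrite -subr_ge0 -/a => a_ge0; rewrite -subr_ge0 -/b => b_ge0.
rewrite -(@kron_unique gcoef).
- rewrite /gcoef a_ge0 b_ge0 /=.
  rewrite (_ : a + b + c = part 0%N lam); last by rewrite /a /b /c; lia.
  rewrite (_ : b + c = part 1%N lam); last by rewrite /b /c; lia.
  by rewrite ![a + b + 2 * c + _]addrC !subrK.
- by move=> *; rewrite /gcoef; case: ifP => // /and3P[? ? ?]; lia.
- exact: gcoef_one.
- by move=> x y z p q; case: (gcoef_anti x y z p q).
- by move=> x y z p q; case: (gcoef_anti x y z p q).
- exact: gcoef_pieri.
- exact: gcoef_dual.
- exact: gcoef_pieri2.
- by rewrite /a /b /c; lia.
- by rewrite /a /b /c; lia.
Qed.

End WeightsOfAdmissibleTriples.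

(** * The explicit formula *)

Definition gap (lo hi : int) : int := Num.max 0 (hi - lo + 1).

Definition strip (P1 P2 Q0 Q1 Q2 e : int) : int :=
  gap (Num.max e (Num.max P1 P2)) (Num.min (Q0 - e) (Num.min Q1 Q2)).

Definition endpoint (P1 P2 Q1 Q2 y : int) : bool :=
  [&& (P2 == y) || (Q2 == y), P1 <= y, P2 <= y, y <= Q1 & y <= Q2].

(** Shrinking [0, Q] by one at each side loses those of its two ends that lie in [lo, hi]; the
    strict inequality avoids counting the same point twice when Q = 0. *)
Lemma gap_shrink (lo hi Q : int) :
  gap (Num.max 0 lo) (Num.min Q hi) - gap (Num.max 1 lo) (Num.min (Q - 1) hi)
  = Posz [&& 0 <= Q, lo <= 0 & 0 <= hi] + Posz [&& 0 < Q, lo <= Q & Q <= hi].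
Proof. by rewrite /gap; lia. Qed.

Lemma endpointE (P1 P2 Q1 Q2 y : int) :
  Posz ((Num.max P1 P2 <= y) && (y <= Num.min Q1 Q2))
  - Posz ((Num.max P1 (P2 + 1) <= y) && (y <= Num.min Q1 (Q2 - 1)))
  = Posz (endpoint P1 P2 Q1 Q2 y).
Proof. by rewrite /endpoint !ge_max !le_min; lia. Qed.

Lemma strip_diff (P1 P2 Q0 Q1 Q2 : int) :
  strip P1 P2 Q0 Q1 Q2 0 - strip P1 P2 Q0 Q1 Q2 1
  - strip P1 (P2 + 1) Q0 Q1 (Q2 - 1) 0 + strip P1 (P2 + 1) Q0 Q1 (Q2 - 1) 1
  = Posz ((0 <= Q0) && endpoint P1 P2 Q1 Q2 0)
    + Posz ((0 < Q0) && endpoint P1 P2 Q1 Q2 Q0).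
Proof.
have PozA (x y : bool) : Posz (x && y) = if x then Posz y else 0 by case: x.
rewrite /strip !subr0.
have := gap_shrink (Num.max P1 P2) (Num.min Q1 Q2) Q0.
have := gap_shrink (Num.max P1 (P2 + 1)) (Num.min Q1 (Q2 - 1)) Q0.
rewrite !(PozA (_ <= Q0)) !(PozA (_ < Q0)) -!endpointE.
move: (gap _ _) (gap _ _) (gap _ _) (gap _ _) => g1 g2 g3 g4.
by case: ifP => _; case: ifP => _ e1 e2; lra.
Qed.

Definition strip_term (b x a c p q : int) : int :=
  strip (ceil_half (b - c - p - q - x)) (b - c - q - x)
        (Num.min 0 (b - (q - p) - 2 * x) + a)
        (Num.min 0 (b - (q - p) - 2 * x) + floor_half (a + (q - p) + x))
        (Num.min 0 (b - (q - p) - 2 * x) + (x - p)) 0.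

Lemma floor_half_ge (y z : int) : (y <= floor_half z) = (2 * y <= z).
Proof. by rewrite /floor_half; lia. Qed.

Lemma ceil_half_le (y z : int) : (ceil_half z <= y) = (z <= 2 * y).
Proof. by rewrite /ceil_half; lia. Qed.

Lemma floor_halfB2 (z : int) : floor_half (z - 2) = floor_half z - 1.
Proof. by rewrite /floor_half; lia. Qed.

Lemma ceil_halfB2 (z : int) : ceil_half (z - 2) = ceil_half z - 1.
Proof. by rewrite /ceil_half; lia. Qed.

Lemma strip_shift (P1 P2 Q0 Q1 Q2 : int) :
  strip (P1 - 1) (P2 - 1) (Q0 - 2) (Q1 - 1) (Q2 - 1) 0 = strip P1 P2 Q0 Q1 Q2 1.
Proof. by rewrite /strip /gap; congr (Num.max 0 (_ + 1)); lia. Qed.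

(* Up to a translation, lowering [a] by 2 removes the two ends of the range
   [0, m + a] and lowering [c] by 2 those of [P2, Q2], so that the second
   difference counts the common ends. *)
Lemma strip_term_rec (b x a c p q : int) :
  let P1 := ceil_half (b - c - p - q - x) in let P2 := b - c - q - x in
  let m := Num.min 0 (b - (q - p) - 2 * x) in
  let Q1 := m + floor_half (a + (q - p) + x) in let Q2 := m + (x - p) in
  strip_term b x a c p q - strip_term b x (a - 2) c (p + 1) (q + 1)
  - strip_term b x a (c - 2) (p + 1) (q + 1) + strip_term b x (a - 2) (c - 2) (p
    + 2) (q + 2)
  = Posz ((0 <= m + a) && endpoint P1 P2 Q1 Q2 0)
    + Posz ((0 < m + a) && endpoint P1 P2 Q1 Q2 (m + a)).
Proof.
move=> P1 P2 m Q1 Q2; rewrite -strip_diff -[strip P1 P2 _ _ _ 1]strip_shift.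
rewrite -[strip P1 (P2 + 1) _ _ _ 1]strip_shift -[P1 - 1]ceil_halfB2.
rewrite /strip_term (_ : q + 1 - (p + 1) = q - p) 1?(_ : q + 2 - (p + 2) = q - p) -/m;
  [|lia ..].
have fl : floor_half (a - 2 + (q - p) + x) = floor_half (a + (q - p) + x) - 1.
  by rewrite -floor_halfB2; congr floor_half; lia.
rewrite fl (_ : b - c - (p + 1) - (q + 1) - x = b - c - p - q - x - 2); last by lia.
rewrite (_ : b - (c - 2) - (p + 1) - (q + 1) - x = b - c - p - q - x); last by lia.
rewrite (_ : b - (c - 2) - (p + 2) - (q + 2) - x = b - c - p - q - x - 2); last by lia.
rewrite /Q1 /Q2 /P2; move: m (floor_half _) {fl Q1 Q2 P2} => m f.
rewrite (_ : b - c - (q + 1) - x = b - c - q - x - 1); last by lia.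
rewrite (_ : b - (c - 2) - (q + 1) - x = b - c - q - x + 1); last by lia.
rewrite (_ : b - (c - 2) - (q + 2) - x = b - c - q - x + 1 - 1); last by lia.
rewrite (_ : m + (a - 2) = m + a - 2); last by lia.
rewrite (_ : m + (f - 1) = m + f - 1); last by lia.
rewrite (_ : m + (x - (p + 1)) = m + (x - p) - 1); last by lia.
by rewrite (_ : m + (x - (p + 2)) = m + (x - p) - 1 - 1); last by lia.
Qed.

(** Each coincidence of ends determines x. At 0 the alternatives are P2 = 0, then Q2 = 0 with m = 0,
    then Q2 = 0 with m < 0; at m + a only Q2 = m + a with m = 0 survives the other inequalities. *)
Lemma strip_term_ends (b x a c p q : int) : 0 <= a -> 0 <= c -> p <= q ->
  b <= a + c + p + q -> 0 <= x <= b -> x <= a + c + 2 * p ->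
  let P1 := ceil_half (b - c - p - q - x) in let P2 := b - c - q - x in
  let m := Num.min 0 (b - (q - p) - 2 * x) in
  let Q1 := m + floor_half (a + (q - p) + x) in let Q2 := m + (x - p) in
  ((0 <= m + a) && endpoint P1 P2 Q1 Q2 0
   = [|| [&& x == b - c - q, 0 <= p & c + p + q <= b],
         [&& x == p, 0 <= p, p + q <= b & b - c < p + q] |
         [&& x == b - q, 0 < c, 0 <= q, p + q < b, 0 <= c + p & b <= a + p + q]])
  /\
  ((0 < m + a) && endpoint P1 P2 Q1 Q2 (m + a)
   = [&& x == a + p, 0 < a, 0 <= q, a + p + q < b, 0 <= a + p & 0 <= c + p]).
Proof.
move=> a0 c0 pq b0 /andP[x0 xb] x1 P1 P2 m Q1 Q2.
rewrite /endpoint /P1 !ceil_half_le.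
have Q1E y : (y <= Q1) = (2 * (y - m) <= a + (q - p) + x).
  by rewrite -floor_half_ge /Q1 lerBlDl.
rewrite !Q1E /P2 /Q2 {P1 P2 Q1 Q2 Q1E}.
rewrite {}/m; case: (lerP 0 (b - (q - p) - 2 * x)) => m0; rewrite ?add0r.
- split; lia.
split. lia.
lia.
Qed.

Lemma Posz_or3 (x y z : bool) : ~~ (x && y) -> ~~ (x && z) -> ~~ (y && z) ->
  Posz [|| x, y | z] = Posz x + Posz y + Posz z.
Proof. by case: x; case: y; case: z. Qed.

Lemma sum_indicator (N : nat) (y : int) (C : bool) :
  \sum_(0 <= x < N.+1) Posz ((x%:Z == y) && C) = Posz [&& 0 <= y, y <= N & C].
Proof.
rewrite big_mkord; case: C; last by rewrite !andbF big1 // => i _; rewrite andbF.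
have [y_in|out] := boolP (0 <= y <= N%:Z); last first.
  rewrite big1 ?(negbTE out) => [|i _]; first by rewrite andbT (negbTE out).
  by case: eqP => // Di; move: out (ltn_ord i); lia.
have yN : (`|y|%N < N.+1)%N by lia.
rewrite (bigD1 (Ordinal yN)) //= big1 => [|i ne_i].
  by rewrite addr0 andbT; lia.
by case: eqP => // Di; case/eqP: ne_i; apply: val_inj => /=; lia.
Qed.

Definition strip_sum (a b c p q : int) : int :=
  \sum_(0 <= x < `|(Num.min b (a + c + 2 * p))%R|%N.+1) strip_term b x%:Z a c p q.

Lemma corner_ends (a b c p q : int) : 0 <= a -> 0 <= c -> p <= q -> b <= a + c + p + q ->
  Posz ((0 <= p) && (c + p + q <= b)) + Posz [&& 0 <= p, p + q <= b & b - c < p + q]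
  + Posz [&& 0 < c, 0 <= q, p + q < b, 0 <= c + p, b <= a + p + q & q <= b]
  + Posz [&& 0 < a, 0 <= q, a + p + q < b, 0 <= a + p & 0 <= c + p] = corner a b c p q.
Proof.
move=> a0 c0 pq bs; rewrite /corner.
(* If a = c = 0, the bound on b gives b <= p + q, so on [tri] the difference b - p - q is 0 and not
   odd. *)
rewrite (_ : oddtri a b c p q = false) ?subr0; last first.
  rewrite /oddtri; have [E|E] : b - p - q = 0 \/ ~~ [&& a <= 0, c <= 0 &
    tri b p q] by rewrite /tri; lia.
    by rewrite E !andbF.
  by apply: contraNF E => /and5P[_ _ -> -> /andP[]].
rewrite (_ : wing a b c p q = (0 <= p) && (p + q <= b)); last by rewrite /wing; lia.
rewrite /wing /shared /tri; decide_le; lia.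
Qed.

(** The range of x depends only on b and a + c + 2 p, which both steps preserve; the second
    difference is therefore taken term by term. *)
Lemma strip_sum_rec (a b c p q : int) : 0 <= a -> 0 <= c -> p <= q ->
  0 <= b <= a + c + p + q -> 0 <= a + c + 2 * p ->
  strip_sum a b c p q = strip_sum (a - 2) b c (p + 1) (q + 1)
    + strip_sum a b (c - 2) (p + 1) (q + 1)
    - strip_sum (a - 2) b (c - 2) (p + 2) (q + 2) + corner a b c p q.
Proof.
move=> a0 c0 pq /andP[b0 bs] r0; rewrite /strip_sum.
rewrite (_ : a - 2 + c + 2 * (p + 1) = a + c + 2 * p); last by lia.
rewrite (_ : a + (c - 2) + 2 * (p + 1) = a + c + 2 * p); last by lia.
rewrite (_ : a - 2 + (c - 2) + 2 * (p + 2) = a + c + 2 * p); last by lia.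
set N := `|_|%N.
have NE : N%:Z = Num.min b (a + c + 2 * p) by rewrite /N; lia.
have {NE} NE : (b <= N /\ N = b :> int) \/ (N = a + c + 2 * p :> int /\
  a + c + 2 * p <= b).
  by rewrite NE; lia.
have : \sum_(0 <= x < N.+1) (strip_term b x a c p q - strip_term b x (a - 2) c (p
  + 1) (q + 1)
  - strip_term b x a (c - 2) (p + 1) (q + 1) + strip_term b x (a - 2) (c - 2) (p
    + 2) (q + 2))
  = corner a b c p q.
  transitivity (\sum_(0 <= x < N.+1) (
    Posz ((x%:Z == b - c - q) && ((0 <= p) && (c + p + q <= b)))
    + Posz ((x%:Z == p) && [&& 0 <= p, p + q <= b & b - c < p + q])
    + Posz ((x%:Z == b - q) && [&& 0 < c, 0 <= q, p + q < b, 0 <= c + p & b <= a + p + q])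
    + Posz ((x%:Z == a + p) && [&& 0 < a, 0 <= q, a + p + q < b, 0 <= a + p &
      0 <= c + p]))).
    apply: eq_big_nat => x /andP[_ ltxN].
    have [xb x1] : 0 <= x%:Z <= b /\ x%:Z <= a + c + 2 * p by lia.
    have [E0 E1] := strip_term_ends a0 c0 pq bs xb x1.
    by rewrite strip_term_rec E0 E1 Posz_or3 // {E0 E1}; clear -a0 c0 pq bs; lia.
  rewrite !big_split /= !sum_indicator.
  rewrite (_ : [&& 0 <= b - c - q, _ & _] = (0 <= p) && (c + p + q <= b));
    last by clear -a0 c0 pq bs NE; lia.
  rewrite (_ : [&& 0 <= p, p <= N & _] = [&& 0 <= p, p + q <= b & b - c < p + q]);
    last by clear -a0 c0 pq bs NE; lia.
  rewrite (_ : [&& 0 <= b - q, _ &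
    _] = [&& 0 < c, 0 <= q, p + q < b, 0 <= c + p, b <= a + p + q & q <= b]);
      last by clear -a0 c0 pq bs NE; lia.
  rewrite (_ : [&& 0 <= a + p, _ & _] = [&& 0 < a, 0 <= q, a + p + q < b, 0 <= a + p &
    0 <= c + p]); last by clear -a0 c0 pq bs NE; lia.
  exact: corner_ends.
rewrite big_split !sumrB /=.
move: (\sum_(0 <= x < _) _) (\sum_(0 <= x < _) _) (\sum_(0 <= x < _) _) (\sum_(0 <= x <
  _) _) => s1 s2 s3 s4.
by move: (corner _ _ _ _ _) => ? ?; lra.
Qed.

(** If a < 0, the range [0, m + a] is empty. If c < 0, then Q2 <= b - q - x < P2, because m <= b -
    (q - p) - 2 x. *)
Lemma strip_sum_out (a b c p q : int) : (a < 0) || (c < 0) -> strip_sum a b c p q = 0.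
Proof.
move=> out; rewrite /strip_sum big1 // => x _.
rewrite /strip_term /strip /gap; apply: max_l.
move: (floor_half _) (ceil_half _) => f1 f2; move: out; clear; lia.
Qed.

Lemma strip_sum_kron (a b c p q : int) : p <= q -> 0 <= b <= a + c + p + q ->
  0 <= a + c + 2 * p ->
  strip_sum a b c p q = kron a b c p q.
Proof.
have [n] := ubnP `|(a + c)%R|%N; elim: n a c p q => // n IH a c p q ltn pq bs r0.
have [out|/norP[]] := boolP ((a < 0) || (c < 0)).
  by rewrite strip_sum_out ?kron_out //; lia.
rewrite -!leNgt => a0 c0.
have IH' a' c' p' q' : p' <= q' -> a' + c' + p' + q' = a + c + p + q ->
  a' + c' + 2 * p' = a + c + 2 * p -> a' + c' < a + c ->
    strip_sum a' b c' p' q' = kron a' b c' p' q'.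
  move=> pq' E1 E2 lt; have [out|/norP[]] := boolP ((a' < 0) || (c' < 0)).
    by rewrite strip_sum_out ?kron_out //; move: out; clear; lia.
  rewrite -!leNgt => a'0 c'0; apply: IH => //; rewrite ?E1 ?E2 //.
  by move: ltn lt a0 c0 a'0 c'0; clear; lia.
by rewrite strip_sum_rec // kron_rec !IH' //; lia.
Qed.

(** If a + c >= 1, the conditions on b hold with enough room to lower b by 2. If a = c = 0, only b =
    p + q + 1 could be affected, and there the parity makes both sides 0. *)
Lemma corner_shift (a b c p q : int) : a + c + p + q < b ->
  corner a b c p q = corner a (b - 2) c p q.
Proof.
move=> lt_b; rewrite /corner; have [out|/norP[]] := boolP ((a < 0) || (c < 0)).
  by rewrite -[LHS]/(corner a b c p q) -[RHS]/(corner a (b - 2) c p q) !corner_out //;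
    lia.
rewrite -!leNgt => a0 c0.
have [/andP[/eqP a_0 /eqP c_0]|ac] := boolP ((a == 0) && (c == 0)).
  rewrite -[LHS]/(corner a b c p q) -[RHS]/(corner a (b - 2) c p q) a_0 c_0 !corner_even
    /tri.
  have -> : odd `|(b - 2 - p - q)%R|%N = odd `|(b - p - q)%R|%N.
    lia.
  have [e|ne] := eqVneq (b - p - q) 1; first by rewrite e /= !andbF.
  by congr (Posz (_ && _)); lia.
rewrite !oddtri0 ?subr0; [|lia ..].
by congr (Posz _ + Posz _ - Posz _); rewrite /wing /shared /tri; lia.
Qed.

(** Both steps of the double sum preserve s = a + c + p + q, so [corner_shift] applies to all
    summands at once. The largest possible k is the floor of (b - s + 1) / 2, which is l_0 unless
    negative; then b - 2 k <= s. *)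
Lemma kron_shift (k : nat) (a b c p q : int) : a + c + p + q + 2 * k%:Z <= b + 1 ->
  kron a b c p q = kron a (b - 2 * k%:Z) c p q.
Proof.
elim: k b => [|k IH] b le_b; first by rewrite mulr0 subr0.
rewrite (_ : b - 2 * k.+1%:Z = b - 2 - 2 * k%:Z); last by lia.
rewrite -IH; last by lia.
by apply: eq_bigr => i _; apply: eq_bigr => j _; apply: corner_shift; lia.
Qed.

(** In weight coordinates b + c - q is the second part of nu. *)
Lemma kron_outq (a b c p q : int) : b + c < q -> kron a b c p q = 0.
Proof.
move=> lt_q; have [c0|c0] := ltrP c 0; first by apply: kron_out; rewrite c0 !orbT.
apply: big1 => i _; apply: big1 => j _; rewrite /corner.
rewrite (_ : wing _ _ _ _ _ = false) 1?(_ : wing _ _ _ _ _ = false); [|rewrite /wing;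
  lia..].
by rewrite /shared /oddtri (_ : tri _ _ _ = false) ?andbF //= /tri; lia.
Qed.

Lemma kronecker_sumE (chi : 'rV[int]_7) :
  let a := wL1 chi - wL2 chi in let b := wL2 chi - wL3 chi in let c := wL3 chi in
  let p := wM1 chi - (a + b + 2 * c) in let q := wN1 chi - (a + b + 2 * c) in
  wM1 chi - wM2 chi = a + c + 2 * p -> wN1 chi - wN2 chi = a + c + 2 * q ->
  kronecker_sum chi = strip_sum a b c p q.
Proof.
cbv zeta; rewrite /kronecker_sum.
move: (wL1 chi) (wL2 chi) (wL3 chi) (wM1 chi) (wM2 chi) (wN1 chi) (wN2 chi) => L1 L2 L3
  M1 M2 N1 N2.
set a := L1 - L2; set b := L2 - L3; set c := L3; set p := M1 - (a + b + 2 * c);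
  set q := N1 - (a + b + 2 * c).
move=> DM DN; rewrite /strip_sum DM.
have M1E : M1 = a + b + 2 * c + p by rewrite addrC /p /q subrK.
have N1E : N1 = a + b + 2 * c + q by rewrite addrC /p /q subrK.
have L1E : L1 = a + b + c by rewrite -addrA /b /c subrK /a subrK.
have L2E : L2 = b + c by rewrite /b /c subrK.
move: a b c p q DM DN M1E N1E L1E L2E => a b c p q DM DN M1E N1E L1E L2E.
apply: eq_bigr => x _; rewrite /strip_term /strip /gap !subr0.
rewrite (_ : M2 - N2 = q - p); last by lia.
rewrite (_ : a - (M1 + N1 - L1 - 2 * L2) - x%:Z = b - c - p - q - x%:Z); last by lia.
rewrite (_ : N2 - 2 * c - x%:Z = b - c - q - x%:Z); last by lia.
rewrite (_ : M2 - L2 + x%:Z = x%:Z - p); last by lia.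
congr (Num.max 0 (_ - _ + 1)).
by rewrite {DM DN M1E N1E L1E L2E}; move: (Num.min 0 _) (floor_half _) => m f; lia.
Qed.

Section Formula.
Local Notation part k s := (Posz (nth 0%N s k)).
Variables lam mu nu : seq nat.
Hypothesis adm : admissible lam mu nu.
Let a : int := part 0%N lam - part 1%N lam.
Let b : int := part 1%N lam - part 2%N lam.
Let c : int := part 2%N lam.
Let p : int := part 0%N mu - (a + b + 2 * c).
Let q : int := part 0%N nu - (a + b + 2 * c).
Let l : int := shift_coef (weight lam mu nu).
Let chibar := reduced_weight (weight lam mu nu).

Lemma shift_coefE : l = Num.max 0 (floor_half (b - (a + c + p + q) + 1)).
Proof.
rewrite /l /shift_coef /weight /weight_row !mxE !(tnth_nth 0) /=.
by congr (Num.max 0 (floor_half _)); rewrite /p /q /a /b /c; lia.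
Qed.

Lemma chibarE : [/\ wL1 chibar = a + b + c - 2 * l, wL2 chibar = b
  + c - 2 * l, wL3 chibar = c
  & [/\ wM1 chibar = a + b + 2 * c + p - 2 * l, wM2 chibar = b + c - p - 2 * l,
    wN1 chibar = a + b + 2 * c + q - 2 * l & wN2 chibar = b + c - q - 2 * l]].
Proof.
have [_ _ _ _ [Dmu Dnu]] := admissible_weight adm.
rewrite /chibar /reduced_weight -/l; move: l => k.
rewrite /weight /weight_row !mxE !(tnth_nth 0) /=.
by split; last split; rewrite /p /q /a /b /c; lia.
Qed.

Lemma kronecker_shift : (kronecker lam mu nu)%:Z = kron a (b - 2 * l) c p q.
Proof.
rewrite kroneckerE // -/a -/b -/c -/p -/q.
have l0 : 0 <= l by rewrite shift_coefE le_max lexx.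
have [le_b|->] : a + c + p + q + 2 * l <= b + 1 \/ l = 0; last by rewrite mulr0 subr0.
  by rewrite shift_coefE /floor_half; move: b (a + c + p + q) => x y; lia.
by rewrite -[l]gez0_abs // -kron_shift // gez0_abs.
Qed.

(** The shift changes neither lambda_3 nor the differences lambda_1 - lambda_2, mu_1 - mu_2 and nu_1
    - nu_2, so only three of the seven conditions can fail. *)
Lemma dominant_chibar : dominant chibar = [&& 2 * l <= b, 2 * l + p <= b + c &
  2 * l + q <= b + c].
Proof.
have [a0 _ m0 n0 [Dmu Dnu]] := admissible_weight adm.
have [L1E L2E L3E [M1E M2E N1E N2E]] := chibarE.
rewrite /dominant L1E L2E L3E M1E M2E N1E N2E.
have r0 : 0 <= a + c + 2 * p by rewrite /p /a /b /c; lia.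
have r1 : 0 <= a + c + 2 * q by rewrite /q /a /b /c; lia.
have {}a0 : 0 <= a by rewrite subr_ge0.
have c0 : 0 <= c by [].
move: a b c p q l r0 r1 a0 c0 {L1E L2E L3E M1E M2E N1E N2E}; clear; lia.
Qed.

Lemma kronecker_not_dominant : ~~ dominant chibar -> kronecker lam mu nu = 0%N.
Proof.
rewrite dominant_chibar => nd; apply/eqP; rewrite -eqz_nat kronecker_shift; apply/eqP.
have [b0|b0] := ltrP (b - 2 * l) 0; first by rewrite kron_out // b0 orbT.
have [q0|q0] := ltrP (b - 2 * l + c) q; first by rewrite kron_outq.
by rewrite kron_swap kron_outq //; lia.
Qed.

Lemma chibar_slope : (wM1 chibar - wM2 chibar <= wN1 chibar - wN2 chibar) = (p <= q).
Proof.
have [_ _ _ [-> -> -> ->]] := chibarE; move: a b c p q l; clear; lia.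
Qed.

Lemma kronecker_sum_chibar : dominant chibar -> p <= q ->
  kronecker_sum chibar = (kronecker lam mu nu)%:Z.
Proof.
rewrite dominant_chibar => /and3P[b0 _ _] pq.
have [a0 _ m0 n0 [Dmu Dnu]] := admissible_weight adm.
have lE := shift_coefE.
have r0 : 0 <= a + c + 2 * p by rewrite /p /a /b /c; lia.
rewrite kronecker_shift -strip_sum_kron //; last first.
  rewrite subr_ge0 b0 /=; move: lE; rewrite /floor_half; move: b l (a + c + p + q);
    clear; lia.
have [L1E L2E L3E [M1E M2E N1E N2E]] := chibarE.
rewrite kronecker_sumE ?L1E ?L2E ?L3E ?M1E ?M2E ?N1E ?N2E.
- by congr strip_sum; move: a b c p q l; clear; lia.
- by move: a b c p q l; clear; lia.
- by move: a b c p q l; clear; lia.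
Qed.

End Formula.

Lemma admissible_swap lam mu nu : admissible lam mu nu -> admissible lam nu mu.
Proof. by case/andP=> /and3P[? ? ?] /and5P[? ? ? ? ?]; apply/andP; split;
  [apply/and3P | apply/and5P]. Qed.

Lemma kronecker_formula lam mu nu : admissible lam mu nu ->
  let chibar := reduced_weight (weight lam mu nu) in
  let chibar_swap := reduced_weight (weight lam nu mu) in
  dominant chibar ->
  (kronecker lam mu nu)%:Z =
    if wM1 chibar - wM2 chibar <= wN1 chibar - wN2 chibar
    then kronecker_sum chibar else kronecker_sum chibar_swap.
Proof.
move=> adm chibar chibar_swap dom; have adm' := admissible_swap adm.
rewrite /chibar chibar_slope //; case: ifP => [pq|/negbT qp].
  by rewrite kronecker_sum_chibar.
rewrite (kronecker_sum_chibar adm').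
- by rewrite (kroneckerE adm) (kroneckerE adm') kron_swap.
- have sE : shift_coef (weight lam nu mu) = shift_coef (weight lam mu nu).
    rewrite (shift_coefE adm) (shift_coefE adm');
      congr (Num.max 0 (floor_half (_ - _ + 1))).
    by rewrite -addrA [X in _ + X]addrC addrA.
  by move: dom; rewrite (dominant_chibar adm) (dominant_chibar adm') sE => /and3P[-> ->
    ->].
- by rewrite ltW // ltNge.
Qed.

(** * Closed form and quasi-polynomiality *)

Definition ind (x : bool) : rat := x%:R.

(* The number of [(i, j) >= 0] with [i + j <= n]. *)
Definition triangle (n : int) : rat :=
  if 0 <= n then (n + 1)%:~R * (n + 2)%:~R / 2 else 0.

Definition odd_int (n : int) : bool := odd `|n|%N.

(* The number of [(i, j) >= 0] with [2 i + j <= n]. *)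
Definition half_triangle (n : int) : rat :=
  if 0 <= n then ((n + 2)%:~R ^+ 2 - (odd_int n)%:R) / 4 else 0.

Lemma triangle_out (n : int) : n < 0 -> triangle n = 0.
Proof. by rewrite /triangle leNgt => ->. Qed.

Lemma half_triangle_out (n : int) : n < 0 -> half_triangle n = 0.
Proof. by rewrite /half_triangle leNgt => ->. Qed.

(** The polynomial has roots -1 and -2, so differences near 0 need no case distinction. *)
Lemma triangle_ge (n : int) : - 2 <= n -> triangle n = (n%:~R + 1) * (n%:~R + 2) / 2.
Proof.
rewrite /triangle; case: ifP => [_ _|n0 n2]; first by rewrite !intrD.
by have [->|->] : n = - 1 \/ n = - 2 by lia.
Qed.

Lemma half_triangle_ge (n : int) : - 2 <= n ->
  half_triangle n = ((n%:~R + 2) ^+ 2 - (odd_int n)%:R) / 4.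
Proof.
rewrite /half_triangle; case: ifP => [_ _|n0 n2]; first by rewrite !intrD.
by have [->|->] : n = - 1 \/ n = - 2 by lia.
Qed.

Lemma triangle_diff2 (n : int) :
  triangle n - 2 * triangle (n - 1) + triangle (n - 2) = ind (0 <= n).
Proof.
have [n0|n0] := lerP 0 n; last by rewrite !triangle_out ?mulr0 ?subr0 ?addr0 //; lia.
by rewrite !triangle_ge; [rewrite !intrB /ind mulr1n; field | lia ..].
Qed.

(** Separate the points (i, j) by the parity of i. *)
Lemma triangle_split (n : int) : triangle n = half_triangle n + half_triangle (n - 1).
Proof.
have [n0|n0] := lerP 0 n; last by rewrite triangle_out // !half_triangle_out ?addr0 //;
  lia.
rewrite triangle_ge ?half_triangle_ge; [|lia ..].
have -> : (odd_int (n - 1))%:R = 1 - (odd_int n)%:R :> rat.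
  have -> : odd_int (n - 1) = ~~ odd_int n by rewrite /odd_int; lia.
  by case: odd_int; rewrite ?subr0 ?subrr.
by rewrite intrB; field.
Qed.

(* For [A, C >= -1], the number of [(i, j)] in [[0, A] x [0, C]] with
   [i + j <= n], by inclusion and exclusion. *)
Definition box (A C n : int) : rat :=
  triangle n - triangle (n - A - 1) - triangle (n - C - 1) + triangle (n - A - C - 2).

(** Inclusion and exclusion over the points with i > 0 and those with j > 0 leaves the origin. *)
Lemma box_rec (A C n : int) :
  box A C n - box (A - 1) C (n - 1) - box A (C - 1) (n - 1)
    + box (A - 1) (C - 1) (n - 2) = ind (0 <= n).
Proof.
rewrite -triangle_diff2 /box.
rewrite (_ : n - 1 - (A - 1) - 1 = n - A - 1); last by lia.
rewrite (_ : n - 1 - (A - 1) - C - 2 = n - A - C - 2); last by lia.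
rewrite (_ : n - 1 - A - (C - 1) - 2 = n - A - C - 2); last by lia.
rewrite (_ : n - 2 - (A - 1) - (C - 1) - 2 = n - A - C - 2); last by lia.
rewrite (_ : n - 2 - (A - 1) - 1 = n - 1 - A - 1); last by lia.
rewrite (_ : n - 2 - (C - 1) - 1 = n - 1 - C - 1); last by lia.
rewrite (_ : n - 1 - (C - 1) - 1 = n - C - 1); last by lia.
by lra.
Qed.

Lemma box0l (C n : int) : box (- 1) C n = 0.
Proof. by rewrite /box opprK addrK (_ : n + 1 - C - 2 = n - C - 1); [lra | lia]. Qed.

Lemma box0r (A n : int) : box A (- 1) n = 0.
Proof. by rewrite /box opprK addrK (_ : n - A + 1 - 2 = n - A - 1); [lra | lia]. Qed.

(* The number of [(i, j) >= 0] with [i + j <= n] and [i - j <= D]. *)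
Definition cone (n D : int) : rat :=
  if 0 <= D then triangle n - half_triangle (n - D - 1) else half_triangle (n + D).

(** Lowering i by one changes (n, D) to (n - 1, D - 1), lowering j to (n - 1, D + 1); again only the
    origin is left. *)
Lemma cone_rec (n D : int) :
  cone n D - cone (n - 1) (D - 1) - cone (n - 1) (D + 1)
    + cone (n - 2) D = ind ((0 <= n) && (0 <= D)).
Proof.
have coneN m : cone m (- 1) = triangle m - half_triangle m.
  by rewrite -[LHS]/(half_triangle (m - 1)) triangle_split addrAC subrr add0r.
have cone0 : triangle (n - 1) - half_triangle (n - 2) = half_triangle (n - 1).
  by rewrite triangle_split (_ : n - 1 - 1 = n - 2) ?addrK //; lia.
have [D0|D0] := lerP 0 D.
  rewrite andbT -triangle_diff2.
  have -> : cone (n - 1) (D - 1) = triangle (n - 1) - half_triangle (n - D - 1).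
    have [D1|D1] := lerP 1 D; last first.
      by have -> : D = 0; [lia | rewrite sub0r coneN subr0].
    rewrite /cone subr_ge0 D1; congr (_ - half_triangle _); lia.
  rewrite /cone D0 (_ : 0 <= D + 1); last by lia.
  rewrite (_ : n - 1 - (D + 1) - 1 = n - 2 - D - 1); last by lia.
  lra.
rewrite andbF /cone (_ : 0 <= D = false) 1?(_ : 0 <= D - 1 = false); [|lia..].
rewrite (_ : n - 1 + (D - 1) = n - 2 + D); last by lia.
case: ifP => [D1|_]; last by rewrite (_ : n - 1 + (D + 1) = n + D); [rewrite /ind mulr0n;
  lra | lia].
have -> : D = - 1 by lia.
rewrite (_ : n - 1 - (- 1 + 1) - 1 = n - 2) 1?cone0; last by lia.
by rewrite /ind mulr0n; lra.
Qed.

Definition outer (a b c p q : int) : bool :=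
  [&& p < 0, 0 <= q, q <= b, - a <= p & - c <= p].

(** Summed over the pairs (i, j) of the double tower, each piece counts a simple region: a band in a
    box, at most one point, or a rectangle in the coordinates i + j and i - j. *)
Lemma corner_split (a b c p q : int) : 0 <= a -> 0 <= c -> 0 <= b ->
  corner a b c p q = Posz (tri b p q) + Posz [&& 0 < a, 0 < c, 0 <= p, 0 <= q & p + q < b]
    - Posz (oddtri a b c p q) + Posz (outer a b c p q) + Posz (outer a b c q p).
Proof.
move=> a0 c0 b0; rewrite /corner.
rewrite (_ : Posz (wing a b c p q) = Posz (tri b p q) + Posz (outer a b c q p));
  last first.
  by rewrite /wing /tri /outer; lia.
rewrite (_ : Posz (wing a b c q p) = Posz (tri b p q) + Posz (outer a b c p q));
  last first.
  by rewrite /wing /tri /outer; lia.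
rewrite (_ : Posz (tri b p q) = Posz (shared a b c p q)
  + Posz [&& 0 < a, 0 < c, 0 <= p, 0 <= q & p + q < b]); last first.
  by rewrite /shared /tri; lia.
by move: (Posz _) (Posz _) (Posz _) (Posz _) (Posz _); clear; lia.
Qed.

Definition band (A C lo hi : int) : rat :=
  if lo <= hi then box A C hi - box A C (lo - 1) else 0.

Lemma band_rec (A C lo hi : int) :
  band A C lo hi - band (A - 1) C (lo - 1) (hi - 1) - band A (C - 1) (lo - 1) (hi - 1)
  + band (A - 1) (C - 1) (lo - 2) (hi - 2) = ind (lo <= 0 <= hi).
Proof.
rewrite /band (_ : (lo - 1 <= hi - 1) = (lo <= hi)); last by lia.
rewrite (_ : (lo - 2 <= hi - 2) = (lo <= hi)); last by lia.
case: ifP => [le_hi|gt_hi]; last by rewrite (_ : _ && _ = false) ?subr0 ?addr0 //; lia.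
have -> : ind (lo <= 0 <= hi) = ind (0 <= hi) - ind (0 <= lo - 1).
  have [h0|h0] := lerP 0 hi; last by rewrite andbF (_ : 0 <= lo - 1 = false) ?subrr //;
    lia.
  by rewrite andbT (_ : (0 <= lo - 1) = ~~ (lo <= 0)); [case: (lo <= 0) | lia].
rewrite -(box_rec A C hi) -(box_rec A C (lo - 1)).
rewrite (_ : lo - 2 - 1 = lo - 1 - 2); last by lia.
by lra.
Qed.

Lemma band0l (C lo hi : int) : band (- 1) C lo hi = 0.
Proof. by rewrite /band !box0l subrr if_same. Qed.

Lemma band0r (A lo hi : int) : band A (- 1) lo hi = 0.
Proof. by rewrite /band !box0r subrr if_same. Qed.

(** Along the towers [tri] depends on i + j only, with p + i + j >= 0, q + i + j >= 0 and 2 (i + j)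
    <= b - p - q, while i <= a / 2 and j <= c / 2. *)
Definition kron_tri (a b c p q : int) : rat :=
  band (floor_half a) (floor_half c) (Num.max (- p) (- q)) (floor_half (b - p - q)).

Definition kron_core (a b c p q : int) : rat :=
  if (0 < a) && (0 < c) then kron_tri (a - 1) (b - 1) (c - 1) p q else 0.

(** [oddtri] requires a - 2 i = c - 2 j = 0, so at most one pair (i, j) contributes. *)
Definition kron_apex (a b c p q : int) : bool :=
  [&& 0 <= a, 0 <= c, ~~ odd_int a, ~~ odd_int c, a + c + p + q <= b &
    odd_int (b - (a + c + p + q))].

(** The region is -q <= i + j <= min(-p - 1, b - q) and -(c + p) <= i - j <= a + p, a difference of
    four cones. It is empty unless p < q, where the guard keeps the difference from becoming
    negative. *)
Definition kron_outer (a b c p q : int) : rat :=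
  if p < q then
    cone (Num.min (- p - 1) (b - q)) (a + p) - cone (Num.min (- p - 1) (b - q)) (- (c
      + p) - 1)
    - (cone (- q - 1) (a + p) - cone (- q - 1) (- (c + p) - 1))
  else 0.

Definition diff2 (F : int -> int -> int -> int -> int -> rat) (a b c p q : int) : rat :=
  F a b c p q - F (a - 2) b c (p + 1) (q + 1) - F a b (c - 2) (p + 1) (q + 1)
  + F (a - 2) b (c - 2) (p + 2) (q + 2).

Lemma kron_tri_diff2 (a b c p q : int) : diff2 kron_tri a b c p q = ind (tri b p q).
Proof.
have -> : tri b p q = (Num.max (- p) (- q) <= 0 <= floor_half (b - p - q)).
  by rewrite ge_max floor_half_ge /tri; lia.
rewrite -(band_rec (floor_half a) (floor_half c)) /diff2 /kron_tri !floor_halfB2.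
rewrite (_ : b - (p + 1) - (q + 1) = b - p - q - 2); last by lia.
rewrite (_ : b - (p + 2) - (q + 2) = b - p - q - 2 - 2); last by lia.
rewrite (_ : Num.max (- (p + 1)) _ = Num.max (- p) (- q) - 1); last by lia.
rewrite (_ : Num.max (- (p + 2)) _ = Num.max (- p) (- q) - 2); last by lia.
by rewrite !floor_halfB2 -[_ - 1 - 1]addrA.
Qed.

Lemma kron_tri_out (a b c p q : int) : - 2 <= a -> - 2 <= c -> (a < 0) || (c < 0) ->
  kron_tri a b c p q = 0.
Proof.
move=> a2 c2 /orP[lt0|lt0]; rewrite /kron_tri.
  by rewrite (_ : floor_half a = - 1) ?band0l // /floor_half; lia.
by rewrite (_ : floor_half c = - 1) ?band0r // /floor_half; lia.
Qed.

Lemma kron_coreE (a b c p q : int) : - 1 <= a -> - 1 <= c ->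
  kron_core a b c p q = kron_tri (a - 1) (b - 1) (c - 1) p q.
Proof.
move=> a1 c1; rewrite /kron_core; case: ifP => // /negbT; rewrite negb_and -!leNgt => out.
by rewrite kron_tri_out //; lia.
Qed.

Lemma kron_core_diff2 (a b c p q : int) : 0 <= a -> 0 <= c ->
  diff2 kron_core a b c p q = ind [&& 0 < a, 0 < c, 0 <= p, 0 <= q & p + q < b].
Proof.
move=> a0 c0; have [/andP[a1 c1]|out] := boolP ((0 < a) && (0 < c)).
  rewrite a1 c1 (_ : [&& true, _ & _] = tri (b - 1) p q); last by rewrite /tri; lia.
  rewrite -(kron_tri_diff2 (a - 1) _ (c - 1)) /diff2 !kron_coreE; [|lia ..].
  by rewrite ![_ - 2 - 1]addrAC.
rewrite /diff2 /kron_core (negbTE out) andbA (negbTE out) /=.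
by do 3 (rewrite ifF; [|lia]); rewrite !subr0 ?addr0.
Qed.

Lemma kron_apex_diff2 (a b c p q : int) : 0 <= a -> 0 <= c -> 0 <= a + c + 2 * p ->
  0 <= a + c + 2 * q ->
  diff2 (fun a b c p q => ind (kron_apex a b c p q)) a b c p q = ind (oddtri a b c p q).
Proof.
move=> a0 c0 m0 n0; rewrite /diff2 /kron_apex.
rewrite (_ : a - 2 + c + (p + 1) + (q + 1) = a + c + p + q); last by lia.
rewrite (_ : a + (c - 2) + (p + 1) + (q + 1) = a + c + p + q); last by lia.
rewrite (_ : a - 2 + (c - 2) + (p + 2) + (q + 2) = a + c + p + q); last by lia.
have evB x : odd_int (x - 2) = odd_int x by rewrite /odd_int; lia.
rewrite !evB a0 c0 /=.
case: (boolP (odd_int a)) => [oa|ea].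
  rewrite !andbF (_ : oddtri _ _ _ _ _ = false) ?/ind ?subr0 ?addr0 //.
  by move: oa; rewrite /oddtri /odd_int; lia.
case: (boolP (odd_int c)) => [oc|ec].
  rewrite !andbF (_ : oddtri _ _ _ _ _ = false) ?/ind ?subr0 ?addr0 //.
  by move: oc; rewrite /oddtri /odd_int; lia.
rewrite /= !subr_ge0.
have [a2|a2] := lerP 2 a; have [c2|c2] := lerP 2 c; rewrite ?a2 ?c2 ?andbF /=.
- rewrite (_ : oddtri _ _ _ _ _ = false) /ind ?mulr0n; [by lra | by rewrite /oddtri; lia].
- rewrite (_ : oddtri _ _ _ _ _ = false) /ind ?mulr0n; [by lra | by rewrite /oddtri; lia].
- rewrite (_ : oddtri _ _ _ _ _ = false) /ind ?mulr0n; [by lra | by rewrite /oddtri; lia].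
have Da : a = 0 by move: ea; rewrite /odd_int; lia.
have Dc : c = 0 by move: ec; rewrite /odd_int; lia.
rewrite /ind mulr0n !subr0 ?addr0; congr (_ : bool)%:R.
by rewrite Da Dc /oddtri /tri /odd_int; lia.
Qed.

Lemma kron_outer_diff2 (a b c p q : int) : 0 <= b -> 0 <= a + c + 2 * p ->
  diff2 kron_outer a b c p q = ind (outer a b c p q).
Proof.
move=> b0 m0; rewrite /diff2 /kron_outer.
rewrite (_ : (p + 1 < q + 1) = (p < q)) 1?(_ : (p + 2 < q + 2) = (p < q)); [|lia..].
case: ifP => [lt_pq|ge_pq]; last by rewrite (_ : outer _ _ _ _ _
  = false) ?subr0 ?addr0 // /outer; lia.
set hi := Num.min _ _; set D := a + p; set D' := - (c + p) - 1; set lo := - q - 1.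
have -> : ind (outer a b c p q)
    = ind ((0 <= hi) && (0 <= D)) - ind ((0 <= hi) && (0 <= D'))
      - (ind ((0 <= lo) && (0 <= D)) - ind ((0 <= lo) && (0 <= D'))).
  have le_D : (0 <= D') ==> (0 <= D) by rewrite /D /D'; lia.
  have le_lo : (0 <= lo) ==> (0 <= hi) by rewrite /lo /hi; lia.
  rewrite (_ : outer _ _ _ _ _ = [&& 0 <= hi, ~~ (0 <= lo), 0 <= D & ~~ (0 <= D')]);
    last first.
    by rewrite /outer /lo /hi /D /D'; lia.
  by move: le_D le_lo; do 4 case: (0 <= _).
rewrite -!cone_rec.
rewrite (_ : a - 2 + (p + 1) = D - 1); last by rewrite /D; lia.
rewrite (_ : a - 2 + (p + 2) = D); last by rewrite /D; lia.
rewrite (_ : a + (p + 1) = D + 1); last by rewrite /D; lia.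
rewrite (_ : - (c + (p + 1)) - 1 = D' - 1); last by rewrite /D'; lia.
rewrite (_ : - (c - 2 + (p + 1)) - 1 = D' + 1); last by rewrite /D'; lia.
rewrite (_ : - (c - 2 + (p + 2)) - 1 = D'); last by rewrite /D'; lia.
rewrite (_ : Num.min (- (p + 1) - 1) _ = hi - 1); last by rewrite /hi; lia.
rewrite (_ : Num.min (- (p + 2) - 1) _ = hi - 2); last by rewrite /hi; lia.
rewrite (_ : - (q + 1) - 1 = lo - 1); last by rewrite /lo; lia.
rewrite (_ : - (q + 2) - 1 = lo - 2); last by rewrite /lo; lia.
by lra.
Qed.

Lemma cone_out (n D : int) : n + D < 0 -> cone n D = 0.
Proof.
move=> nD; rewrite /cone; case: ifP => D0; last by rewrite half_triangle_out.
by rewrite triangle_out ?half_triangle_out ?subrr //; lia.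
Qed.

Lemma cone_full (n D : int) : n <= D -> cone n D = triangle n.
Proof.
move=> le_nD; rewrite /cone; case: ifP => D0;
  first by rewrite half_triangle_out ?subr0 //; lia.
by rewrite half_triangle_out ?triangle_out //; lia.
Qed.

Lemma kron_outer_out (a b c p q : int) : 0 <= b -> 0 <= a + c + 2 * p ->
  (a < 0) || (c < 0) ->
  kron_outer a b c p q = 0.
Proof.
move=> b0 m0; rewrite /kron_outer; case: ifP => // lt_pq /orP[lt0|lt0].
  by rewrite !cone_out ?subrr //; lia.
by rewrite !cone_full ?subrr //; lia.
Qed.

Definition kron_closed (a b c p q : int) : rat :=
  kron_tri a b c p q + kron_core a b c p q - ind (kron_apex a b c p q)
  + kron_outer a b c p q + kron_outer a b c q p.

Lemma kron_closed_diff2 (a b c p q : int) : 0 <= a -> 0 <= c -> 0 <= b ->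
  0 <= a + c + 2 * p -> 0 <= a + c + 2 * q ->
  diff2 kron_closed a b c p q = (corner a b c p q)%:~R.
Proof.
move=> a0 c0 b0 m0 n0; rewrite corner_split // !(intrD, intrN).
have P2 x : (Posz x)%:~R = x%:R :> rat by [].
rewrite !P2 -/(ind _) -![(nat_of_bool _)%:R]/(ind _).
rewrite -(kron_tri_diff2 a b c) -kron_core_diff2 // -kron_apex_diff2 //
  -!kron_outer_diff2 //.
by rewrite /diff2 /kron_closed; lra.
Qed.

(** Both sides have second difference [corner] for nonnegative a and c, and vanish when a or c is
    negative; the steps of length 2 reach no further than -2. *)
Lemma kron_closedE (a b c p q : int) : 0 <= b -> - 2 <= a -> - 2 <= c ->
  0 <= a + c + 2 * p -> 0 <= a + c + 2 * q ->
  kron_closed a b c p q = (kron a b c p q)%:~R.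
Proof.
move=> b0; have [n] := ubnP `|(a + c + 4)%R|%N;
  elim: n a c p q => // n IH a c p q ltn a2 c2 m0 n0.
have [out|/norP[]] := boolP ((a < 0) || (c < 0)).
  rewrite kron_out; last by move: out; clear; lia.
  rewrite /kron_closed kron_tri_out // kron_outer_out // kron_outer_out //.
  rewrite /kron_core ifF; last by move: out; clear; lia.
  rewrite (_ : kron_apex _ _ _ _ _ = false) //.
  by move: out; rewrite /kron_apex; clear; lia.
rewrite -!leNgt => a0 c0.
have := kron_closed_diff2 a0 c0 b0 m0 n0;
  rewrite /diff2 (IH (a - 2) c) ?(IH a (c - 2)) ?(IH (a - 2) (c - 2)); [|lia..].
by move=> E; rewrite kron_rec intrD -E intrB intrD; lra.
Qed.

(** * Piecewise polynomial functions of the weight *)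

Definition form := ('rV[int]_7 * int)%type.
Definition form_eval (w : form) (chi : 'rV[int]_7) : int :=
  \sum_i w.1 ord0 i * chi ord0 i + w.2.

Definition affine (f : 'rV[int]_7 -> int) : Prop := exists w, f =1 form_eval w.

Lemma affine_const (k : int) : affine (fun=> k).
Proof.
exists (0, k) => chi; rewrite /form_eval big1 ?add0r // => i _.
by rewrite mxE mul0r.
Qed.

Lemma affine_coord i : affine (fun chi => chi ord0 i).
Proof.
exists (delta_mx ord0 i, 0) => chi; rewrite /form_eval (bigD1 i) //= !mxE !eqxx mul1r.
by rewrite big1 ?addr0 // => j /negbTE ne_ji; rewrite !mxE ne_ji andbF mul0r.
Qed.

Lemma affineD f g : affine f -> affine g -> affine (fun chi => f chi + g chi).
Proof.
move=> [w fE] [w' gE]; exists (w.1 + w'.1, w.2 + w'.2) => chi.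
rewrite fE gE /form_eval addrACA -big_split; congr (_ + _).
by apply: eq_bigr => i _; rewrite mxE mulrDl.
Qed.

Lemma affineN f : affine f -> affine (fun chi => - f chi).
Proof.
move=> [w fE]; exists (- w.1, - w.2) => chi.
rewrite fE /form_eval opprD -sumrN; congr (_ + _).
by apply: eq_bigr => i _; rewrite mxE mulNr.
Qed.

Lemma affine_coset f chi kappa : affine f -> same_coset 2 chi kappa ->
  odd_int (f chi) = odd_int (f kappa).
Proof.
move=> [w fE] [y _ ->]; rewrite !fE /form_eval.
have -> : \sum_i w.1 ord0 i * (kappa
  + y *+ 2) ord0 i = \sum_i w.1 ord0 i * kappa ord0 i + 2 * \sum_i w.1 ord0 i * y ord0 i.
  rewrite mulr_sumr -big_split; apply: eq_bigr => i _.
  by rewrite /= mxE mulmxnE; ring.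
by rewrite /odd_int; lia.
Qed.

(* Doubled, such functions are affine up to one of finitely many corrections,
   which is determined by the coset. *)
Definition halfaffine (f : 'rV[int]_7 -> int) : Prop :=
  exists (w : form) (E : seq int), forall kappa, exists2 e, e \in E &
    forall chi, same_coset 2 chi kappa -> 2 * f chi = form_eval w chi + e.

Lemma affine_half f : affine f -> halfaffine f.
Proof.
move=> aff_f; have [w fE] := affineD aff_f aff_f; exists w, [:: 0] => kappa.
by exists 0 => // chi _; rewrite -fE; lia.
Qed.

Lemma halfaffine_floor f : affine f -> halfaffine (fun chi => floor_half (f chi)).
Proof.
move=> aff_f; have [w fE] := aff_f; exists w, [:: 0; -1] => kappa.
exists (if odd_int (f kappa) then -1 else 0) => [|chi same]; first by case: odd_int.
rewrite -(affine_coset aff_f same) -fE /floor_half /odd_int.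
case: ifP; lia.
Qed.

Lemma halfaffineD f g : halfaffine f -> halfaffine g ->
  halfaffine (fun chi => f chi + g chi).
Proof.
move=> [w [E fE]] [w' [E' gE]].
have [w2 wE] := affineD (ex_intro _ w (frefl _)) (ex_intro _ w' (frefl _)).
exists w2, [seq e + e' | e <- E, e' <- E'] => kappa.
have [e e_in {}fE] := fE kappa; have [e' e'_in {}gE] := gE kappa.
exists (e + e') => [|chi same]; first exact: allpairs_f.
by rewrite mulrDr fE // gE // -wE addrACA.
Qed.

Lemma halfaffineN f : halfaffine f -> halfaffine (fun chi => - f chi).
Proof.
move=> [w [E fE]]; have [w2 wE] := affineN (ex_intro _ w (frefl _)).
exists w2, [seq - e | e <- E] => kappa.
have [e e_in {}fE] := fE kappa; exists (- e) => [|chi same]; first exact: map_f.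
by rewrite mulrN fE // -wE opprD.
Qed.

Definition on_weights (P : {mpoly rat[7]}) (chi : 'rV[int]_7) : rat := P.@[rat_weight chi
  ord0].

(** Any boolean list may be prescribed, even one that no weight attains; operations on such
    functions then simply concatenate the lists of forms. *)
Definition piecewise_poly (F : 'rV[int]_7 -> rat) : Prop :=
  exists W : seq form, forall (signs : seq bool) kappa, exists P : {mpoly rat[7]},
    forall chi, [seq 0 <= form_eval w chi | w <- W] = signs -> same_coset 2 chi kappa ->
    F chi = on_weights P chi.

Lemma piecewise_ext F G : F =1 G -> piecewise_poly F -> piecewise_poly G.
Proof.
move=> FG [W FW]; exists W => signs kappa; have [P FP] := FW signs kappa.
by exists P => chi sg same; rewrite -FG FP.
Qed.

Section Binary.
Variable op : rat -> rat -> rat.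
Variable mop : {mpoly rat[7]} -> {mpoly rat[7]} -> {mpoly rat[7]}.
Hypothesis mopE : forall P Q chi, on_weights (mop P Q) chi
  = op (on_weights P chi) (on_weights Q chi).

Lemma piecewise_op F G : piecewise_poly F -> piecewise_poly G ->
  piecewise_poly (fun chi => op (F chi) (G chi)).
Proof.
move=> [W FW] [W' GW]; exists (W ++ W') => signs kappa.
have [P FP] := FW (take (size W) signs) kappa;
  have [Q GQ] := GW (drop (size W) signs) kappa.
exists (mop P Q) => chi sg same; rewrite mopE FP ?GQ // -sg.
  by rewrite map_cat drop_size_cat ?size_map.
by rewrite map_cat take_size_cat ?size_map.
Qed.

End Binary.

Lemma piecewiseD F G : piecewise_poly F -> piecewise_poly G ->
  piecewise_poly (fun chi => F chi + G chi).
Proof. by apply: (@piecewise_op _ (fun P Q => P + Q)) => P Q chi;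
  rewrite /on_weights mevalD. Qed.

Lemma piecewiseB F G : piecewise_poly F -> piecewise_poly G ->
  piecewise_poly (fun chi => F chi - G chi).
Proof. by apply: (@piecewise_op (fun x y => x - y) (fun P Q => P - Q)) => P Q chi;
  rewrite /on_weights mevalB. Qed.

Lemma piecewiseM F G : piecewise_poly F -> piecewise_poly G ->
  piecewise_poly (fun chi => F chi * G chi).
Proof. by apply: (@piecewise_op _ (fun P Q => P * Q)) => P Q chi;
  rewrite /on_weights mevalM. Qed.

Lemma piecewise_const k : piecewise_poly (fun=> k).
Proof. by exists [::] => signs kappa; exists k%:MP => chi _ _;
  rewrite /on_weights mevalC. Qed.

Definition form_poly (w : form) : {mpoly rat[7]} :=
  \sum_i ((w.1 ord0 i)%:~R : rat)%:MP * 'X_i + (w.2%:~R : rat)%:MP.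

Lemma form_polyE w chi : on_weights (form_poly w) chi = (form_eval w chi)%:~R.
Proof.
rewrite /on_weights /form_poly mevalD mevalC rmorph_sum /= intrD; congr (_ + _).
rewrite [RHS](rmorph_sum (intr : int -> rat)); apply: eq_bigr => i _.
by rewrite mevalM mevalC mevalXU mxE /= intrM.
Qed.

Lemma piecewise_halfaffine f : halfaffine f -> piecewise_poly (fun chi => (f chi)%:~R).
Proof.
move=> [w [E fE]]; exists [::] => signs kappa; have [e _ {}fE] := fE kappa.
exists ((form_poly w + (e%:~R)%:MP) * (1 / 2)%:MP) => chi _ same.
rewrite /on_weights mevalM mevalD !mevalC -/(on_weights _ _) form_polyE -intrD -fE //.
by rewrite intrM; field.
Qed.

Lemma piecewise_if f F G : halfaffine f -> piecewise_poly F -> piecewise_poly G ->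
  piecewise_poly (fun chi => if 0 <= f chi then F chi else G chi).
Proof.
move=> [w [E fE]] [W FW] [W' GW].
(* The correction [e] depends on the coset but the list of forms must not; so every possible
   correction contributes a form, and the sign of the relevant one is looked up. *)
pose WE := [seq (w.1, w.2 + e) | e <- E]; exists (WE ++ W ++ W') => signs kappa.
have [e e_in {}fE] := fE kappa.
have [P FP] := FW (take (size W) (drop (size E) signs)) kappa.
have [Q GQ] := GW (drop (size W) (drop (size E) signs)) kappa.
exists (if nth false signs (index e E) then P else Q) => chi sg same.
rewrite !map_cat -map_comp in sg.
have signs_e : nth false signs (index e E) = (0 <= f chi).
  rewrite -sg nth_cat size_map index_mem e_in (nth_map 0) ?index_mem // nth_index //=.
  rewrite -[RHS](@pmulr_rge0 _ 2) // fE // /form_eval /=; congr (0 <= _); lia.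
rewrite signs_e; case: ifP => _.
  by rewrite FP // -sg drop_size_cat ?size_map // take_size_cat ?size_map.
by rewrite GQ // -sg drop_size_cat ?size_map // drop_size_cat ?size_map.
Qed.

(** The parity of an affine function is constant on a coset, so it adds no wall of its own. *)
Lemma piecewise_odd f (F : bool -> 'rV[int]_7 -> rat) : affine f ->
  (forall r, piecewise_poly (F r)) ->
  piecewise_poly (fun chi => F (odd_int (f chi)) chi).
Proof.
move=> aff_f ppF; have [W FW] := ppF true; have [W' GW] := ppF false.
exists (W ++ W') => signs kappa; case Dr: (odd_int (f kappa)).
  have [P FP] := FW (take (size W) signs) kappa; exists P => chi sg same.
  by rewrite (affine_coset aff_f same) Dr FP // -sg map_cat take_size_cat ?size_map.
have [P FP] := GW (drop (size W) signs) kappa; exists P => chi sg same.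
by rewrite (affine_coset aff_f same) Dr FP // -sg map_cat drop_size_cat ?size_map.
Qed.

Lemma halfaffine_const k : halfaffine (fun=> k).
Proof. exact/affine_half/affine_const. Qed.

Lemma halfaffineB f g : halfaffine f -> halfaffine g ->
  halfaffine (fun chi => f chi - g chi).
Proof. by move=> hf hg; apply: halfaffineD hf (halfaffineN hg). Qed.

Lemma affineB f g : affine f -> affine g -> affine (fun chi => f chi - g chi).
Proof. by move=> hf hg; apply: affineD hf (affineN hg). Qed.

Lemma piecewise_min (F : int -> 'rV[int]_7 -> rat) f g : halfaffine f -> halfaffine g ->
  piecewise_poly (fun chi => F (f chi) chi) ->
    piecewise_poly (fun chi => F (g chi) chi) ->
  piecewise_poly (fun chi => F (Num.min (f chi) (g chi)) chi).
Proof.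
move=> hf hg ppf ppg.
apply: piecewise_ext (piecewise_if (halfaffineB hg hf) ppf ppg) => chi.
by rewrite subr_ge0; case: lerP.
Qed.

Lemma piecewise_triangle f : halfaffine f -> piecewise_poly (fun chi => triangle (f chi)).
Proof.
move=> hf; have pp k := piecewise_halfaffine (halfaffineD hf (halfaffine_const k)).
exact: piecewise_if hf (piecewiseM (piecewiseM (pp 1) (pp 2)) (piecewise_const _))
  (piecewise_const 0).
Qed.

(** The argument must be affine and not merely half-affine: the parity of a rounded half is not
    determined by the coset of 2 Lambda. *)
Lemma piecewise_half_triangle f : affine f ->
  piecewise_poly (fun chi => half_triangle (f chi)).
Proof.
move=> aff_f; have hf := affine_half aff_f.
have pp := piecewise_halfaffine (halfaffineD hf (halfaffine_const 2)).
apply: piecewise_if hf _ (piecewise_const 0).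
apply: (piecewise_odd (F := fun r chi => ((f chi + 2)%:~R ^+ 2 - r%:R) / 4)) => // r.
exact: piecewiseM (piecewiseB (piecewiseM pp pp) (piecewise_const _)) (piecewise_const _).
Qed.

Lemma piecewise_box A C n : halfaffine A -> halfaffine C -> halfaffine n ->
  piecewise_poly (fun chi => box (A chi) (C chi) (n chi)).
Proof.
move=> hA hC hn; have h1 := halfaffine_const 1; have h2 := halfaffine_const 2.
apply: piecewiseD; first apply: piecewiseB; first apply: piecewiseB;
  apply: piecewise_triangle => //.
- exact: halfaffineB (halfaffineB hn hA) h1.
- exact: halfaffineB (halfaffineB hn hC) h1.
- exact: halfaffineB (halfaffineB (halfaffineB hn hA) hC) h2.
Qed.

Lemma piecewise_cone n D : affine n -> affine D ->
  piecewise_poly (fun chi => cone (n chi) (D chi)).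
Proof.
move=> an aD; apply: (piecewise_if (affine_half aD)).
  apply: piecewiseB; first exact: piecewise_triangle (affine_half an).
  exact: piecewise_half_triangle (affineB (affineB an aD) (affine_const 1)).
exact: piecewise_half_triangle (affineD an aD).
Qed.

Lemma piecewise_band A C lo hi : halfaffine A -> halfaffine C -> halfaffine lo ->
  halfaffine hi ->
  piecewise_poly (fun chi => band (A chi) (C chi) (lo chi) (hi chi)).
Proof.
move=> hA hC hlo hhi.
apply: (piecewise_ext (F := fun chi => if 0 <= hi chi - lo chi then
   box (A chi) (C chi) (hi chi) - box (A chi) (C chi) (lo chi - 1) else 0)).
  by move=> chi; rewrite subr_ge0.
apply: piecewise_if (halfaffineB hhi hlo) _ (piecewise_const 0).
apply: piecewiseB; apply: piecewise_box => //.
exact: halfaffineB hlo (halfaffine_const 1).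
Qed.

Section KroneckerCoordinates.
Variables a b c p q : 'rV[int]_7 -> int.
Hypotheses (aa : affine a) (ab : affine b) (ac : affine c) (ap : affine p) (aq : affine
  q).

Lemma piecewise_kron_tri : piecewise_poly (fun chi => kron_tri (a chi) (b chi) (c chi) (p
  chi) (q chi)).
Proof.
have hA := halfaffine_floor aa; have hC := halfaffine_floor ac.
have hB := halfaffine_floor (affineB (affineB ab ap) aq).
have hp := affine_half (affineN ap); have hq := affine_half (affineN aq).
apply: (piecewise_ext (F := fun chi => if 0 <= - p chi - - q chi
   then band (floor_half (a chi)) (floor_half (c chi)) (- p chi) (floor_half (b chi - p
     chi - q chi))
   else band (floor_half (a chi)) (floor_half (c chi)) (- q chi) (floor_half (b chi - p
     chi - q chi)))).
  by move=> chi; rewrite subr_ge0 /kron_tri; case: lerP.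
by apply: piecewise_if (halfaffineB hp hq) _ _; apply: piecewise_band.
Qed.

Lemma piecewise_kron_outer : piecewise_poly (fun chi => kron_outer (a chi) (b chi) (c
  chi) (p chi) (q chi)).
Proof.
have a1 := affine_const 1; have aD := affineD aa ap;
  have aD' := affineB (affineN (affineD ac ap)) a1.
have alo := affineB (affineN aq) a1; have ahi := affineB (affineN ap) a1;
  have abq := affineB ab aq.
apply: (piecewise_ext (F := fun chi => if 0 <= q chi - p chi - 1 then
    cone (Num.min (- p chi - 1) (b chi - q chi)) (a chi + p chi)
    - cone (Num.min (- p chi - 1) (b chi - q chi)) (- (c chi + p chi) - 1)
    - (cone (- q chi - 1) (a chi + p chi) - cone (- q chi - 1) (- (c chi
      + p chi) - 1)) else 0)).
  move=> chi; rewrite /kron_outer (_ : (0 <= q chi - p chi - 1) = (p chi < q chi)) //;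
    lia.
apply: piecewise_if (affine_half (affineB (affineB aq ap) a1)) _ (piecewise_const 0).
apply: piecewiseB; last by apply: piecewiseB; apply: piecewise_cone.
have hhi := affine_half ahi; have hbq := affine_half abq.
apply: piecewiseB.
  by apply: (piecewise_min (F := fun n chi => cone n (a chi + p chi))) => //;
    apply: piecewise_cone.
by apply: (piecewise_min (F := fun n chi => cone n (- (c chi + p chi) - 1))) => //;
  apply: piecewise_cone.
Qed.

Lemma piecewise_guard f F : affine f -> piecewise_poly F ->
  piecewise_poly (fun chi => if 0 <= f chi then F chi else 0).
Proof. by move=> af ppF; apply: piecewise_if (affine_half af) ppF (piecewise_const 0).
  Qed.

Lemma piecewise_kron_apex : piecewise_poly (fun chi => ind (kron_apex (a chi) (b chi) (c
  chi) (p chi) (q chi))).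
Proof.
have as_ := affineD (affineD (affineD aa ac) ap) aq.
have abs := affineB ab as_.
apply: (piecewise_ext (F := fun chi => if 0 <= a chi then if 0 <= c chi then
   if 0 <= b chi - (a chi + c chi + p chi + q chi) then
     (~~ odd_int (a chi))%:R * (~~ odd_int (c chi))%:R
     * (odd_int (b chi - (a chi + c chi + p chi + q chi)))%:R else 0 else 0 else 0)).
  move=> chi; rewrite /kron_apex subr_ge0; do 2 (case: ifP => // _).
  case: ifP => _; last by rewrite /= !andbF.
  by do 3 case: odd_int; rewrite /ind ?mulr0 ?mul0r ?mulr1.
do 3 (apply: piecewise_guard => //).
apply: piecewiseM; first apply: piecewiseM.
- by apply: (piecewise_odd (F := fun r _ => (~~ r)%:R)) => // r; apply: piecewise_const.
- by apply: (piecewise_odd (F := fun r _ => (~~ r)%:R)) => // r; apply: piecewise_const.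
- by apply: (piecewise_odd (F := fun r _ => r%:R) abs) => // r; apply: piecewise_const.
Qed.

End KroneckerCoordinates.

Lemma piecewise_kron_closed a b c p q : affine a -> affine b -> affine c -> affine p ->
  affine q ->
  piecewise_poly (fun chi => kron_closed (a chi) (b chi) (c chi) (p chi) (q chi)).
Proof.
move=> aa ab ac ap aq; have a1 := affine_const 1.
apply: piecewiseD; last exact: piecewise_kron_outer.
apply: piecewiseD; last exact: piecewise_kron_outer.
apply: piecewiseB; last exact: piecewise_kron_apex.
apply: piecewiseD; first exact: piecewise_kron_tri.
apply: (piecewise_ext (F := fun chi => if 0 <= a chi - 1 then if 0 <= c chi - 1 then
   kron_tri (a chi - 1) (b chi - 1) (c chi - 1) (p chi) (q chi) else 0 else 0)).
  move=> chi; rewrite /kron_core (_ : (0 <= a chi - 1) = (0 < a chi)); last by lia.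
  rewrite (_ : (0 <= c chi - 1) = (0 < c chi)); last by lia.
  by do 2 case: (0 < _).
do 2 (apply: piecewise_guard; first exact: affineB).
by apply: (piecewise_kron_tri (a := fun chi => a chi - 1) (b := fun chi => b chi - 1)
  (c := fun chi => c chi - 1)) => //; apply: affineB.
Qed.

(** * The chambers *)

Lemma affine_evalD x : {morph affine_eval^~ x : phi psi / phi + psi}.
Proof.
move=> phi psi; rewrite /affine_eval addrACA -big_split; congr (_ + _).
by apply: eq_bigr => i _; rewrite mxE mulrDl.
Qed.

Lemma affine_eval0 x : affine_eval 0 x = 0.
Proof. by rewrite /affine_eval addr0 big1 // => i _; rewrite mxE mul0r. Qed.

Lemma affine_evalN phi x : affine_eval (- phi) x = - affine_eval phi x.
Proof. by apply/eqP; rewrite -addr_eq0 -affine_evalD addNr affine_eval0. Qed.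

(* The hyperplane [w = - 1 / 2], on which no lattice point lies. *)
Definition wall (w : form) : affine_form :=
  (\row_i (2 * w.1 ord0 i)%:~R, (2 * w.2 + 1)%:~R).

Lemma wall_eval w chi : affine_eval (wall w) (rat_weight chi) = (2 * form_eval w chi
  + 1)%:~R.
Proof.
rewrite /affine_eval /form_eval mulrDr mulr_sumr -addrA [RHS]intrD; congr (_ + _).
by rewrite [RHS](rmorph_sum (intr : int -> rat)); apply: eq_bigr => i _;
  rewrite !mxE -intrM mulrA.
Qed.

Definition side (s : bool) (w : form) : affine_form := if s then wall w else - wall w.

(** Because 2 w + 1 is odd at lattice points, the closed half spaces on the two sides of a wall
    separate w >= 0 from w < 0 there. *)
Lemma side_lattice s w chi : (0 <= affine_eval (side s w) (rat_weight chi))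
  = ((0 <= form_eval w chi) == s).
Proof.
rewrite /side; case: s; rewrite ?affine_evalN wall_eval ?oppr_ge0 ?ler0z ?lerz0; lia.
Qed.

Definition coord_form (i : 'I_7) : affine_form := (delta_mx ord0 i, 0).

Lemma coord_formE i x : affine_eval (coord_form i) x = x ord0 i.
Proof.
rewrite /affine_eval (bigD1 i) //= !mxE !eqxx mul1r addr0.
by rewrite big1 ?addr0 // => j /negbTE ne_ji; rewrite !mxE ne_ji andbF mul0r.
Qed.

Definition dominant_cone : polyhedron :=
  let L1 := coord_form (@Ordinal 7 0 isT) in let L2 := coord_form (@Ordinal 7 1 isT) in
  let L3 := coord_form (@Ordinal 7 2 isT) in let M1 := coord_form (@Ordinal 7 3 isT) in
  let M2 := coord_form (@Ordinal 7 4 isT) in let N1 := coord_form (@Ordinal 7 5 isT) in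
  let N2 := coord_form (@Ordinal 7 6 isT) in
  let e1 := L1 + L2 + L3 - (M1 + M2) in let e2 := L1 + L2 + L3 - (N1 + N2) in
  [:: e1; - e1; e2; - e2; L1 - L2; L2 - L3; L3; M1 - M2; M2; N1 - N2; N2].

Lemma dominant_coneP x : reflect (admissible_space x) (in_polyhedron dominant_cone x).
Proof.
rewrite /in_polyhedron /dominant_cone /= !(affine_evalN, affine_evalD) !coord_formE.
rewrite /admissible_space /equal_sizes /dominant.
move: (wL1 x) (wL2 x) (wL3 x) (wM1 x) (wM2 x) (wN1 x) (wN2 x) => L1 L2 L3 M1 M2 N1 N2.
rewrite !subr_ge0 !oppr_ge0 !subr_le0 andbT.
apply: (iffP idP) => [/and5P[e1 e2 e3 e4 dom]|[[e1 e2] dom]].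
  by split=> //; split; apply/le_anti/andP; split.
by rewrite -!e1 -!e2 !lexx.
Qed.

Section Chambers.
Variable W : seq form.
Local Notation n := (size W).
Local Notation w_ i := (tnth (in_tuple W) i).

Definition chamber (s : {ffun 'I_n -> bool}) : polyhedron :=
  dominant_cone ++ [seq side (s i) (w_ i) | i <- enum 'I_n].

Definition chambers : seq polyhedron := [seq chamber s | s : {ffun 'I_n -> bool}].

Lemma chamberP s x : in_polyhedron (chamber s) x <->
  admissible_space x /\ forall i, 0 <= affine_eval (side (s i) (w_ i)) x.
Proof.
rewrite /in_polyhedron all_cat -/(in_polyhedron _ x);
  split=> [/andP[/dominant_coneP adm /allP pos]|[adm pos]].
  by split=> // i; apply: pos; apply: map_f; rewrite mem_enum.
by apply/andP; split; [apply/dominant_coneP | apply/allP=> _ /mapP[i _ ->]].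
Qed.

(** Where the sign vectors differ, the defining forms of the two chambers are opposite. The sum of
    these forms is nonnegative on the first chamber and vanishes exactly where each of them does,
    that is, on the intersection. *)
Lemma chamber_face s s' :
  is_face (fun x => in_polyhedron (chamber s) x /\
    in_polyhedron (chamber s') x) (chamber s).
Proof.
exists (\sum_(i | s i != s' i) side (s i) (w_ i)).
have evalE x : affine_eval (\sum_(i | s i != s' i) side (s i) (w_ i)) x
    = \sum_(i | s i != s' i) affine_eval (side (s i) (w_ i)) x.
  exact: (big_morph _ (affine_evalD x) (affine_eval0 x)).
have flip i x : s i != s' i -> affine_eval (side (s' i) (w_ i)) x
  = - affine_eval (side (s i) (w_ i)) x.
  by rewrite /side; case: (s i); case: (s' i) => // _; rewrite affine_evalN ?opprK.
split=> [x /chamberP[_ pos]|x]; first by rewrite evalE sumr_ge0.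
rewrite evalE; split=> [[Cx Cx']|[Cx sum0]].
  split=> //; apply: big1 => i ne_i; apply/le_anti.
  have [[_ pos] [_ pos']] := (iffLR (chamberP s x) Cx, iffLR (chamberP s' x) Cx').
  by rewrite pos andbT -oppr_ge0 -flip.
split=> //; have [adm pos] := iffLR (chamberP s x) Cx.
apply/chamberP; split=> // i; have [<-//|ne_i] := eqVneq (s i) (s' i).
have z := psumr_eq0P (fun i _ => pos i) sum0.
by rewrite flip // z ?oppr0.
Qed.

Lemma chambers_subdivision : polyhedral_subdivision admissible_space chambers.
Proof.
split=> [x|_ _ /imageP[s _ ->] /imageP[s' _ ->]].
  split=> [adm|[_ /imageP[s _ ->] /chamberP[]]] //.
  pose s := [ffun i => 0 <= affine_eval (wall (w_ i)) x].
  exists (chamber s); first exact: image_f.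
  apply/chamberP; split=> // i; rewrite ffunE /side; case: ifP => // /negbT.
  by rewrite -ltNge affine_evalN oppr_ge0 => /ltW.
split; first exact: chamber_face.
have [phi [pos phiE]] := chamber_face s' s; exists phi; split=> // x.
by rewrite -phiE and_comm.
Qed.

Lemma chamber_signs s chi : in_polyhedron (chamber s) (rat_weight chi) ->
  [seq 0 <= form_eval w chi | w <- W] = codom s.
Proof.
move=> /chamberP[_ pos].
transitivity [seq 0 <= form_eval w chi | w <- [seq w_ i | i <- enum 'I_n]].
  by rewrite map_tnth_enum.
rewrite -map_comp codomE; apply: eq_map => i /=.
by have := pos i; rewrite side_lattice => /eqP.
Qed.

End Chambers.

Lemma kronecker_piecewise : piecewise_quasipolynomial 2 kronecker.
Proof.
pose a (chi : 'rV[int]_7) := wL1 chi - wL2 chi.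
pose b (chi : 'rV[int]_7) := wL2 chi - wL3 chi.
pose c (chi : 'rV[int]_7) := wL3 chi.
pose p (chi : 'rV[int]_7) := wM1 chi - (a chi + b chi + (c chi + c chi)).
pose q (chi : 'rV[int]_7) := wN1 chi - (a chi + b chi + (c chi + c chi)).
have [aa ab ac] : [/\ affine a, affine b & affine c].
  by split; rewrite /a /b /c; do ?apply: affineB; apply: affine_coord.
have ax := affineD (affineD aa ab) (affineD ac ac).
have [ap aq] : affine p /\ affine q by split; apply: affineB => //; apply: affine_coord.
have [W FW] := piecewise_kron_closed aa ab ac ap aq.
exists (chambers W); first exact: chambers_subdivision.
move=> _ /imageP[s _ ->] kappa _; have [P FP] := FW (codom s) kappa.
exists P => lam mu nu adm /chamber_signs in_s same; rewrite -/(on_weights P _) -FP //.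
have [l01 l12 m01 n01 [Dmu Dnu]] := admissible_weight adm.
rewrite /p /q /a /b /c /weight /weight_row !mxE !(tnth_nth 0) /=.
rewrite -[LHS]/((kronecker lam mu nu)%:Z%:~R) kroneckerE // -kron_closedE; [|lia..].
by rewrite mulr_natl mulr2n.
Qed.

Theorem theorem5p4 :
  (forall lam mu nu : seq nat, admissible lam mu nu ->
     let chibar := reduced_weight (weight lam mu nu) in
     let chibar_swap := reduced_weight (weight lam nu mu) in
     (~~ dominant chibar -> kronecker lam mu nu = 0%N) /\
     (dominant chibar ->
      (kronecker lam mu nu)%:Z =
        if wM1 chibar - wM2 chibar <= wN1 chibar - wN2 chibar
        then kronecker_sum chibar
        else kronecker_sum chibar_swap))
  /\ piecewise_quasipolynomial 2 kronecker.
Proof.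
split; last exact: kronecker_piecewise.
move=> lam mu nu adm chibar chibar_swap; split; first exact: kronecker_not_dominant adm.
exact: (kronecker_formula adm).
Qed.
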